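(* Let $S$ be the minimal Laplacian on $L_2(0,1)$: $\mathcal{D}(S)=\{f\in H^2(0,1): f(0)=f(1)=f'(0)=f'(1)=0\}$, $Sf=-f''$, let $V\ge0$ be a bounded operator on $L_2(0,1)$ and let $A=S+\mathrm{i}V$ with $\mathcal{D}(A)=\mathcal{D}(S)$. Every maximally dissipative extension $\widehat A$ of $A$ belongs to exactly one of the cases listed below. Moreover, every operator in these cases is a maximally dissipative extension of $A$. (i) $\mathcal{D}(\widehat A)=\left\{f\in H^2(0,1):\begin{pmatrix} f(0) \\ f(1) \end{pmatrix}=\begin{pmatrix} c_{11} & c_{12} \\ c_{21} & c_{22} \end{pmatrix}\begin{pmatrix} f'(0) \\ -f'(1) \end{pmatrix}\right\}$, $\ \widehat Af=(S^*+\mathrm{i}V)f+f'(0)k_1-f'(1)k_2$, with $k_1,k_2\in\operatorname{rg}(V^{1/2})$ and $c_{jk}\in\mathbb{C}$ such that $$\operatorname{Im}\begin{pmatrix} c_{11} & c_{12} \\ c_{21} & c_{22} \end{pmatrix}^*\ge\frac14\begin{pmatrix} \|V^{-1/2}k_1\|^2 & \langle V^{-1/2}k_1,V^{-1/2}k_2\rangle \\ \langle V^{-1/2}k_2,V^{-1/2}k_1\rangle & \|V^{-1/2}k_2\|^2 \end{pmatrix}.$$ (ii) $\mathcal{D}(\widehat A)=\{f\in H^2(0,1): f(1)-\overline{c_{22}}f(0)=\overline{c_{22}}c_{12}f'(1),\ f'(0)-c_{22}f'(1)=0\}$, $\ \widehat Af=(S^*+\mathrm{i}V)f+f'(1)k_1$,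 with $k_1\in\operatorname{rg}(V^{1/2})$ and $c_{12},c_{22}\in\mathbb{C}$ such that $c_{22}\ne0$ and $\operatorname{Im}(c_{12}\overline{c_{22}})\ge\frac14\|V^{-1/2}k_1\|^2$. (iii) $\mathcal{D}(\widehat A)=\{f\in H^2(0,1): f(0)=c_{11}f'(0),\ f'(1)=0\}$, $\ \widehat Af=(S^*+\mathrm{i}V)f+f'(0)k_1$, with $k_1\in\operatorname{rg}(V^{1/2})$ and $c_{11}\in\mathbb{C}$ such that $\operatorname{Im}(\overline{c_{11}})\ge\frac14\|V^{-1/2}k_1\|^2$. (iv) $\mathcal{D}(\widehat A)=\{f\in H^2(0,1): f(1)=-c_{12}f'(1),\ f'(0)=0\}$, $\ \widehat Af=(S^*+\mathrm{i}V)f+f'(1)k_1$, with $k_1\in\operatorname{rg}(V^{1/2})$ and $c_{12}\in\mathbb{C}$ such that $\operatorname{Im}(\overline{c_{12}})\ge\frac14\|V^{-1/2}k_1\|^2$. (v) $\mathcal{D}(\widehat A)=\{f\in H^2(0,1): f'(0)=f'(1)=0\}$, $\ \widehat Af=(S^*+\mathrm{i}V)f$.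
   Context: $L_2(0,1)$ is complex with inner product linear in the second argument; $H^2(0,1)$ is the Sobolev space. The adjoint of $S$ is $S^*f=-f''$ with $\mathcal{D}(S^* )=H^2(0,1)$. A densely defined operator $T$ is dissipative if $\operatorname{Im}\langle x,Tx\rangle\ge0$ for all $x\in\mathcal{D}(T)$, and maximally dissipative if it is dissipative and has no non-trivial dissipative extension. $V^{1/2}$ is the non-negative square root of $V$ and $V^{-1/2}:\operatorname{rg}(V^{1/2})\to(\ker V)^\perp$ is the inverse of $V^{1/2}$ restricted to $(\ker V)^\perp$; $\operatorname{rg}$ denotes range. For a square matrix $M$, $\operatorname{Im}M:=\frac1{2\mathrm{i}}(M-M^* )$; matrix inequalities are in the sense of quadratic forms. *)

(* Defs.v *)
From HB Require Import structures.
From mathcomp Require Import all_boot all_order all_algebra.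
From mathcomp Require Import generic_quotient ring_quotient.
From mathcomp Require Import all_classical all_reals all_analysis.
From mathcomp Require Import complex.

Set Implicit Arguments.
Unset Strict Implicit.
Unset Printing Implicit Defensive.

Import Order.TTheory GRing.Theory Num.Theory.
Import numFieldNormedType.Exports.

Local Open Scope classical_set_scope.
Local Open Scope ring_scope.
Local Open Scope complex_scope.

Notation reC := (@complex.Re _).
Notation imC := (@complex.Im _).

Section L2.
Variable R : realType.
Local Notation C := R[i].
Local Notation mu := (@lebesgue_measure R).

Definition I01 : set R := `]0, 1[.

(* f restricted to (0,1) is in L^2, tested on its real and imaginary parts *)
Definition square_integrable (f : R -> C) : bool :=
  ((reC \o f) \_ I01 \in Lfun mu 2%:E) && ((imC \o f) \_ I01 \in Lfun mu 2%:E).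

Let restr_cmb (a b : R) (f g h k : R -> R) :
  f \_ I01 \in Lfun mu 2%:E -> g \_ I01 \in Lfun mu 2%:E ->
  h \_ I01 \in Lfun mu 2%:E ->
  (forall x, k x = a * f x + b * g x + h x) ->
  k \_ I01 \in Lfun mu 2%:E.
Proof.
move=> Lf Lg Lh kE.
have le12 : (1 <= 2%:E :> \bar R)%E by rewrite lee_fin ler1n.
have [_ cl] := @Lfun_submod_closed _ _ R mu _ le12.
have -> : k \_ I01 = a *: (f \_ I01) + (b *: (g \_ I01) + h \_ I01).
  apply/funext => x.
  rewrite /patch !fctE; case: ifP => _; first by rewrite kE addrA.
  by rewrite !scaler0 !addr0.
exact: cl Lf (cl _ _ _ Lg Lh).
Qed.

Lemma square_integrable_submod_closed : submod_closed square_integrable.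
Proof.
have le12 : (1 <= 2%:E :> \bar R)%E by rewrite lee_fin ler1n.
split.
  have [L0 _] := @Lfun_submod_closed _ _ R mu _ le12.
  suff H : ((fun=> 0) : R -> R) \_ I01 = 0 by apply/andP; rewrite /comp/= H.
  by apply/funext => x; rewrite /patch; case: ifP.
move=> a f g /andP[fr fi] /andP[gr gi]; apply/andP; split.
- apply: (restr_cmb (a := reC a) (b := - imC a) fr fi gr) => x /=.
  by rewrite !fctE; case: a (f x) (g x) => [? ?] [? ?] [? ?] /=; rewrite mulNr.
- apply: (restr_cmb (a := reC a) (b := imC a) fi fr gi) => x /=.
  by rewrite !fctE; case: a (f x) (g x) => [? ?] [? ?] [? ?] /=.
Qed.

HB.instance Definition _ :=
  GRing.isSubmodClosed.Build C (R -> C) square_integrable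
    square_integrable_submod_closed.

Record L2fun := L2Fun {
  L2fun_val :> R -> C;
  L2fun_square_integrable : L2fun_val \in square_integrable }.

HB.instance Definition _ := [isSub for L2fun_val].
HB.instance Definition _ := [Choice of L2fun by <:].
HB.instance Definition _ := [SubChoice_isSubLmodule of L2fun by <:].

Definition null_fun (f : L2fun) : bool := `[< ae_eq mu I01 f (cst 0) >].

Lemma null_fun_zmod_closed : zmod_closed null_fun.
Proof.
split=> [|f g /asboolP f0 /asboolP g0]; first by apply/asboolP/aeW.
apply/asboolP; apply: filterS2 f0 g0 => x f0 g0 Dx.
by rewrite [LHS]/= !fctE f0// g0// subr0.
Qed.

HB.instance Definition _ :=
  GRing.isZmodClosed.Build L2fun null_fun null_fun_zmod_closed.

Definition null_space : zmodClosed L2fun :=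
  GRing.ZmodClosed.clone L2fun null_fun _.

(* complex L_2(0,1): classes modulo equality a.e. on (0,1) *)
Definition L2 : Type := Quotient.quot null_space.
HB.instance Definition _ := GRing.Zmodule.on L2.
HB.instance Definition _ := EqQuotient.on L2.

Local Open Scope quotient_scope.

Definition L2_of : L2fun -> L2 := \pi_L2.
Definition L2_repr (f : L2) : L2fun := repr f.
Coercion L2_repr : L2 >-> L2fun.

Lemma L2_reprK : cancel L2_repr L2_of.
Proof. exact: reprK. Qed.

Lemma L2_of_eqP (f g : L2fun) : L2_of f = L2_of g <-> ae_eq mu I01 f g.
Proof.
have E : L2_of f = L2_of g <-> f - g \in null_space.
  by rewrite Quotient.idealrBE; split=> [/eqP|/eqP].
split=> [/E/asboolP fg|fg]; last apply/E/asboolP; apply: filterS fg => x fg Dx.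
  by apply/eqP; rewrite -subr_eq0; apply/eqP/fg.
by rewrite -[LHS]/(f x - g x) fg ?subrr.
Qed.

Lemma L2_reprE (f : L2fun) : ae_eq mu I01 (L2_of f : L2fun) f.
Proof. by apply/L2_of_eqP; rewrite L2_reprK. Qed.

Definition L2_scale (a : C) (f : L2) : L2 := L2_of (a *: (f : L2fun)).

Let L2_ofD (f g : L2fun) : L2_of (f + g) = L2_of f + L2_of g.
Proof. exact: (@Quotient.pi_add _ null_space). Qed.

Let L2_ofZ (a : C) (f : L2fun) : L2_of (a *: f) = L2_scale a (L2_of f).
Proof.
apply/L2_of_eqP; apply: filterS (L2_reprE f) => x fx Dx.
by rewrite -[LHS]/(a * f x) -[RHS]/(a * (L2_of f : L2fun) x) fx.
Qed.

Let scaleA a b f : L2_scale a (L2_scale b f) = L2_scale (a * b) f.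
Proof. by rewrite -(L2_reprK f) -!L2_ofZ scalerA. Qed.

Let scale1 : left_id 1 L2_scale.
Proof. by move=> f; rewrite -(L2_reprK f) -!L2_ofZ scale1r. Qed.

Let scaleDr : right_distributive L2_scale +%R.
Proof.
move=> a f g; rewrite -(L2_reprK f) -(L2_reprK g).
by rewrite -!L2_ofZ -!L2_ofD -L2_ofZ scalerDr.
Qed.

Let scaleDl f : {morph L2_scale^~ f : a b / a + b}.
Proof.
by move=> a b; rewrite -(L2_reprK f) -!L2_ofZ -!L2_ofD scalerDl.
Qed.

HB.instance Definition _ :=
  GRing.Zmodule_isLmodule.Build C L2 scaleA scale1 scaleDr scaleDl.

Definition cintegral (F : R -> C) : C :=
  (\int[mu]_(x in I01) reC (F x)) +i* (\int[mu]_(x in I01) imC (F x)).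

Definition inner (f g : L2) : C := cintegral (fun x => (f x)^*%C * g x).

Definition L2norm (f : L2) : R := Num.sqrt (reC (inner f f)).

(* C^1 functions with compact support in (0,1), extended by 0 to the line *)
Definition test_fun (phi : R -> R) : Prop :=
  [/\ forall x, derivable phi x 1,
      continuous (derive1 phi : R -> R) &
      exists a b, [/\ 0 < a, a <= b, b < 1 &
                      forall x, x \notin `[a, b] -> phi x = 0]].

(* Weak derivatives are tested against real C^1_c functions (as in Brezis,
   Functional Analysis, Sobolev Spaces and PDE, Chapter 8); by linearity this
   is the same as testing against complex ones. *)
Definition weak_deriv (f g : L2) : Prop :=
  forall phi, test_fun phi ->
    cintegral (fun x => f x * (derive1 phi x)%:C) =
    - cintegral (fun x => g x * (phi x)%:C).

(* the weak derivative f' when f is in H^1(0,1), and 0 otherwise *)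
Definition wderiv (f : L2) : L2 := xget 0 [set g | weak_deriv f g].

Definition H1 : set L2 := [set f | exists g, weak_deriv f g].
Definition H2 : set L2 := [set f | H1 f /\ H1 (wderiv f)].

(* f(x) for x in [0,1]: the value at x of the representative of f that is
   continuous on [0,1] (0 when there is none) *)
Definition trace (f : L2) (x : R) : C :=
  xget 0 [set c | exists F : R -> C,
    [/\ {within `[0, 1], continuous (reC \o F : R -> R)},
        {within `[0, 1], continuous (imC \o F : R -> R)},
        ae_eq mu I01 f F & F x = c]].

End L2.

Section operators.
Variable R : realType.
Local Notation C := R[i].
Local Notation L2 := (L2 R).

(* Possibly unbounded operators: only the values of [act] on [dom] matter. *)
Record operator := Operator { dom : set L2; act : L2 -> L2 }.

Definition linear_operator (T : operator) : Prop :=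
  dom T 0 /\
  forall (a : C) f g, dom T f -> dom T g ->
    dom T (a *: f + g) /\ act T (a *: f + g) = a *: act T f + act T g.

Definition densely_defined (T : operator) : Prop :=
  forall (f : L2) (e : R), 0 < e -> exists2 g, dom T g & L2norm (f - g) < e.

(* T' is an extension of T *)
Definition extension (T' T : operator) : Prop :=
  dom T `<=` dom T' /\ forall f, dom T f -> act T' f = act T f.

Definition op_eq (T T' : operator) : Prop := extension T T' /\ extension T' T.

Definition dissipative (T : operator) : Prop :=
  [/\ linear_operator T, densely_defined T &
      forall f, dom T f -> 0 <= imC (inner f (act T f))].

Definition maximally_dissipative (T : operator) : Prop :=
  dissipative T /\
  forall T', dissipative T' -> extension T' T -> op_eq T' T.

Definition adjoint (T : operator) : operator :=
  let adj f g := forall h, dom T h -> inner f (act T h) = inner g h in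
  Operator [set f | exists g, adj f g] (fun f => xget 0 [set g | adj f g]).

Definition bounded_op (V : L2 -> L2) : Prop :=
  exists M : R, forall f, L2norm (V f) <= M * L2norm f.

(* In the order of R[i], 0 <= z says that z is real and non-negative. *)
Definition nonneg_op (V : L2 -> L2) : Prop := forall f, 0 <= inner f (V f).

(* V^{1/2}, for a bounded V >= 0 *)
Definition op_sqrt (V : L2 -> L2) : L2 -> L2 :=
  xget (fun=> 0) [set W : L2 -> L2 |
    [/\ linear W, bounded_op W, nonneg_op W & forall f, W (W f) = V f]].

Definition ker_orth (V : L2 -> L2) : set L2 :=
  [set h | forall f, V f = 0 -> inner f h = 0].

(* V^{-1/2} k, for k in rg V^{1/2} *)
Definition op_invsqrt (V : L2 -> L2) (k : L2) : L2 :=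
  xget 0 [set h | ker_orth V h /\ op_sqrt V h = k].

Definition minLaplacian : operator :=
  Operator
    [set f | H2 f /\ [/\ trace f 0 = 0, trace f 1 = 0,
                         trace (wderiv f) 0 = 0 & trace (wderiv f) 1 = 0]]
    (fun f => - wderiv (wderiv f)).

Definition minLaplacian_iV (V : L2 -> L2) : operator :=
  Operator (dom minLaplacian) (fun f => act minLaplacian f + 'i%C *: V f).

Definition adjmx m n (M : 'M[C]_(m, n)) : 'M[C]_(n, m) :=
  \matrix_(i, j) (M j i)^*%C.

Definition Im_mx n (M : 'M[C]_n) : 'M[C]_n := (2 * 'i%C)^-1 *: (M - adjmx M).

Definition form_le n (M N : 'M[C]_n) : Prop :=
  forall x : 'cV[C]_n,
    (adjmx x *m M *m x) 0 0 <= (adjmx x *m N *m x) 0 0.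

Definition cv2 (a b : C) : 'cV[C]_2 := \col_i (if i == 0 then a else b).

Definition mx2 (a b c d : C) : 'M[C]_2 :=
  \matrix_(i, j) (if i == 0 then (if j == 0 then a else b)
                  else (if j == 0 then c else d)).

Section extensions.
Variable V : L2 -> L2.

(* (S^* + iV) f *)
Definition Smax_iV (f : L2) : L2 := act (adjoint minLaplacian) f + 'i%C *: V f.

Definition ext_i (c11 c12 c21 c22 : C) (k1 k2 : L2) : operator :=
  Operator
    [set f | H2 f /\
       cv2 (trace f 0) (trace f 1) =
       mx2 c11 c12 c21 c22 *m
         cv2 (trace (wderiv f) 0) (- trace (wderiv f) 1)]
    (fun f => Smax_iV f + trace (wderiv f) 0 *: k1 - trace (wderiv f) 1 *: k2).

Definition ext_ii (c12 c22 : C) (k1 : L2) : operator :=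
  Operator
    [set f | [/\ H2 f,
       trace f 1 - c22^*%C * trace f 0 = c22^*%C * c12 * trace (wderiv f) 1 &
       trace (wderiv f) 0 - c22 * trace (wderiv f) 1 = 0]]
    (fun f => Smax_iV f + trace (wderiv f) 1 *: k1).

Definition ext_iii (c11 : C) (k1 : L2) : operator :=
  Operator
    [set f | [/\ H2 f, trace f 0 = c11 * trace (wderiv f) 0 &
                 trace (wderiv f) 1 = 0]]
    (fun f => Smax_iV f + trace (wderiv f) 0 *: k1).

Definition ext_iv (c12 : C) (k1 : L2) : operator :=
  Operator
    [set f | [/\ H2 f, trace f 1 = - c12 * trace (wderiv f) 1 &
                 trace (wderiv f) 0 = 0]]
    (fun f => Smax_iV f + trace (wderiv f) 1 *: k1).

Definition ext_v : operator :=
  Operator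
    [set f | [/\ H2 f, trace (wderiv f) 0 = 0 & trace (wderiv f) 1 = 0]]
    Smax_iV.

Inductive ext_case := case_i | case_ii | case_iii | case_iv | case_v.

(* The parameters of a case are existentially quantified; the inequality between
   2x2 matrices compares quadratic forms in the order of R[i]. *)
Definition in_case (c : ext_case) (Ahat : operator) : Prop :=
  let rgV := range (op_sqrt V) in
  let Vih := op_invsqrt V in
  match c with
  | case_i => exists c11 c12 c21 c22 k1 k2,
      [/\ rgV k1, rgV k2,
          form_le
            (4^-1 *: mx2 (L2norm (Vih k1) ^+ 2)%:C (inner (Vih k1) (Vih k2))
                         (inner (Vih k2) (Vih k1)) (L2norm (Vih k2) ^+ 2)%:C)
            (Im_mx (adjmx (mx2 c11 c12 c21 c22))) &
          op_eq Ahat (ext_i c11 c12 c21 c22 k1 k2)]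
  | case_ii => exists c12 c22 k1,
      [/\ rgV k1, c22 != 0, 4^-1 * L2norm (Vih k1) ^+ 2 <= imC (c12 * c22^*%C) &
          op_eq Ahat (ext_ii c12 c22 k1)]
  | case_iii => exists c11 k1,
      [/\ rgV k1, 4^-1 * L2norm (Vih k1) ^+ 2 <= imC (c11^*)%C &
          op_eq Ahat (ext_iii c11 k1)]
  | case_iv => exists c12 k1,
      [/\ rgV k1, 4^-1 * L2norm (Vih k1) ^+ 2 <= imC (c12^*)%C &
          op_eq Ahat (ext_iv c12 k1)]
  | case_v => op_eq Ahat ext_v
  end.

End extensions.

End operators.

(* Main.v *)
(* Write [A = S + i V], [Smax = S^* + i V] and [W = V^(1/2)].  If [T] is a dissipative
   extension of [A] and [f] is in its domain, the Cauchy-Schwarz inequality for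
   [Im <f, T f>] on the span of [f] and [dom S] bounds [v |-> <f, A v> - <T f, v>] by
   a multiple of [|W v|]; so this functional is [<g, W v>] for some [g].  Hence [f]
   is in H^2, [T f - Smax f] is in the range of [W], and dissipativity reads
     (1/4) |V^(-1/2) (T f - Smax f)|^2 <= Im (f(0)^* f'(0) - f(1)^* f'(1)).
   In particular [T f = Smax f] when [f'(0) = f'(1) = 0], so the perturbation
   [T f - Smax f] only depends on [f'(0)] and [f'(1)]; and if [e] is such an [f], then
   [e(0)^* f'(0) = e(1)^* f'(1)] for all [f] in [dom T].  The boundary values of
   [dom T] thus form a subspace of C^4 with an isotropy property.  When [T] is
   maximal, [f |-> (f(0) - i f'(0), f(1) + i f'(1))] maps [dom T] onto C^2, and linear
   algebra leaves the five listed families, which are told apart by the values of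
   [(f'(0), f'(1))].  Conversely, these families are maximal for the isotropy
   property, so the corresponding operators are maximal. *)
From mathcomp Require Import all_boot all_order all_algebra.
From mathcomp Require Import all_classical all_reals all_analysis.
From mathcomp Require Import measurable_realfun complex ring lra zify.
Require Import Defs.

Set Implicit Arguments.
Unset Strict Implicit.
Unset Printing Implicit Defensive.

Import Order.TTheory GRing.Theory Num.Theory.
Import numFieldNormedType.Exports.

Local Open Scope classical_set_scope.
Local Open Scope ring_scope.
Local Open Scope complex_scope.

(** * The Hilbert space L_2(0,1) *)

Section L2_layer.
Variable R : realType.
Local Notation C := R[i].
Local Notation mu := (@lebesgue_measure R).
Local Notation I01 := (@I01 R).
Local Notation L2 := (L2 R).

(** At the outset nothing is known about the domain of [T], not even that it lies in H^2, and the
    range of W need not be closed. The estimate is therefore made against dom S alone, where all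
    boundary terms vanish; the representing vector found in the closure of range W then lets f be
    recognised as an element of the domain of the adjoint of S. The constant 1/4 comes from
    completing a square: if T f = Smax f + W h and b is the boundary form, then Im <f, T f> = b(f) +
    |W f|^2 + Im <W f, h> = b(f) - |h|^2/4 + |W f - (i/2) h|^2. With P f = (f(0) - i f'(0), f(1) + i
    f'(1)) and Q f = (f(0) + i f'(0), f(1) - i f'(1)), one has b(f) = (|P f|^2 - |Q f|^2)/4. So P is
    the positive part of an indefinite form on C^4, and a nonnegative subspace on which P is not
    onto can be enlarged by a vector with Q = 0. Data with f'(0) = f'(1) = 0 are null vectors of b,
    and a null vector of a nonnegative subspace is orthogonal to all of it: this is the isotropy. *)

Definition sqi (u : R -> R) : bool := u \_ I01 \in Lfun mu 2%:E.

(** Complex inner products are unfolded by [innerE] into four such real pairings, so that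
    integration theory is applied to real functions only. *)
Definition rip (u v : R -> R) : R := \int[mu]_(x in I01) (u x * v x).

Lemma measurable_I01 : @measurable _ (measurableTypeR R) I01.
Proof. exact: measurable_itv. Qed.
Hint Resolve measurable_I01 : core.

Lemma mu_I01 : mu I01 = 1%:E.
Proof. by rewrite /I01 lebesgue_measure_itv /= lte_fin ltr01 oppr0 adde0. Qed.

Lemma sqi_measurable u : sqi u -> measurable_fun I01 u.
Proof.
rewrite /sqi inE => /andP[/[!inE]/= mu_ _].
by apply/(measurable_restrictT u measurable_I01).
Qed.

Lemma sqi_mul_integrable u v : sqi u -> sqi v ->
  mu.-integrable I01 (EFin \o (u \* v)).
Proof.
move=> su sv; have := Lfun2_mul_Lfun1 su sv.
move/Lfun1_integrable => h.
have {}h : mu.-integrable I01 (EFin \o u \_ I01 \* v \_ I01).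
  by apply: (integrableS _ measurable_I01 _ h).
apply: eq_integrable h => // x xI.
by rewrite /= /patch xI.
Qed.

(** [Lfun] is defined by a norm with real powers; integrability of the plain product [u * u] is the
    form in which new members are recognised. *)
Lemma sqiP u : sqi u <->
  measurable_fun I01 u /\ mu.-integrable I01 (EFin \o (u \* u)).
Proof.
split=> [su|[mu_ iu]]; first by split; [exact: sqi_measurable|exact: sqi_mul_integrable].
have mr : measurable_fun setT (u \_ I01).
  by apply/(measurable_restrictT u measurable_I01).
rewrite /sqi inE; apply/andP; split; first by rewrite inE.
rewrite inE/= /finite_norm unlock poweR_lty//.
have /integrableP[_] := iu.
rewrite [X in (X < _)%E -> _]integral_mkcond; apply: le_lt_trans.
apply: ge0_le_integral => //.
- by move=> x _; rewrite poweR_ge0.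
- apply/(measurable_EFinP _ (fun x => `|(u \_ I01) x| `^ 2)).
  apply: (measurableT_comp (measurable_powR _)) => //.
  exact: measurableT_comp.
- apply/(measurable_restrictT _ measurable_I01).
  apply: measurableT_comp => //; apply/measurable_EFinP.
  exact: measurable_funM.
- move=> x _; rewrite /patch; case: ifP => xI /=; rewrite xI.
    by rewrite lee_fin powR_mulrn// normrM expr2.
  by rewrite -[leRHS]/(0%:E) lee_fin normr0 powR0// pnatr_eq0.
Qed.

Lemma sqi_bounded (u : R -> R) (M : R) : measurable_fun I01 u ->
  (forall x, I01 x -> `|u x| <= M) -> sqi u.
Proof.
move=> mu_ uM; apply/sqiP; split => //.
apply: (@le_integrable _ _ _ mu I01 measurable_I01 _ (EFin \o cst (M * M))).
- by apply/measurable_EFinP; exact: measurable_funM.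
- move=> x /uM xM; rewrite /= lee_fin normrM.
  have M0 : 0 <= M by apply: le_trans xM.
  by rewrite (ger0_norm (mulr_ge0 M0 M0)) ler_pM.
- apply/integrableP; split; first exact/measurable_EFinP.
  rewrite (_ : \int[mu]_(x in I01) _ = \int[mu]_(x in I01) (cst `|M * M|%:E x))%E//.
  by rewrite integral_cst// [X in (_ * X)%E]mu_I01 mule1 ltry.
Qed.

Lemma sqi_cst c : sqi (cst c).
Proof. by apply: (@sqi_bounded _ `|c|). Qed.

Lemma sqi_cmb a u v : sqi u -> sqi v -> sqi (fun x => a * u x + v x).
Proof.
move=> su sv.
have le12 : (1 <= 2%:E :> \bar R)%E by rewrite lee_fin ler1n.
have [_ cl] := @Lfun_submod_closed _ _ R mu _ le12.
have E : (fun x => a * u x + v x) \_ I01 = a *: (u \_ I01) + (v \_ I01).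
  apply/funext => x; rewrite /patch !fctE; case: ifP => _ //.
  by rewrite scaler0 addr0.
by rewrite /sqi E; apply: cl.
Qed.

Lemma sqiD u v : sqi u -> sqi v -> sqi (fun x => u x + v x).
Proof.
move=> su sv; have := sqi_cmb 1 su sv.
by congr (is_true (sqi _)); apply/funext => x; rewrite mul1r.
Qed.

Lemma sqiZ a u : sqi u -> sqi (fun x => a * u x).
Proof.
move=> su; have := sqi_cmb a su (sqi_cst 0).
by congr (is_true (sqi _)); apply/funext => x; rewrite addr0.
Qed.

Lemma sqiB u v : sqi u -> sqi v -> sqi (fun x => u x - v x).
Proof.
move=> su sv; have := sqi_cmb (-1) sv su.
by congr (is_true (sqi _)); apply/funext => x; rewrite mulN1r addrC.
Qed.

Lemma sqi_integrable u : sqi u -> mu.-integrable I01 (EFin \o u).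
Proof.
move=> su; have := sqi_mul_integrable su (sqi_cst 1).
by apply: eq_integrable => // x _ /=; rewrite mulr1.
Qed.

Lemma ae_eq_Rintegral (u v : R -> R) : mu.-integrable I01 (EFin \o u) ->
  mu.-integrable I01 (EFin \o v) -> ae_eq mu I01 u v ->
  \int[mu]_(x in I01) u x = \int[mu]_(x in I01) v x.
Proof.
move=> /integrableP[mu_ _] /integrableP[mv _] uv; congr fine.
apply: ae_eq_integral => //.
by apply: filterS uv => x /= h /h ->.
Qed.

Lemma ripC u v : rip u v = rip v u.
Proof. by apply: eq_Rintegral => x _; rewrite mulrC. Qed.

Lemma rip_cmbl a u v w : sqi u -> sqi v -> sqi w ->
  rip (fun x => a * u x + v x) w = a * rip u w + rip v w.
Proof.
move=> su sv sw; rewrite /rip -RintegralZl//; last exact: sqi_mul_integrable.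
rewrite -RintegralD//; last 2 first.
  - have := sqi_mul_integrable (sqiZ a su) sw.
    by apply: (@eq_integrable _ _ _ mu) => // x _ /=; rewrite mulrA.
  - exact: sqi_mul_integrable.
by apply: eq_Rintegral => x _ /=; rewrite mulrDl mulrA.
Qed.

Lemma rip_ae u u' v v' : sqi u -> sqi u' -> sqi v -> sqi v' ->
  ae_eq mu I01 u u' -> ae_eq mu I01 v v' -> rip u v = rip u' v'.
Proof.
move=> su su' sv sv' uu' vv'.
apply: ae_eq_Rintegral; [exact: sqi_mul_integrable..|].
by apply: filterS2 uu' vv' => x h1 h2 Ix; rewrite h1// h2.
Qed.

Lemma rip_ge0 u : 0 <= rip u u.
Proof. by apply: Rintegral_ge0 => x _; rewrite -expr2 sqr_ge0. Qed.

Lemma rip_eq0 u : sqi u -> rip u u = 0 -> ae_eq mu I01 u (cst 0).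
Proof.
move=> su u0; have iu := sqi_mul_integrable su su.
have h : (\int[mu]_(x in I01) `|(u x * u x)%:E| = 0)%E.
  rewrite -[RHS]/(0%R%:E) -u0 /rip fineK ?integrable_fin_num//.
  by apply: eq_integral => x _; rewrite /= ger0_norm// -expr2 sqr_ge0.
have : ae_eq mu I01 (EFin \o (u \* u)) (cst 0)%E.
  by apply/(ae_eq_integral_abs mu measurable_I01) => //; case/integrableP: iu.
apply: filterS => x h1 /h1 /= [] /eqP; rewrite mulf_eq0 => /orP[] /eqP //.
Qed.

Lemma L2fun_re_sqi (f : L2fun R) : sqi (reC \o f).
Proof. by have /andP[] := L2fun_square_integrable f. Qed.

Lemma L2fun_im_sqi (f : L2fun R) : sqi (imC \o f).
Proof. by have /andP[] := L2fun_square_integrable f. Qed.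
Hint Resolve L2fun_re_sqi L2fun_im_sqi : core.

Lemma L2fun_of (F : R -> C) : sqi (reC \o F) -> sqi (imC \o F) ->
  exists f : L2 , ae_eq mu I01 f F.
Proof.
move=> sr si; have h : F \in @square_integrable R by apply/andP.
by exists (L2_of (L2Fun h)); exact: L2_reprE.
Qed.

Lemma ae_eq_reC (f g : R -> C) : ae_eq mu I01 f g ->
  ae_eq mu I01 (reC \o f) (reC \o g).
Proof. by apply: filterS => x h /h /= ->. Qed.

Lemma ae_eq_imC (f g : R -> C) : ae_eq mu I01 f g ->
  ae_eq mu I01 (imC \o f) (imC \o g).
Proof. by apply: filterS => x h /h /= ->. Qed.

Lemma L2_eqP (f g : L2) : f = g <-> ae_eq mu I01 f g.
Proof. by rewrite -L2_of_eqP !L2_reprK. Qed.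

(** The representative of a class is a choice, so that of a sum agrees with the sum of the
    representatives only almost everywhere. *)
Lemma L2_addE (f g : L2) : ae_eq mu I01 (f + g : L2) (fun x => f x + g x).
Proof.
have -> : f + g = L2_of ((f : L2fun R) + (g : L2fun R)).
  rewrite -[LHS](congr2 _ (L2_reprK f) (L2_reprK g)).
  by apply/esym; exact: (@Quotient.pi_add _ (null_space R)).
by apply: filterS (L2_reprE ((f : L2fun R) + (g : L2fun R))) => x h /h ->.
Qed.

Lemma L2_scaleE a (f : L2) : ae_eq mu I01 (a *: f : L2) (fun x => a * f x).
Proof. exact: (L2_reprE (a *: (f : L2fun R))). Qed.

Lemma L2_cmbE a (f g : L2) : ae_eq mu I01 (a *: f + g : L2) (fun x => a * f x + g x).
Proof.
apply: filterS2 (L2_addE (a *: f) g) (L2_scaleE a f) => x h1 h2 Ix.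
by rewrite h1// h2.
Qed.

Lemma innerE (f g : L2) : inner f g =
  (rip (reC \o f) (reC \o g) + rip (imC \o f) (imC \o g)) +i*
  (rip (reC \o f) (imC \o g) - rip (imC \o f) (reC \o g)).
Proof.
rewrite /rip -RintegralD ?sqi_mul_integrable// -RintegralB ?sqi_mul_integrable//.
congr (_ +i* _); apply: eq_Rintegral => x _ /=;
 by case: (f x) (g x) => [a b] [c d] /=; ring.
Qed.

Lemma inner_conj (f g : L2) : inner g f = (inner f g)^*%C.
Proof.
rewrite !innerE /=; rewrite !(ripC (_ \o g)); congr (_ +i* _).
by rewrite opprB.
Qed.

Lemma inner_cmbr a (f g h : L2) :
  inner f (a *: g + h) = a * inner f g + inner f h.
Proof.
have ag := L2_cmbE a g h.
rewrite !innerE.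
set G := (a *: g + h : L2) in ag *.
have sr : sqi (fun x => reC a * reC (g x) + ((- imC a) * imC (g x) + reC (h x))).
  exact: (sqi_cmb _ (L2fun_re_sqi g) (sqi_cmb _ (L2fun_im_sqi g) (L2fun_re_sqi h))).
have si : sqi (fun x => reC a * imC (g x) + (imC a * reC (g x) + imC (h x))).
  exact: (sqi_cmb _ (L2fun_im_sqi g) (sqi_cmb _ (L2fun_re_sqi g) (L2fun_im_sqi h))).
have er : ae_eq mu I01 (reC \o G) (fun x => reC a * reC (g x) + ((- imC a) * imC (g x) + reC (h x))).
  apply: filterS ag => x e /e /= ->.
  by case: (a) (g x) (h x) => [? ?] [? ?] [? ?] /=; ring.
have ei : ae_eq mu I01 (imC \o G) (fun x => reC a * imC (g x) + (imC a * reC (g x) + imC (h x))).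
  apply: filterS ag => x e /e /= ->.
  by case: (a) (g x) (h x) => [? ?] [? ?] [? ?] /=; ring.
have E w : sqi w -> rip w (reC \o G) = reC a * rip w (reC \o g) - imC a * rip w (imC \o g) + rip w (reC \o h).
  move=> sw; rewrite !(ripC w) (rip_ae _ sr sw sw er)//; last exact: aeW.
  rewrite [LHS](@rip_cmbl (reC a) (reC \o g) (fun x => - imC a * imC (g x) + reC (h x)))//.
    by rewrite (@rip_cmbl (- imC a) (imC \o g) (reC \o h))//; ring.
  exact: (sqi_cmb _ (L2fun_im_sqi g) (L2fun_re_sqi h)).
have E' w : sqi w -> rip w (imC \o G) = reC a * rip w (imC \o g) + imC a * rip w (reC \o g) + rip w (imC \o h).
  move=> sw; rewrite !(ripC w) (rip_ae _ si sw sw ei)//; last exact: aeW.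
  rewrite [LHS](@rip_cmbl (reC a) (imC \o g) (fun x => imC a * reC (g x) + imC (h x)))//.
    by rewrite (@rip_cmbl (imC a) (reC \o g) (imC \o h))//; ring.
  exact: (sqi_cmb _ (L2fun_re_sqi g) (L2fun_im_sqi h)).
rewrite !E ?E'//.
by case: (a) => ? ?; congr (_ +i* _) => /=; ring.
Qed.

Lemma inner_ge0 (f : L2) : 0 <= inner f f.
Proof.
by rewrite innerE lecE /= ripC subrr eqxx addr_ge0 ?rip_ge0.
Qed.

Lemma inner_eq0 (f : L2) : inner f f = 0 -> f = 0.
Proof.
rewrite innerE => -[/eqP]; rewrite paddr_eq0 ?rip_ge0// => /andP[/eqP r0 /eqP i0] _.
apply/L2_eqP; have e0 : ae_eq mu I01 (0 : L2) (cst 0 : R -> C).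
  have := L2_scaleE 0 0; rewrite scaler0; apply: filterS => x h /h ->.
  by rewrite mul0r.
have {}r0 := rip_eq0 (L2fun_re_sqi f) r0.
have {}i0 := rip_eq0 (L2fun_im_sqi f) i0.
apply: filterS2 (filterI r0 i0) e0 => x [h1 h2] h3 Ix.
rewrite h3//; move: (h1 Ix) (h2 Ix) => /=.
by case: (L2_repr f x) => ? ? /= -> ->.
Qed.

End L2_layer.
Arguments measurable_I01 {R}.

(** * Completeness of L_2(0,1) *)

Section completeness.
Variable R : realType.
Local Notation mu := (@lebesgue_measure R).
Local Notation I01 := (@I01 R).
Local Notation L2 := (L2 R).

Hint Extern 0 (measurable _) => solve [exact: measurable_I01] : core.
Hint Resolve L2fun_re_sqi L2fun_im_sqi : core.

Definition rdist (u v : R -> R) : R := rip (u \- v) (u \- v).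

(** Fatou for the squares [(w k - u)^2]: from pointwise convergence alone it yields both the square
    integrability of the limit and the bound on its distance to [u]. *)
Lemma sqi_fatou (w : nat -> R -> R) (l u : R -> R) (M : R) :
  (forall k, sqi (w k)) ->
  (forall x, I01 x -> w ^~ x @ \oo --> l x) ->
  sqi u -> (forall k, rdist (w k) u <= M) -> sqi l /\ rdist l u <= M.
Proof.
move=> sw wl su wM.
have ml : measurable_fun I01 l.
  by apply: (@measurable_fun_cvg _ _ _ I01 w) => // m; exact: sqi_measurable.
have swu k : sqi (w k \- u) by exact: sqiB.
have mlu : measurable_fun I01 (l \- u).
  by apply: measurable_funB => //; exact: sqi_measurable.
pose F k x := (((w k x - u x) * (w k x - u x))%:E : \bar R).
have mF k : measurable_fun I01 (F k).
  by apply/measurable_EFinP; exact: (measurable_funM (sqi_measurable (swu k)) (sqi_measurable (swu k))).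
have F0 k x : I01 x -> (0 <= F k x)%E by move=> _; rewrite lee_fin -expr2 sqr_ge0.
have := fatou mu measurable_I01 mF F0.
have -> : (\int[mu]_(x in I01) limn_einf (F^~ x) =
  \int[mu]_(x in I01) ((l \- u) x * (l \- u) x)%:E)%E.
  apply: eq_integral => x /set_mem Ix.
  have cF : F^~ x @ \oo --> ((l \- u) x * (l \- u) x)%:E.
    have cwu : w k x - u x @[k --> \oo] --> l x - u x.
      by apply: cvgB; [exact: wl|exact: cvg_cst].
    by apply: cvg_EFin; [exact: nearW|exact: (cvgM cwu cwu)].
  by have [-> _] := cvg_limn_einf_sup cF.
have intF k : (\int[mu]_(x in I01) F k x = (rdist (w k) u)%:E)%E.
  rewrite /rdist /rip /Rintegral fineK// integrable_fin_num//.
  exact: sqi_mul_integrable.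
move=> /le_trans h.
have {}h : (\int[mu]_(x in I01) ((l \- u) x * (l \- u) x)%:E <= M%:E)%E.
  apply: h; rewrite limn_einf_lim; apply: lime_le; first exact: is_cvg_einfs.
  apply: nearW => n; apply: (@le_trans _ _ (\int[mu]_(x in I01) F n x)%E).
    by apply: ereal_inf_lbound; exists n => /=.
  by rewrite intF lee_fin.
have slu : sqi (l \- u).
  apply/sqiP; split => //; apply/integrableP; split.
    by apply/measurable_EFinP; exact: measurable_funM.
  apply: (@le_lt_trans _ _ M%:E); last exact: ltry.
  apply: le_trans h; apply: (ge0_le_integral mu measurable_I01) => //=.
  - apply/measurable_EFinP; apply: measurableT_comp => //.
    exact: measurable_funM.
  - by apply/measurable_EFinP; exact: measurable_funM.
  - by move=> x _; rewrite lee_fin ger0_norm// -expr2 sqr_ge0.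
split.
  have := sqiD slu su.
  by congr (is_true (sqi _)); apply/funext => x /=; rewrite subrK.
rewrite -lee_fin /rdist /rip /Rintegral fineK//.
exact: (integrable_fin_num _ (sqi_mul_integrable slu slu)).
Qed.

(** Integrate |u| <= u^2 / (2 c) + c / 2 over (0,1), which has measure 1. *)
Lemma sqi_L1_le (u : R -> R) (c : R) : 0 < c -> sqi u -> rip u u <= c ^+ 2 ->
  (\int[mu]_(x in I01) `|(u x)%:E| <= c%:E)%E.
Proof.
move=> c0 su uc.
have iu := sqi_mul_integrable su su.
have iu' : mu.-integrable I01 (EFin \o (fun x => 2^-1 * c^-1 * (u \* u) x)).
  by have := integrableZl measurable_I01 (2^-1 * c^-1) iu.
have ic : mu.-integrable I01 (EFin \o cst (2^-1 * c)).
  exact: sqi_integrable (sqi_cst _).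
apply: (@le_trans _ _ (\int[mu]_(x in I01) ((2^-1 * c^-1 * (u \* u) x) + 2^-1 * c)%:E)%E).
  apply: ge0_le_integral => //.
  - by do 2 apply: measurableT_comp => //; exact: sqi_measurable.
  - by have /integrableP[] := integrableD measurable_I01 iu' ic.
  - move=> x _; rewrite /= lee_fin.
    rewrite -(ler_pM2l c0) mulrDr -(ler_pM2l (ltr0n R 2)) mulrDr.
    have -> : 2 * (c * (2^-1 * c^-1 * (u x * u x))) = `|u x| * `|u x|.
      by rewrite -normrM ger0_norm -?expr2 ?sqr_ge0//; field; lra.
    have -> : 2 * (c * (2^-1 * c)) = c * c by field.
    by have := sqr_ge0 (`|u x| - c); nra.
under eq_integral do rewrite EFinD.
rewrite (integralD measurable_I01 iu' ic) /=.
under eq_integral do rewrite EFinM.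
rewrite integralZl//.
have -> : (\int[mu]_(x in I01) (2^-1 * c)%:E = (2^-1 * c)%:E)%E.
  rewrite -[LHS]/(\int[mu]_(x in I01) cst (2^-1 * c)%:E x)%E integral_cst//.
  by rewrite [X in (_ * X)%E]mu_I01 mule1.
have -> : (\int[mu]_(x in I01) (u x * u x)%:E = (rip u u)%:E)%E.
  by rewrite /rip /Rintegral fineK// integrable_fin_num.
rewrite -EFinM -EFinD lee_fin.
have : 2^-1 * c^-1 * rip u u <= 2^-1 * c^-1 * c ^+ 2.
  by rewrite ler_pM2l// mulr_gt0 ?invr_gt0.
have -> : 2^-1 * c^-1 * c ^+ 2 = 2^-1 * c by field; lra.
by lra.
Qed.

(** Riesz-Fischer: along a fast subsequence the increments are absolutely summable almost
    everywhere, and [sqi_fatou] turns the pointwise limit into a limit in norm of the whole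
    sequence. *)
Lemma sqi_complete (u : nat -> R -> R) : (forall n, sqi (u n)) ->
  (forall e : R, 0 < e -> exists N, forall m n, (N <= m)%N -> (N <= n)%N ->
     rdist (u m) (u n) <= e) ->
  exists2 l, sqi l & forall e : R, 0 < e -> exists N, forall n, (N <= n)%N ->
     rdist l (u n) <= e.
Proof.
move=> su cu.
(* These are the numbers 2^-(k+1), written as the summands of [cvg_geometric_eseries_half]. *)
pose c k : R := 1 / (2 ^ (k + 0.+1))%:R.
have c0 k : 0 < c k by rewrite /c divr_gt0// ltr0n expn_gt0.
have /choice[N hN] : forall k, exists N, forall m n, (N <= m)%N -> (N <= n)%N ->
     rdist (u m) (u n) <= c k ^+ 2.
  by move=> k; apply: cu; rewrite exprn_gt0.
(* The partial sums make [phi] monotone and at least [N k]; the extra [k] makes it unbounded. *)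
pose phi k := (\sum_(i < k.+1) N i + k)%N.
have phiN k : (N k <= phi k)%N by rewrite /phi big_ord_recr /=; lia.
have phiS k : (phi k <= phi k.+1)%N by rewrite /phi [in leqRHS]big_ord_recr /=; lia.
have phik k : (k <= phi k)%N by rewrite /phi; lia.
pose v k := u (phi k); pose d k := v k.+1 \- v k.
have sd k : sqi (d k) by exact: (sqiB (su _) (su _)).
have dc k : (\int[mu]_(x in I01) `|(d k x)%:E| <= (c k)%:E)%E.
  apply: sqi_L1_le => //.
  by apply: hN => //; apply: leq_trans (phiS k).
have md k : measurable_fun I01 (fun x => `|(d k x)%:E|)%E.
  by do 2 apply: measurableT_comp => //; exact: sqi_measurable.
have d0 k x : I01 x -> (0 <= `|(d k x)%:E|)%E by [].
have isum : mu.-integrable I01 (fun x => \sum_(k <oo) `|(d k x)%:E|)%E.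
  apply/integrableP; split.
    rewrite [X in measurable_fun _ X](_ : _ = fun x => \sum_(k <oo | k \in xpredT) `|(d k x)%:E|)%E.
      apply: ge0_emeasurable_sum; first by move=> k x _ _; exact: abse_ge0.
      by move=> k _; exact: md.
    by apply/funext => x; apply: eq_eseriesl.
  have -> : (\int[mu]_(x in I01) `|\sum_(k <oo) `|(d k x)%:E| | =
      \int[mu]_(x in I01) \sum_(k <oo) `|(d k x)%:E|)%E.
    by apply: eq_integral => x _; rewrite gee0_abs// nneseries_ge0.
  rewrite integral_nneseries//.
  apply: (@le_lt_trans _ _ (\sum_(k <oo) (c k)%:E)%E).
    by apply: lee_nneseries => [k _ _|k _]; [exact: integral_ge0|exact: dc].
  have /cvg_lim -> // := @cvg_geometric_eseries_half R 1 0.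
  by rewrite ltry.
have [A [mA A0 hA]] := integrable_ae measurable_I01 isum.
have cvgv x : I01 x -> ~ A x -> cvgn (v ^~ x).
  move=> Ix nA; have {hA} : (\sum_(k <oo) `|(d k x)%:E|)%E \is a fin_num.
    by apply: contrapT => h; apply: nA; apply: hA => /= /(_ Ix).
  move=> hfin; have : cvgn (series (fun k => `|d k x|)).
    apply: nnseries_is_cvg => //.
    by rewrite -ge0_fin_numE//; apply: nneseries_ge0.
  move=> hs; have {hs} : cvgn (series (fun k => d k x)).
    exact: (@normed_cvg R R^o).
  have -> : series (fun k => d k x) = [sequence v n x - v 0%N x]_n.
    exact: (telescopeK (v ^~ x)).
  move=> h; have -> : v ^~ x = [sequence v n x - v 0%N x]_n + cst (v 0%N x).
    by apply/funext => n; rewrite !fctE /= subrK.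
  by apply: is_cvgD h _; exact: is_cvg_cst.
(* Killing [v k] on the null set [A] gives convergence at every point of (0,1), as [sqi_fatou]
   requires. *)
pose w (k : nat) (x : R) := v k x * \1_(~` A) x.
have wA k x : A x -> w k x = 0.
  by move=> Ax; rewrite /w indicE memNset ?mulr0// => /(_ Ax).
have wnA k x : ~ A x -> w k x = v k x.
  by move=> Ax; rewrite /w indicE mem_set ?mulr1.
have wv k : ae_eq mu I01 (w k) (v k).
  by exists A; split => // x /= h; apply: contrapT => /wnA nA; apply: h => Ix.
have sw k : sqi (w k).
  have [mv iv] := (sqiP (v k)).1 (su _).
  have mw : measurable_fun I01 (w k).
    by apply: measurable_funM => //; apply: measurable_indic; exact: measurableC.
  apply/sqiP; split => //.
  apply: le_integrable iv => //.
    by apply/measurable_EFinP; exact: measurable_funM.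
  move=> x _ /=; have [xA|nA] := pselect (A x); last by rewrite wnA.
  by rewrite wA// mul0r normr0 lee_fin.
pose l x := limn (w ^~ x).
have wl x : I01 x -> w ^~ x @ \oo --> l x.
  move=> Ix; rewrite /l; have [xA|nA] := pselect (A x).
    have -> : w ^~ x = cst 0 by apply/funext => k; rewrite wA.
    exact: is_cvg_cst.
  have -> : w ^~ x = v ^~ x by apply/funext => k; rewrite wnA.
  exact: cvgv.
(* For a fixed late [n], the tail of the subsequence stays within [e] of [u n]; hence so does its
   limit. *)
have main e : 0 < e -> exists N, forall n, (N <= n)%N -> sqi l /\ rdist l (u n) <= e.
  move=> e0; have [M hM] := cu e e0; exists M => n Mn.
  apply: (@sqi_fatou (fun k => w (k + M)%N)) => //.
    by move=> x Ix; have := wl x Ix; rewrite -(cvg_shiftn M).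
  move=> k; have E : ae_eq mu I01 (w (k + M)%N \- u n) (v (k + M)%N \- u n).
    by apply: filterS (wv (k + M)%N) => x h Ix /=; rewrite h.
  have s1 : sqi (w (k + M)%N \- u n) by exact: sqiB.
  have s2 : sqi (v (k + M)%N \- u n) by exact: (sqiB (su _)).
  rewrite /rdist (rip_ae s1 s2 s1 s2 E E).
  by apply: hM => //; apply: leq_trans (phik _); rewrite leq_addl.
exists l.
  by have [M hM] := main 1 ltr01; have [] := hM M (leqnn _).
by move=> e /main[M hM]; exists M => n /hM[].
Qed.

Definition L2_cvg (f : nat -> L2) (g : L2) : Prop :=
  forall e : R, 0 < e -> exists N, forall n, (N <= n)%N -> L2norm (f n - g) < e.

Lemma L2norm_ge0 (f : L2) : 0 <= L2norm f.
Proof. exact: sqrtr_ge0. Qed.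

Lemma L2norm_sqr (f : L2) : L2norm f ^+ 2 = reC (inner f f).
Proof. by rewrite sqr_sqrtr//; have := inner_ge0 f; rewrite lecE => /andP[]. Qed.

Lemma L2norm_rdist (f g : L2) :
  L2norm (f - g) ^+ 2 = rdist (reC \o f) (reC \o g) + rdist (imC \o f) (imC \o g).
Proof.
have e : ae_eq mu I01 (f - g : L2) (fun x => f x - g x).
  apply: filterS (L2_cmbE (-1) g f) => x + Ix => /(_ Ix).
  by rewrite scaleN1r addrC => ->; rewrite mulN1r addrC.
rewrite L2norm_sqr innerE /=; congr (_ + _).
  apply: rip_ae; rewrite ?L2fun_re_sqi ?(sqiB (L2fun_re_sqi f) (L2fun_re_sqi g))//.
  - by apply: filterS e => x h /h /= ->; case: (f x) (g x) => ? ? [? ?].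
  - by apply: filterS e => x h /h /= ->; case: (f x) (g x) => ? ? [? ?].
apply: rip_ae; rewrite ?L2fun_im_sqi ?(sqiB (L2fun_im_sqi f) (L2fun_im_sqi g))//.
- by apply: filterS e => x h /h /= ->; case: (f x) (g x) => ? ? [? ?].
- by apply: filterS e => x h /h /= ->; case: (f x) (g x) => ? ? [? ?].
Qed.

Lemma rdist_ge0 (u v : R -> R) : 0 <= rdist u v.
Proof. exact: rip_ge0. Qed.

Lemma rdistC (u v : R -> R) : rdist u v = rdist v u.
Proof. by apply: eq_Rintegral => x _ /=; ring. Qed.

Lemma L2_complete (f : nat -> L2) :
  (forall e : R, 0 < e -> exists N, forall m n, (N <= m)%N -> (N <= n)%N ->
     L2norm (f m - f n) < e) -> exists g, L2_cvg f g.
Proof.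
move=> cf.
have cu e : 0 < e -> exists N, forall m n, (N <= m)%N -> (N <= n)%N ->
    rdist (reC \o f m) (reC \o f n) + rdist (imC \o f m) (imC \o f n) <= e.
  move=> e0; have [|N hN] := cf (Num.sqrt e); first by rewrite sqrtr_gt0.
  exists N => m n /hN h /h {}h; rewrite -L2norm_rdist -(sqr_sqrtr (ltW e0)).
  by rewrite lerXn2r ?nnegrE ?L2norm_ge0 ?sqrtr_ge0// ltW.
have [|u su hu] := @sqi_complete (fun n => reC \o f n) (fun n => L2fun_re_sqi _).
  move=> e /cu[N hN]; exists N => m n /hN h /h.
  by apply: le_trans; rewrite lerDl rdist_ge0.
have [|v sv hv] := @sqi_complete (fun n => imC \o f n) (fun n => L2fun_im_sqi _).
  move=> e /cu[N hN]; exists N => m n /hN h /h.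
  by apply: le_trans; rewrite lerDr rdist_ge0.
have [g gE] := @L2fun_of R (fun x => u x +i* v x) su sv.
exists g => e e0.
have e2 : 0 < e ^+ 2 / 4 by rewrite divr_gt0// exprn_gt0.
have [N1 hN1] := hu _ e2; have [N2 hN2] := hv _ e2.
exists (maxn N1 N2) => n; rewrite geq_max => /andP[/hN1 h1 /hN2 h2].
rewrite -(ltr_pXn2r (n := 2)) ?nnegrE ?L2norm_ge0 ?ltW// L2norm_rdist.
have Eu : ae_eq mu I01 (reC \o g) u by exact: (ae_eq_reC gE).
have Ev : ae_eq mu I01 (imC \o g) v by exact: (ae_eq_imC gE).
have -> : rdist (reC \o f n) (reC \o g) = rdist u (reC \o f n).
  rewrite rdistC; apply: rip_ae; rewrite ?(sqiB (L2fun_re_sqi _) (L2fun_re_sqi _)) ?(sqiB su (L2fun_re_sqi _))//.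
  - by apply: filterS Eu => x h /h /= ->.
  - by apply: filterS Eu => x h /h /= ->.
have -> : rdist (imC \o f n) (imC \o g) = rdist v (imC \o f n).
  rewrite rdistC; apply: rip_ae; rewrite ?(sqiB (L2fun_im_sqi _) (L2fun_im_sqi _)) ?(sqiB sv (L2fun_im_sqi _))//.
  - by apply: filterS Ev => x h /h /= ->.
  - by apply: filterS Ev => x h /h /= ->.
by have := exprn_gt0 2 e0; lra.
Qed.

End completeness.

Local Opaque inner.

(** * Real and imaginary parts of complex numbers *)

Section complex_parts.
Variable R : realType.
Local Notation C := R[i].
Implicit Types x y z : C.

Lemma reD x y : reC (x + y) = reC x + reC y. Proof. by case: x y => ? ? []. Qed.
Lemma imD x y : imC (x + y) = imC x + imC y. Proof. by case: x y => ? ? []. Qed.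
Lemma reN x : reC (- x) = - reC x. Proof. by case: x. Qed.
Lemma imN x : imC (- x) = - imC x. Proof. by case: x. Qed.
Lemma reM x y : reC (x * y) = reC x * reC y - imC x * imC y.
Proof. by case: x y => ? ? []. Qed.
Lemma imM x y : imC (x * y) = reC x * imC y + imC x * reC y.
Proof. by case: x y => ? ? []. Qed.
Lemma reJ x : reC (x^*%C) = reC x. Proof. by case: x. Qed.
Lemma imJ x : imC (x^*%C) = - imC x. Proof. by case: x. Qed.
Lemma re0 : reC (0 : C) = 0. Proof. by []. Qed.
Lemma im0 : imC (0 : C) = 0. Proof. by []. Qed.
Lemma re1 : reC (1 : C) = 1. Proof. by []. Qed.
Lemma im1 : imC (1 : C) = 0. Proof. by []. Qed.
Lemma rei : reC ('i%C : C) = 0. Proof. by []. Qed.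
Lemma imi : imC ('i%C : C) = 1. Proof. by []. Qed.
(** Turns an identity between complex numbers into real polynomial ones, within reach of [ring],
    [field] and [lra]. *)
Definition partsE := (reD, imD, reN, imN, reM, imM, reJ, imJ, re0, im0, re1, im1,
  rei, imi).

Lemma eqC x y : reC x = reC y -> imC x = imC y -> x = y.
Proof. by case: x y => a b [c d] /= -> ->. Qed.

Lemma conjD x y : (x + y)^*%C = x^*%C + y^*%C.
Proof. by apply: eqC; rewrite !partsE/=; ring. Qed.
Lemma conjN x : (- x)^*%C = - x^*%C.
Proof. by apply: eqC; rewrite !partsE/=. Qed.
Lemma conjM x y : (x * y)^*%C = x^*%C * y^*%C.
Proof. by apply: eqC; rewrite !partsE/=; ring. Qed.
Lemma conjK x : ((x^*)%C^*)%C = x.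
Proof. by apply: eqC; rewrite !partsE/=; ring. Qed.

Definition sqn x : R := reC x ^+ 2 + imC x ^+ 2.

Lemma sqn_ge0 x : 0 <= sqn x.
Proof. by rewrite addr_ge0 ?sqr_ge0. Qed.

Lemma sqn_eq0 x : sqn x = 0 -> x = 0.
Proof.
move/eqP; rewrite paddr_eq0 ?sqr_ge0// !sqrf_eq0 => /andP[/eqP a /eqP b].
exact: eqC.
Qed.

Lemma sqnM x y : sqn (x * y) = sqn x * sqn y.
Proof. by rewrite /sqn !partsE/=; ring. Qed.

Lemma sqn_conj x : sqn (x^*%C) = sqn x.
Proof. by rewrite /sqn !partsE/= sqrrN. Qed.

(** At [t = - a / (1 + |b|)] the linear term outweighs the quadratic one whatever [b] is. This is
    the first-variation argument at a minimum. *)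
Lemma linear_quadratic_ge0 (a b : R) :
  (forall t : R, 0 <= 2 * t * a + t ^+ 2 * b) -> a = 0.
Proof.
move=> h; apply/eqP; rewrite -sqrf_eq0 eq_le sqr_ge0 andbT.
have b1 : 0 < 1 + `|b| by rewrite ltr_wpDr.
have h1 := h (- a * (1 + `|b|)^-1).
have bb : b <= `|b| := ler_norm b.
have p : 0 <= 2 * (- a * (1 + `|b|)^-1) * a * (1 + `|b|) ^+ 2 + (- a * (1 + `|b|)^-1) ^+ 2 * b * (1 + `|b|) ^+ 2.
  by rewrite -mulrDl mulr_ge0// sqr_ge0.
have E : 2 * (- a * (1 + `|b|)^-1) * a * (1 + `|b|) ^+ 2 + (- a * (1 + `|b|)^-1) ^+ 2 * b * (1 + `|b|) ^+ 2 = a ^+ 2 * (b - 2 * (1 + `|b|)).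
  by field; lra.
rewrite E in p; have := sqr_ge0 a; have := normr_ge0 b; nra.
Qed.

(* the discriminant of [l |-> a + 2 Re (l z) + |l|^2 b] *)
Lemma sesquilinear_CS (a b : R) z :
  (forall l : C, 0 <= a + 2 * reC (l * z) + sqn l * b) -> sqn z <= a * b.
Proof.
move=> h.
(* The choice [l = - t * conj z] reduces the hypothesis to a real quadratic in [t]. *)
have ht t : 0 <= a - 2 * t * sqn z + t ^+ 2 * (sqn z * b).
  have := h (- (t%:C * z^*%C)); rewrite /sqn !partsE/=.
  by congr (0 <= _); ring.
have z0 := sqn_ge0 z.
have [b0|b0] := ltP 0 b.
  have := ht b^-1; have -> : a - 2 * b^-1 * sqn z + b^-1 ^+ 2 * (sqn z * b) = a - b^-1 * sqn z.
    by field; lra.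
  by rewrite subr_ge0 -(ler_pM2r b0) mulrAC mulVf ?mul1r// gt_eqF.
have a0 : 0 <= a by have := ht 0; rewrite expr0n /=; lra.
have [->|zn] := eqVneq (sqn z) 0.
  have [b00|] := eqVneq b 0; first by rewrite b00 mulr0.
  move=> bn; have bl : b < 0 by rewrite lt_neqAle bn.
  have hl l := h l.
  (* The sum of the inequalities at [s] and [- s] leaves [0 <= a + s^2 b], which fails for this [s]
     when [b < 0]. *)
  have := h (((1 + a) / - b + 1)%:C); have := h (- ((1 + a) / - b + 1)%:C).
  rewrite /sqn !partsE/=.
  set s := (1 + a) / - b + 1; have s1 : 1 <= s.
    by rewrite /s lerDr divr_ge0//; lra.
  have sb : s * - b = 1 + a - b by rewrite /s; field; lra.
  by nra.
have zp : 0 < sqn z by rewrite lt_neqAle eq_sym zn.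
(* With [b <= 0] and [z] nonzero the linear term in [t] already makes the quadratic negative
   here. *)
have := ht ((1 + a) / sqn z).
have -> : a - 2 * ((1 + a) / sqn z) * sqn z + ((1 + a) / sqn z) ^+ 2 * (sqn z * b)
  = - a - 2 + ((1 + a) / sqn z) ^+ 2 * (sqn z * b) by field.
have : ((1 + a) / sqn z) ^+ 2 * (sqn z * b) <= 0.
  by rewrite mulr_ge0_le0 ?sqr_ge0// mulr_ge0_le0.
by lra.
Qed.

End complex_parts.

Section hilbert.
Variable R : realType.
Local Notation C := R[i].
Local Notation L2 := (L2 R).
Implicit Types (f g h : L2) (a b : C).

Lemma innerDr f g h : inner f (g + h) = inner f g + inner f h.
Proof. by rewrite -{1}(scale1r g) inner_cmbr mul1r. Qed.

Lemma inner0r f : inner f 0 = 0.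
Proof. by apply: (@addrI _ (inner f 0)); rewrite -innerDr !addr0. Qed.

Lemma innerZr a f g : inner f (a *: g) = a * inner f g.
Proof. by rewrite -[a *: g]addr0 inner_cmbr inner0r addr0. Qed.

Lemma innerNr f g : inner f (- g) = - inner f g.
Proof. by rewrite -scaleN1r innerZr mulN1r. Qed.

Lemma innerBr f g h : inner f (g - h) = inner f g - inner f h.
Proof. by rewrite innerDr innerNr. Qed.

Lemma innerDl f g h : inner (f + g) h = inner f h + inner g h.
Proof. by rewrite inner_conj innerDr conjD -!inner_conj. Qed.

Lemma inner0l f : inner 0 f = 0.
Proof. by rewrite inner_conj inner0r; apply: eqC; rewrite !partsE/= ?oppr0. Qed.

Lemma innerZl a f g : inner (a *: f) g = a^*%C * inner f g.
Proof. by rewrite inner_conj innerZr conjM -inner_conj. Qed.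

Lemma innerNl f g : inner (- f) g = - inner f g.
Proof. by rewrite inner_conj innerNr conjN -inner_conj. Qed.

Lemma innerBl f g h : inner (f - g) h = inner f h - inner g h.
Proof. by rewrite innerDl innerNl. Qed.

Definition n2 f : R := reC (inner f f).

Lemma n2_ge0 f : 0 <= n2 f.
Proof. by have := inner_ge0 f; rewrite lecE => /andP[]. Qed.

Lemma n2E f : L2norm f ^+ 2 = n2 f. Proof. exact: L2norm_sqr. Qed.

Lemma inner_self f : inner f f = (n2 f)%:C.
Proof.
by apply: eqC => //=; have := inner_ge0 f; rewrite lecE => /andP[/eqP].
Qed.

Lemma n2_eq0 f : n2 f = 0 -> f = 0.
Proof. by move=> h; apply: inner_eq0; rewrite inner_self h. Qed.

Lemma n2_cmb a f g :
  n2 (f + a *: g) = n2 f + 2 * reC (a * inner f g) + sqn a * n2 g.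
Proof.
rewrite /n2 innerDr !innerDl !innerZr !innerZl (inner_conj f g) !inner_self.
by rewrite /sqn !partsE/=; ring.
Qed.

Lemma n2D f g : n2 (f + g) = n2 f + 2 * reC (inner f g) + n2 g.
Proof. by rewrite -{1}(scale1r g) n2_cmb mul1r /sqn !partsE/=; ring. Qed.

Lemma n2B f g : n2 (f - g) = n2 f - 2 * reC (inner f g) + n2 g.
Proof. by rewrite -scaleN1r n2_cmb /sqn !partsE/=; ring. Qed.

Lemma n2Z a f : n2 (a *: f) = sqn a * n2 f.
Proof. by rewrite /n2 innerZr innerZl inner_self /sqn !partsE/=; ring. Qed.

Lemma inner_CS f g : sqn (inner f g) <= n2 f * n2 g.
Proof.
apply: sesquilinear_CS => l; rewrite -n2_cmb; exact: n2_ge0.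
Qed.

Lemma re_inner_le f g : reC (inner f g) <= L2norm f * L2norm g.
Proof.
have := inner_CS f g; rewrite -!n2E /sqn.
have := L2norm_ge0 f; have := L2norm_ge0 g; have := sqr_ge0 (imC (inner f g)).
set x := reC _; set y := L2norm f; set z := L2norm g => h1 z0 y0 h.
have [x0|x0] := lerP x 0; first by apply: le_trans x0 _; rewrite mulr_ge0.
have : x ^+ 2 <= (y * z) ^+ 2 by rewrite exprMn; lra.
by rewrite ler_pXn2r// nnegrE ?mulr_ge0// ltW.
Qed.

Lemma L2normN f : L2norm (- f) = L2norm f.
Proof. by rewrite /L2norm innerNr innerNl opprK. Qed.

Lemma L2norm_triangle f g : L2norm (f + g) <= L2norm f + L2norm g.
Proof.
rewrite -(ler_pXn2r (n := 2)) ?nnegrE ?addr_ge0 ?L2norm_ge0//.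
by rewrite n2E n2D -!n2E; have := re_inner_le f g; nra.
Qed.

Lemma L2norm0 : L2norm (0 : L2) = 0.
Proof. by rewrite /L2norm inner0r sqrtr0. Qed.

Lemma L2norm_eq0 f : L2norm f = 0 -> f = 0.
Proof. by move=> h; apply: n2_eq0; rewrite -n2E h expr0n. Qed.

Lemma L2normZ a f : L2norm (a *: f) = Num.sqrt (sqn a) * L2norm f.
Proof. by rewrite /L2norm -sqrtrM ?sqn_ge0// -/(n2 _) n2Z. Qed.

Lemma L2norm_re (t : R) f : 0 <= t -> L2norm (t%:C *: f) = t * L2norm f.
Proof. by move=> t0; rewrite L2normZ /sqn !partsE/= expr0n addr0 sqrtr_sqr ger0_norm. Qed.

End hilbert.

(** * Riesz representation and square roots *)

Section riesz.
Variable R : realType.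
Local Notation C := R[i].
Local Notation L2 := (L2 R).
Implicit Types (f g h : L2) (a b : C).

Lemma L2_cvgP (u : nat -> L2) g :
  L2_cvg u g <-> (fun n => L2norm (u n - g)) @ \oo --> (0 : R).
Proof.
split=> [h|h e e0].
  apply/cvgrPdist_lt => e /h[N hN]; exists N => // n /hN.
  by rewrite sub0r normrN ger0_norm ?L2norm_ge0.
have /cvgrPdist_lt/(_ e e0) [N _ hN] := h.
exists N => n /hN; by rewrite sub0r normrN ger0_norm ?L2norm_ge0.
Qed.

Lemma L2_cvg_squeeze (u : nat -> L2) g (c : nat -> R) :
  (forall n, L2norm (u n - g) <= c n) -> c @ \oo --> (0 : R) -> L2_cvg u g.
Proof.
move=> h c0; apply/L2_cvgP; apply: (squeeze_cvgr _ (cvg_cst 0) c0).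
by apply: nearW => n; rewrite L2norm_ge0 h.
Qed.

Lemma L2_cvg_cst f : L2_cvg (fun=> f) f.
Proof. by move=> e e0; exists 0%N => n _; rewrite subrr L2norm0. Qed.

Lemma L2_cvg_cmb a (u v : nat -> L2) f g : L2_cvg u f -> L2_cvg v g ->
  L2_cvg (fun n => a *: u n + v n) (a *: f + g).
Proof.
move=> /L2_cvgP uf /L2_cvgP vg.
pose c n := Num.sqrt (sqn a) * L2norm (u n - f) + L2norm (v n - g).
apply: (@L2_cvg_squeeze _ _ c) => [n|].
  rewrite /c -L2normZ scalerBr; apply: le_trans (L2norm_triangle _ _).
  by rewrite opprD addrACA.
have -> : (0 : R) = Num.sqrt (sqn a) * 0 + 0 by rewrite mulr0 addr0.
by apply: cvgD => //; apply: cvgMr.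
Qed.

Lemma L2_cvg_unique (u : nat -> L2) f g : L2_cvg u f -> L2_cvg u g -> f = g.
Proof.
move=> uf ug; apply/eqP; rewrite -subr_eq0; apply/eqP/L2norm_eq0.
apply/eqP; rewrite eq_le L2norm_ge0 andbT; apply/ler_addgt0Pl => e e0.
have e2 : 0 < e / 2 by rewrite divr_gt0.
have [N hN] := uf _ e2; have [M hM] := ug _ e2.
have h1 := hN _ (leq_maxl N M); have h2 := hM _ (leq_maxr N M).
set k := maxn N M in h1 h2.
have -> : f - g = (u k - g) + - (u k - f).
  by rewrite opprB [RHS]addrC addrA subrK.
by have := L2norm_triangle (u k - g) (- (u k - f)); rewrite L2normN; lra.
Qed.

Lemma L2_cvg_re_inner (u : nat -> L2) g h : L2_cvg u g ->
  (fun n => reC (inner h (u n))) @ \oo --> reC (inner h g).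
Proof.
move=> /L2_cvgP ug; apply/cvgrPdist_lt => e e0.
have k0 : 0 < 1 + L2norm h by rewrite ltr_pwDl// L2norm_ge0.
have /cvgrPdist_lt/(_ (e / (1 + L2norm h))) [|N _ hN] := ug; first by rewrite divr_gt0.
exists N => // n /hN; rewrite sub0r normrN ger0_norm ?L2norm_ge0// ltr_pdivlMr// => hh.
rewrite -reN -reD -innerBr; apply: le_lt_trans hh.
have := re_inner_le h (g - u n); have := re_inner_le h (u n - g).
rewrite -(opprB g) L2normN innerNr partsE.
have := L2norm_ge0 h; have := L2norm_ge0 (g - u n) => h1 h2 h3 h4.
apply: (@le_trans _ _ (L2norm h * L2norm (g - u n))); last by rewrite mulrDr mulr1 mulrC lerDr.
by rewrite ler_norml; apply/andP; split; lra.
Qed.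

Lemma L2_cvg_im_inner (u : nat -> L2) g h : L2_cvg u g ->
  (fun n => imC (inner h (u n))) @ \oo --> imC (inner h g).
Proof.
move=> ug; have := L2_cvg_re_inner (h := 'i%C *: h) ug.
have E f : reC (inner ('i%C *: h) f) = imC (inner h f).
  by rewrite innerZl !partsE/=; ring.
by under eq_cvg do rewrite E; rewrite E.
Qed.

Lemma L2_cvg_norm (u : nat -> L2) g : L2_cvg u g ->
  (fun n => L2norm (u n)) @ \oo --> L2norm g.
Proof.
move=> ug; apply/cvgrPdist_lt => e e0.
have [N hN] := ug e e0; exists N => // n /hN; apply: le_lt_trans.
have := L2norm_triangle (u n - g) g; have := L2norm_triangle (g - u n) (u n).
rewrite !subrK -(opprB (u n)) L2normN => h1 h2.
by rewrite ler_norml; apply/andP; split; lra.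
Qed.

Lemma L2_cvg_n2 (u : nat -> L2) g : L2_cvg u g ->
  (fun n => n2 (u n)) @ \oo --> n2 g.
Proof.
move=> /L2_cvg_norm h; rewrite -n2E expr2.
under eq_cvg do rewrite -n2E expr2.
exact: cvgM.
Qed.

Definition subspace (D : set L2) : Prop :=
  D 0 /\ forall a f g, D f -> D g -> D (a *: f + g).

Definition linear_on (V : lmodType C) (D : set L2) (T : L2 -> V) : Prop :=
  forall a f g, D f -> D g -> T (a *: f + g) = a *: T f + T g.

(* The representing vector is the limit of T f_n along a minimising sequence of
   |T f|^2 - 2 Re (l f). *)
Lemma riesz_image (D : set L2) (T : L2 -> L2) (l : L2 -> C) (c : R) :
  subspace D -> linear_on D T -> linear_on D (l : L2 -> C^o) -> 0 <= c ->
  (forall f, D f -> sqn (l f) <= c * n2 (T f)) ->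
  exists g, [/\ forall f, D f -> l f = inner g (T f), n2 g <= c &
    exists2 u : nat -> L2, forall n, D (u n) & L2_cvg (T \o u) g].
Proof.
move=> [D0 sD] linT linl c0 lc.
pose phi f := n2 (T f) - 2 * reC (l f).
(* The hypothesis on [l] gives (Re l f)^2 <= c |T f|^2, and 2 Re l f <= c + |T f|^2 follows from the
   inequality between geometric and arithmetic means. *)
have phic f : D f -> - c <= phi f.
  move=> /lc; rewrite /phi /sqn.
  have := sqr_ge0 (imC (l f)); have := n2_ge0 (T f).
  set x := reC _; set n := n2 _ => n0 i0 h.
  have h2 : 4 * x ^+ 2 <= (c + n) ^+ 2 by have := sqr_ge0 (c - n); nra.
  suff : 2 * x <= c + n by lra.
  have cn : 0 <= c + n by lra.
  rewrite leNgt; apply/negP => hh; nra.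
have T0 : T 0 = 0.
  have := linT (-1) 0 0 D0 D0; rewrite scaler0 addr0 scaleN1r addNr; exact.
have l0 : l 0 = 0.
  by have := linl (-1) 0 0 D0 D0; rewrite scaler0 addr0 scaleN1r addNr.
have TZ a f : D f -> T (a *: f) = a *: T f.
  by move=> Df; have := linT a f 0 Df D0; rewrite !addr0 T0 addr0.
have lZ a f : D f -> l (a *: f) = a * l f.
  by move=> Df; have := linl a f 0 Df D0; rewrite !addr0 l0 addr0.
have DZ a f : D f -> D (a *: f) by move=> Df; have := sD a f 0 Df D0; rewrite addr0.
pose S := [set phi f | f in D].
have hS : has_inf S.
  split; first by exists (phi 0), 0.
  by exists (- c) => _ [f Df <-]; exact: phic.
pose m := inf S.
have mphi f : D f -> m <= phi f.
  by move=> Df; apply: ge_inf; [case: hS|exists f].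
have /choice[u hu] : forall n : nat, exists f, D f /\ phi f < m + n.+1%:R^-1.
  move=> n; have n0 : 0 < n.+1%:R^-1 :> R by rewrite invr_gt0.
  by have [_ [f Df <-] h] := inf_adherent n0 hS; exists f.
have Du n : D (u n) by case: (hu n).
have phiu n : phi (u n) < m + n.+1%:R^-1 by case: (hu n).
(* parallelogram identity *)
have par n k : n2 (T (u n) - T (u k)) <= 2 * (n.+1%:R^-1 + k.+1%:R^-1).
  pose w := (2^-1)%:C *: (u n + u k).
  have Dw : D w by apply: DZ; have := sD 1 _ _ (Du n) (Du k); rewrite scale1r.
  have Tw : T w = (2^-1)%:C *: (T (u n) + T (u k)).
    rewrite TZ; last by have := sD 1 _ _ (Du n) (Du k); rewrite scale1r.
    by have := linT 1 _ _ (Du n) (Du k); rewrite !scale1r => ->.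
  have lw : l w = (2^-1)%:C * (l (u n) + l (u k)).
    rewrite lZ; last by have := sD 1 _ _ (Du n) (Du k); rewrite scale1r.
    by have := linl 1 _ _ (Du n) (Du k); rewrite !scale1r => ->.
  have := mphi _ Dw; rewrite /phi Tw lw n2Z n2D n2B /sqn !partsE/=.
  have := phiu n; have := phiu k; rewrite /phi.
  have -> : (2^-1 : R) ^+ 2 = 4^-1 by field.
  rewrite expr0n /= addr0 mul0r subr0.
  set p := reC (inner _ _); set en := n.+1%:R^-1; set ek := k.+1%:R^-1; lra.
have [g Tg] : exists g, L2_cvg (T \o u) g.
  apply: L2_complete => e e0.
  have e4 : 0 < e ^+ 2 / 4 by rewrite divr_gt0// exprn_gt0.
  have /cvgrPdist_lt/(_ _ e4) [N _ hN] := @cvg_harmonic R.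
  exists N => n k /hN hn /hN hk.
  rewrite -(ltr_pXn2r (n := 2)) ?nnegrE ?L2norm_ge0 ?ltW// n2E.
  apply: le_lt_trans (par n k) _.
  move: hn hk; rewrite !sub0r !normrN /= !ger0_norm ?invr_ge0//.
  set E := e ^+ 2; set en := n.+1%:R^-1; set ek := k.+1%:R^-1; lra.
(* First variation: replacing [u n] by [u n - t v] cannot bring [phi] below its infimum. As n grows,
   a quadratic in [t] without constant term remains. *)
have re_eq v : D v -> reC (l v) = reC (inner g (T v)).
  move=> Dv; apply/eqP; rewrite -subr_eq0; apply/eqP.
  apply: (@linear_quadratic_ge0 _ _ (n2 (T v))) => t.
  have key n : 0 <= n.+1%:R^-1 + 2 * t * (reC (l v) - reC (inner (T v) (T (u n)))) + t ^+ 2 * n2 (T v).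
    have Dw := sD (- t%:C) v (u n) Dv (Du n).
    have := mphi _ Dw; rewrite /phi linT// linl//.
    rewrite [_ *: T v + _]addrC n2_cmb (inner_conj (T v)) /sqn !partsE/=.
    rewrite oppr0 expr0n sqrrN /= addr0 !mul0r !subr0.
    have := phiu n; rewrite /phi; set en := n.+1%:R^-1; lra.
  have -> : reC (inner g (T v)) = reC (inner (T v) g) by rewrite inner_conj reJ.
  have lim : (fun n => n.+1%:R^-1 + 2 * t * (reC (l v) - reC (inner (T v) (T (u n)))) + t ^+ 2 * n2 (T v)) @ \oo -->
     0 + 2 * t * (reC (l v) - reC (inner (T v) g)) + t ^+ 2 * n2 (T v).
    apply: cvgD; last exact: cvg_cst.
    apply: cvgD; first exact: cvg_harmonic.
    apply: cvgMr; apply: cvgB; first exact: cvg_cst.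
    exact: (L2_cvg_re_inner (h := T v) Tg).
  rewrite -[X in 0 <= X + _]add0r.
  rewrite -(cvg_lim (@Rhausdorff R) lim).
  apply: limr_ge; first by apply/cvg_ex; eexists; exact: lim.
  exact: nearW.
have eq v : D v -> l v = inner g (T v).
  move=> Dv; apply: eqC; first exact: re_eq.
  (* The imaginary part is the real part at [- i v]. *)
  have := re_eq _ (DZ (- 'i%C) v Dv); rewrite lZ// TZ// innerZr !partsE/=; lra.
exists g; split => //; last by exists u.
(* The limit of [phi (u n)] is - |g|^2, so the lower bound - c for [phi] becomes |g|^2 <= c. *)
have lim : (fun n => phi (u n)) @ \oo --> n2 g - 2 * n2 g.
  apply: cvgB; first exact: (L2_cvg_n2 Tg).
  apply: cvgMr; under eq_cvg do rewrite eq//.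
  exact: (L2_cvg_re_inner (h := g) Tg).
have : - c <= n2 g - 2 * n2 g.
  rewrite -(cvg_lim (@Rhausdorff R) lim).
  apply: limr_ge; first by apply/cvg_ex; eexists; exact: lim.
  by apply: nearW => n; exact: phic.
by lra.
Qed.

(** With [T = id] and [l = <f, .>], [riesz_image] is the orthogonal projection of [f] on the closure
    of [D]; the residue is orthogonal to [D], hence zero. *)
Lemma dense_subspace (D : set L2) : subspace D ->
  (forall f, (forall g, D g -> inner f g = 0) -> f = 0) ->
  forall f (e : R), 0 < e -> exists2 g, D g & L2norm (f - g) < e.
Proof.
move=> sD D0 f e e0.
have [|||g [gE _ [u Du ug]]] := @riesz_image D id (inner f) (n2 f) sD _ _ (n2_ge0 f).
- by move=> a g h.
- by move=> a g h _ _; rewrite inner_cmbr.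
- by move=> g _; exact: inner_CS.
have fg : f = g.
  apply/eqP; rewrite -subr_eq0; apply/eqP/D0 => h Dh.
  by rewrite innerBl gE ?subrr.
have [N hN] := ug e e0; exists (u N) => //.
by rewrite -opprB L2normN fg; apply: hN.
Qed.

End riesz.

(** * Square root of a bounded nonnegative operator *)

Section square_root.
Variable R : realType.
Local Notation C := R[i].
Local Notation L2 := (L2 R).
Implicit Types (f g h : L2) (a b : C).

Definition symmetric_op (T : L2 -> L2) : Prop :=
  forall f g, inner f (T g) = inner (T f) g.

(** Polarisation over C: <h, V h> is real at h = g + f and at h = i g + f, which settles the
    imaginary and the real part. *)
Lemma nonneg_symmetric (V : L2 -> L2) : linear V -> nonneg_op V -> symmetric_op V.
Proof.
move=> linV V0 f g.
have im0 h : imC (inner h (V h)) = 0 by have := V0 h; rewrite lecE => /andP[/eqP].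
have E a : imC (a * inner f (V g) + a^*%C * inner g (V f)) = 0.
  have := im0 (a *: g + f).
  rewrite linV !innerDl !innerDr !innerZl !innerZr.
  have := im0 f; have := im0 g; rewrite !partsE/= => hf hg; rewrite hf hg; lra.
rewrite (inner_conj g (V f)).
have := E 1; have := E 'i%C; rewrite !partsE/= => h1 h2.
by apply: eqC; rewrite !partsE/=; lra.
Qed.

Lemma nonneg_CS (V : L2 -> L2) f g : linear V -> nonneg_op V ->
  sqn (inner f (V g)) <= reC (inner f (V f)) * reC (inner g (V g)).
Proof.
move=> linV V0; apply: sesquilinear_CS => l.
have : 0 <= reC (inner (l *: g + f) (V (l *: g + f))).
  by have := V0 (l *: g + f); rewrite lecE => /andP[].
rewrite linV !innerDl !innerDr !innerZl !innerZr.
rewrite (nonneg_symmetric linV V0 g f) (inner_conj f (V g)).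
have : imC (inner g (V g)) = 0 by have := V0 g; rewrite lecE => /andP[/eqP].
rewrite /sqn !partsE/= => ->; congr (0 <= _); ring.
Qed.

(* If |V f| <= M |f| then |V f|^2 <= M <f, V f>, so that B := 1 - V/M is a
   contraction.  With 0 <= B <= 1, the fixed point of Y = (B + Y^2)/2 is
   1 - (1 - B)^(1/2); the iterates below converge to it in norm, because they are
   dominated by the scalar iteration c |-> (1 + c^2)/2. *)
Lemma nonneg_contraction (V : L2 -> L2) (M : R) f : linear V -> nonneg_op V ->
  0 < M -> (forall f, L2norm (V f) <= M * L2norm f) ->
  L2norm (f - (M^-1)%:C *: V f) <= L2norm f.
Proof.
move=> linV V0 M0 VM.
have q0 h : 0 <= reC (inner h (V h)) by have := V0 h; rewrite lecE => /andP[].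
have qM h : reC (inner h (V h)) <= M * n2 h.
  apply: le_trans (re_inner_le _ _) _; rewrite -n2E expr2 mulrCA.
  by rewrite ler_wpM2l ?L2norm_ge0.
(* Cauchy-Schwarz for the form of [V] between V f and f gives |V f|^4 <= M |V f|^2 <f, V f>; divide
   by |V f|^2. *)
have VV : n2 (V f) <= M * reC (inner f (V f)).
  have := nonneg_CS (V f) f linV V0; rewrite inner_self /sqn/=.
  have := qM (V f); have := q0 f; have := n2_ge0 (V f).
  set x := n2 _; set y := reC (inner f _); set z := reC _ => x0 y0 zx h.
  have [->|xn] := eqVneq x 0; first by rewrite mulr_ge0// ltW.
  have xp : 0 < x by rewrite lt_neqAle eq_sym xn.
  rewrite -(ler_pM2l xp); nra.
rewrite -(ler_pXn2r (n := 2)) ?nnegrE ?L2norm_ge0// !n2E.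
rewrite n2B innerZr n2Z /sqn !partsE/= mul0r subr0 expr0n addr0.
have : M^-1 ^+ 2 * n2 (V f) <= M^-1 * reC (inner f (V f)).
  rewrite expr2 -mulrA ler_pM2l ?invr_gt0// -(ler_pM2l M0) mulrA.
  by rewrite mulfV ?gt_eqF// mul1r.
have : 0 <= M^-1 * reC (inner f (V f)) by rewrite mulr_ge0// invr_ge0 ltW.
lra.
Qed.

Fixpoint sqrt_iter (B : L2 -> L2) (n : nat) : L2 -> L2 :=
  if n is m.+1 then
    fun f => (2^-1)%:C *: (B f + sqrt_iter B m (sqrt_iter B m f))
  else fun=> 0.

Fixpoint sqrt_maj (n : nat) : R :=
  if n is m.+1 then 2^-1 * (1 + sqrt_maj m ^+ 2) else 0.

Lemma sqrt_maj_ge0 n : 0 <= sqrt_maj n.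
Proof. by case: n => //= n; rewrite mulr_ge0// addr_ge0// sqr_ge0. Qed.

Lemma sqrt_maj_le1 n : sqrt_maj n <= 1.
Proof. by elim: n => //= n IH; have := sqrt_maj_ge0 n; nra. Qed.

Lemma sqrt_maj_le n m : (n <= m)%N -> sqrt_maj n <= sqrt_maj m.
Proof.
move=> nm; apply: (homo_leq lexx le_trans _ nm) => {nm}n.
by rewrite /=; have := sqr_ge0 (1 - sqrt_maj n); nra.
Qed.

Section iter.
Variable B : L2 -> L2.
Hypotheses (linB : linear B) (symB : symmetric_op B)
  (B1 : forall f, L2norm (B f) <= L2norm f).
Local Notation Y := (sqrt_iter B).
Local Notation c := sqrt_maj.

Lemma sqrt_iter_linear n : linear (Y n).
Proof.
elim: n => [|n IH] a f g /=; first by rewrite scaler0 addr0.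
rewrite linB IH IH scalerA mulrC -scalerA -scalerDr; congr (_ *: _).
by rewrite scalerDr addrACA.
Qed.

Lemma sqrt_iter_symmetric n : symmetric_op (Y n).
Proof.
elim: n => [|n IH] f g /=; first by rewrite inner0r inner0l.
rewrite innerZr innerZl innerDr innerDl symB !IH; congr (_ * _).
by apply: eqC; rewrite /= ?oppr0.
Qed.

Lemma sqrt_iterB n f g : Y n (f - g) = Y n f - Y n g.
Proof.
by rewrite addrC -scaleN1r sqrt_iter_linear scaleN1r addrC.
Qed.

Lemma sqrt_iter_norm n f : L2norm (Y n f) <= c n * L2norm f.
Proof.
elim: n f => [|n IH] f /=; first by rewrite L2norm0 mul0r.
rewrite L2norm_re ?invr_ge0// -mulrA ler_pM2l ?invr_gt0//.
apply: le_trans (L2norm_triangle _ _) _; rewrite mulrDl mul1r lerD//.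
apply: le_trans (IH _) _; rewrite expr2 -mulrA ler_wpM2l ?sqrt_maj_ge0//.
Qed.

(** With Y' the iterate after Y, the split Y'^2 - Y^2 = Y' (Y' - Y) + (Y' - Y) Y holds without
    commutation, and the scalar sequence [c] obeys the same recursion with equality. *)
Lemma sqrt_iter_step n f :
  L2norm (Y n.+1 f - Y n f) <= (c n.+1 - c n) * L2norm f.
Proof.
elim: n f => [|n IH] f.
  rewrite /= subr0 addr0 expr0n /= addr0 mulr1 subr0 L2norm_re ?invr_ge0//.
  by rewrite ler_pM2l ?invr_gt0.
have -> : Y n.+2 f - Y n.+1 f =
   (2^-1)%:C *: (Y n.+1 (Y n.+1 f - Y n f) + (Y n.+1 (Y n f) - Y n (Y n f))).
  rewrite sqrt_iterB addrA subrK -[in RHS]scaleN1r.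
  rewrite [Y n.+2]/= [Y n.+1 f in LHS]/= -scalerBr; congr (_ *: _).
  by rewrite opprD addrACA subrr add0r scaleN1r.
rewrite L2norm_re ?invr_ge0//.
have -> : (c n.+2 - c n.+1) * L2norm f =
   2^-1 * ((c n.+1 - c n) * (c n.+1 * L2norm f) + (c n.+1 - c n) * (c n * L2norm f)).
  rewrite [c n.+2]/=; have -> : c n.+1 = 2^-1 * (1 + c n ^+ 2) by [].
  by field.
rewrite ler_pM2l ?invr_gt0//; apply: le_trans (L2norm_triangle _ _) _.
have cc : 0 <= c n.+1 - c n by rewrite subr_ge0 sqrt_maj_le.
apply: lerD.
  apply: le_trans (sqrt_iter_norm _ _) _; rewrite [leRHS]mulrCA.
  by rewrite ler_wpM2l ?sqrt_maj_ge0.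
by apply: le_trans (IH _) _; rewrite ler_wpM2l// sqrt_iter_norm.
Qed.

Lemma sqrt_iter_dist n k f :
  L2norm (Y (n + k) f - Y n f) <= (c (n + k) - c n) * L2norm f.
Proof.
elim: k => [|k IH]; first by rewrite addn0 !subrr L2norm0 mul0r.
rewrite addnS -(subrK (Y (n + k) f) (Y _ f)) -addrA.
apply: le_trans (L2norm_triangle _ _) _.
by have := sqrt_iter_step (n + k) f; lra.
Qed.

Lemma sqrt_iter_cvg : exists2 Z : L2 -> L2,
  forall f, L2_cvg (fun n => Y n f) (Z f) &
  forall f, L2norm (Z f) <= L2norm f.
Proof.
have cc : cvgn c.
  apply: nondecreasing_is_cvgn; first exact: sqrt_maj_le.
  by exists 1 => _ [n _ <-]; exact: sqrt_maj_le1.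
have cauchy f : exists g, L2_cvg (fun n => Y n f) g.
  apply: L2_complete => e e0.
  have p0 : 0 < 1 + L2norm f by rewrite ltr_pwDl// L2norm_ge0.
  have e2 : 0 < e / (1 + L2norm f) / 2 by rewrite !divr_gt0.
  have /cvgrPdist_lt/(_ _ e2)[N _ hN] := cc.
  have H m n : (N <= n)%N -> (n <= m)%N -> L2norm (Y m f - Y n f) < e.
    move=> Nn nm; rewrite -(subnKC nm); apply: le_lt_trans (sqrt_iter_dist _ _ _) _.
    rewrite subnKC//; have := hN _ Nn; have := hN _ (leq_trans Nn nm).
    rewrite !ltr_norml => /andP[h1 h2] /andP[h3 h4].
    have h : c m - c n < e / (1 + L2norm f) by lra.
    have cmn : 0 <= c m - c n by rewrite subr_ge0 sqrt_maj_le.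
    move: h; rewrite ltr_pdivlMr// => h; have := L2norm_ge0 f; nra.
  exists N => m n Nm Nn; have [nm|/ltnW mn] := leqP n m; first exact: H.
  by rewrite -opprB L2normN; exact: H.
have [Z hZ] := choice cauchy; exists Z => // f.
have lim := L2_cvg_norm (hZ f).
rewrite -(cvg_lim (@Rhausdorff R) lim); apply: limr_le.
  by apply/cvg_ex; eexists; exact: lim.
apply: nearW => n; apply: le_trans (sqrt_iter_norm _ _) _.
by rewrite ler_piMl ?L2norm_ge0// sqrt_maj_le1.
Qed.

End iter.

Lemma op_sqrt_exists (V : L2 -> L2) : linear V -> bounded_op V -> nonneg_op V ->
  exists W : L2 -> L2, [/\ linear W, bounded_op W, nonneg_op W &
    forall f, W (W f) = V f].
Proof.
move=> linV [M0 VM0] V0.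
(* The given bound may be zero or negative; a positive one is needed to divide by it. *)
pose M := Num.max M0 1.
have Mp : 0 < M by rewrite lt_max ltr01 orbT.
have VM f : L2norm (V f) <= M * L2norm f.
  by apply: le_trans (VM0 f) _; rewrite ler_wpM2r ?L2norm_ge0// le_max lexx.
have symV := nonneg_symmetric linV V0.
pose B f := f - (M^-1)%:C *: V f.
have linB : linear B.
  move=> a f g; rewrite /B linV scalerBr scalerDr opprD addrACA; congr (_ + (_ + _)).
  by rewrite !scalerA mulrC -scalerN.
have symB : symmetric_op B.
  move=> f g; rewrite /B innerBr innerBl innerZr innerZl symV; congr (_ - _ * _).
  by apply: eqC; rewrite /= ?oppr0.
have B1 f : L2norm (B f) <= L2norm f by exact: nonneg_contraction.
have [Z hZ Z1] := sqrt_iter_cvg linB B1.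
have linZ : linear Z.
  move=> a f g; apply: (L2_cvg_unique (hZ _)).
  have := L2_cvg_cmb a (hZ f) (hZ g).
  move=> h e e0; have [N hN] := h e e0; exists N => n /hN.
  by rewrite (sqrt_iter_linear linB).
(* The fixed-point equation 2 Z = B + Z^2, obtained by computing the limit of B + Y_n^2 in two
   ways. *)
have ZZ f : B f + Z (Z f) = 2%:C *: Z f.
  have c1 : L2_cvg (fun n => B f + sqrt_iter B n (sqrt_iter B n f)) (B f + Z (Z f)).
    have cY : L2_cvg (fun n => sqrt_iter B n (sqrt_iter B n f)) (Z (Z f)).
      (* Insert Y_n (Z f); since |Y_n| <= 1, the first difference is at most |Y_n f - Z f|. *)
      apply: (@L2_cvg_squeeze _ _ _
        (fun n => L2norm (sqrt_iter B n f - Z f) + L2norm (sqrt_iter B n (Z f) - Z (Z f)))) => [n|].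
        rewrite -(subrK (sqrt_iter B n (Z f)) (sqrt_iter B n (sqrt_iter B n f))) -addrA.
        apply: le_trans (L2norm_triangle _ _) _; rewrite lerD2r -(sqrt_iterB linB).
        apply: le_trans (sqrt_iter_norm B1 _ _) _.
        by rewrite ler_piMl ?L2norm_ge0// sqrt_maj_le1.
      rewrite -(addr0 0); apply: cvgD; exact/L2_cvgP.
    have := L2_cvg_cmb 1 (@L2_cvg_cst _ (B f)) cY; rewrite scale1r.
    by apply.
  have c2 : L2_cvg (fun n => B f + sqrt_iter B n (sqrt_iter B n f)) (2%:C *: Z f).
    have := L2_cvg_cmb 2%:C (hZ f) (@L2_cvg_cst _ 0); rewrite addr0.
    move=> h e e0; have [N hN] := h e e0; exists N => n Nn.
    have := hN n.+1 (leqW Nn); rewrite addr0 /= scalerA.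
    suff -> : 2%:C * (2^-1)%:C = 1 :> C by rewrite scale1r.
    by rewrite -rmorphM/= mulfV.
  exact: L2_cvg_unique c1 c2.
pose s : C := (Num.sqrt M)%:C.
(* By the fixed-point equation (1 - Z)^2 = 1 - B = V / M. *)
pose W f := s *: (f - Z f).
have linW : linear W.
  move=> a f g; rewrite /W linZ opprD addrACA -scalerBr scalerDr; congr (_ + _).
  by rewrite !scalerA mulrC.
exists W; split => //.
- exists (Num.sqrt M * 2) => f; rewrite /W L2norm_re ?sqrtr_ge0// -mulrA.
  rewrite ler_wpM2l ?sqrtr_ge0//; apply: le_trans (L2norm_triangle _ _) _.
  by rewrite L2normN; have := Z1 f; lra.
- move=> f; rewrite /W innerZr innerBr inner_self lecE !partsE/=.
  have imZ : imC (inner f (Z f)) = 0.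
    have E n : imC (inner f (sqrt_iter B n f)) = 0.
      have := inner_conj f (sqrt_iter B n f); rewrite -(sqrt_iter_symmetric symB).
      by move/(congr1 (fun z : C => imC z)); rewrite !partsE/=; lra.
    have := L2_cvg_im_inner (h := f) (hZ f); under eq_cvg do rewrite E.
    move=> lim; exact: (cvg_unique _ lim (cvg_cst 0)).
  rewrite imZ subr0 mulr0 !mul0r addr0 subr0 eqxx /=.
  rewrite mulr_ge0 ?sqrtr_ge0// subr_ge0.
  apply: le_trans (re_inner_le _ _) _; rewrite -n2E expr2.
  by rewrite ler_wpM2l ?L2norm_ge0.
- move=> f; have linW0 : W (s *: (f - Z f)) = s *: W (f - Z f).
    have W0 : W 0 = 0.
      by have := linW (-1) 0 0; rewrite scaler0 addr0 scaleN1r addNr.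
    by have := linW s (f - Z f) 0; rewrite !addr0 W0 addr0.
  rewrite [W f]/W linW0 /W scalerA.
  have -> : Z (f - Z f) = Z f - Z (Z f).
    by have := linZ (-1) (Z f) f; rewrite !scaleN1r ![- _ + _]addrC.
  have -> : f - Z f - (Z f - Z (Z f)) = (M^-1)%:C *: V f.
    have -> : (M^-1)%:C *: V f = f - B f by rewrite /B opprB addrCA subrr addr0.
    have -> : B f = 2%:C *: Z f - Z (Z f) by rewrite -ZZ addrK.
    rewrite (rmorph_nat (@real_complex R)) scaler_nat mulr2n.
    by rewrite !opprD !opprK !addrA.
  rewrite scalerA; suff -> : s * s * (M^-1)%:C = 1 by rewrite scale1r.
  by rewrite /s -!rmorphM/= -expr2 sqr_sqrtr ?ltW// mulfV// gt_eqF.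
Qed.

End square_root.

(** * Weak derivatives and traces *)

Section primitives.
Variable R : realType.
Local Notation mu := (@lebesgue_measure R).
Local Notation I01 := (@I01 R).
Implicit Types (u v w : R -> R).

Hint Extern 0 (measurable _) => solve [exact: measurable_I01] : core.

(** For x in [0,1] this is the integral over (0, x). Extending [u] by zero allows the lower limit
    -oo, the shape in which [FTC1Ny] and [continuous_FTC1] apply. *)
Definition Prim u (x : R) : R := \int[mu]_(t in `]-oo, x]) (u \_ I01) t.

Lemma restrict_integrable u : mu.-integrable I01 (EFin \o u) ->
  mu.-integrable setT (EFin \o (u \_ I01)).
Proof.
move=> iu; rewrite -restrict_EFin; apply/integrable_restrict => //.
by rewrite setTI.
Qed.

Lemma restrict_integrableS u (A : set (measurableTypeR R)) : measurable A ->
  mu.-integrable I01 (EFin \o u) -> mu.-integrable A (EFin \o (u \_ I01)).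
Proof. by move=> mA /restrict_integrable; apply: integrableS. Qed.

Lemma I01E (x : R) : I01 x <-> 0 < x /\ x < 1.
Proof. by rewrite /I01 /= in_itv/=; split => [/andP|[-> ->]]. Qed.

Lemma patch_in (A : set R) u x : A x -> (u \_ A) x = u x.
Proof. by move=> Ax; rewrite /patch mem_set. Qed.

Lemma patch_out (A : set R) u x : ~ A x -> (u \_ A) x = 0.
Proof. by move=> Ax; rewrite /patch memNset. Qed.

Lemma patch_eq0 (A : set R) u x : u x = 0 -> (u \_ A) x = 0.
Proof. by move=> u0; rewrite /patch; case: ifP. Qed.

Lemma Prim_parameterized u x :
  Prim u x = parameterized_integral mu 0 x (u \_ I01).
Proof.
rewrite /Prim /parameterized_integral.
rewrite Rintegral_mkcond [RHS]Rintegral_mkcond; congr (Rintegral _ _ _).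
apply/funext => t; have [t01|t01] := pselect (I01 t); last first.
  by have U0 := patch_out u t01; rewrite !(patch_eq0 _ U0).
have [t0 _] := (I01E t).1 t01.
have [tx|tx] := leP t x.
  by rewrite !patch_in//= in_itv/= ?tx// (ltW t0).
by rewrite !patch_out//= in_itv/= ?(ltW t0)/=; apply/negP; rewrite -ltNge.
Qed.

Lemma Rintegral_eq0 (A : set (measurableTypeR R)) u :
  (forall x, A x -> u x = 0) -> \int[mu]_(x in A) u x = 0.
Proof.
move=> u0; rewrite /Rintegral (eq_integral (cst 0%E)) ?integral0//.
by move=> x /set_mem/u0 ->.
Qed.

Lemma Prim0 u : Prim u 0 = 0.
Proof.
apply: Rintegral_eq0 => x /=; rewrite in_itv/= => x0.
by rewrite patch_out// => /I01E[]; rewrite ltNge x0.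
Qed.

Lemma Prim1 u : Prim u 1 = \int[mu]_(x in I01) u x.
Proof.
rewrite /Prim Rintegral_mkcond [RHS]Rintegral_mkcond; congr (Rintegral _ _ _).
apply/funext => t; have [t01|t01] := pselect (I01 t); last first.
  by have U0 := patch_out u t01; rewrite !(patch_eq0 _ U0).
have [t0 t1] := (I01E t).1 t01.
by rewrite !patch_in//= in_itv/= (ltW t1).
Qed.

Lemma Prim_continuous u : mu.-integrable I01 (EFin \o u) ->
  {within `[0, 1], continuous (Prim u)}.
Proof.
move=> iu; have i01 : mu.-integrable `[0, 1] (EFin \o u \_ I01).
  exact: restrict_integrableS.
have := parameterized_integral_continuous ler01 i01.
apply: subspace_eq_continuous => x _.
exact/esym/Prim_parameterized.
Qed.

Lemma I01_sub : I01 `<=` `[0, 1].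
Proof. by move=> x /I01E[x0 x1]; rewrite /= in_itv/= !ltW. Qed.

Lemma continuous_sqi u : {within `[0, 1], continuous u} -> sqi u.
Proof.
move=> cu; apply/sqiP; split.
  have mu01 := subspace_continuous_measurable_fun (measurable_itv `[0, 1]) cu.
  by apply: measurable_funS mu01 => //; exact: I01_sub.
have : mu.-integrable `[0, 1] (EFin \o (u \* u)).
  apply: continuous_compact_integrable; first exact: segment_compact.
  by move=> x; exact: (cvgM (cu x) (cu x)).
by apply: integrableS => //; exact: I01_sub.
Qed.

Lemma Prim_sqi u : sqi u -> sqi (Prim u).
Proof. by move=> su; apply/continuous_sqi/Prim_continuous/sqi_integrable. Qed.

Lemma EFin_Rintegral (A : set (measurableTypeR R)) u : measurable A ->
  mu.-integrable A (EFin \o u) ->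
  (\int[mu]_(x in A) (u x)%:E = (\int[mu]_(x in A) u x)%:E)%E.
Proof. by move=> mA iu; rewrite /Rintegral fineK// integrable_fin_num. Qed.

(** The inner integral over y, at fixed x, of the Fubini argument in [Prim_by_parts]. *)
Lemma Prim_tail v x : mu.-integrable I01 (EFin \o v) ->
  mu.-integrable setT (EFin \o (fun y => (v \_ I01) y * (x <= y)%R%:R)) /\
  \int[mu]_y ((v \_ I01) y * (x <= y)%R%:R) = Prim v 1 - Prim v x.
Proof.
move=> iv; have iV := restrict_integrable iv.
have iP : mu.-integrable setT (EFin \o ((v \_ I01) \_ `]-oo, x[)).
  rewrite -restrict_EFin; apply/integrable_restrict => //.
  by rewrite setTI; apply: integrableS iV.
have E y : (v \_ I01) y * (x <= y)%R%:R = (v \_ I01) y - ((v \_ I01) \_ `]-oo, x[) y.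
  have [xy|yx] := leP x y.
    by rewrite mulr1 [X in _ - X]patch_out ?subr0//= in_itv/= ltNge xy.
  by rewrite mulr0 [X in _ - X]patch_in ?subrr//= in_itv/= yx.
split.
  have := integrableB measurableT iV iP; apply: eq_integrable => // y _ /=.
  by rewrite E EFinB.
under eq_Rintegral do rewrite E.
rewrite RintegralB// Prim1 [X in _ = X - _]Rintegral_mkcond; congr (_ - _).
rewrite -Rintegral_mkcond Rintegral_itv_bndo_bndc//.
by apply: restrict_integrableS.
Qed.

(* Fubini for u(x) v(y) on the triangle x <= y *)
Lemma Prim_by_parts u v : sqi u -> sqi v ->
  rip (Prim u) v + rip u (Prim v) = Prim u 1 * Prim v 1.
Proof.
move=> su sv; have iu := sqi_integrable su; have iv := sqi_integrable sv.
set U := u \_ I01; set V := v \_ I01.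
have iU : mu.-integrable setT (EFin \o U) := restrict_integrable iu.
have iV : mu.-integrable setT (EFin \o V) := restrict_integrable iv.
have mU : measurable_fun setT U by have /integrableP[/measurable_EFinP] := iU.
have mV : measurable_fun setT V by have /integrableP[/measurable_EFinP] := iV.
pose F (p : measurableTypeR R * measurableTypeR R) : \bar R :=
  (U p.1 * (V p.2 * ((p.1 : R) <= p.2)%R%:R))%:E.
have mF : measurable_fun setT F.
  apply/measurable_EFinP; apply: measurable_funM.
    exact: (measurableT_comp mU measurable_fst).
  apply: measurable_funM; first exact: (measurableT_comp mV measurable_snd).
  rewrite (_ : (fun p => _) = \1_[set p : measurableTypeR R * measurableTypeR R | (p.1 : R) <= p.2]); last first.
    by apply/funext => p; rewrite indicE mem_setE.
  apply: measurable_indic.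
  have := @measurable_fun_ler _ _ R setT _ _ (@measurable_fst _ _ (measurableTypeR R) (measurableTypeR R)) (@measurable_snd _ _ (measurableTypeR R) (measurableTypeR R)).
  move=> /(_ measurableT [set true] I); rewrite setTI.
  by congr (measurable _); apply/seteqP; split => p /=.
(* Without the indicator of the triangle, |F| integrates to the product of the integrals of |U| and
   |V|. *)
have iF : (mu \x mu)%E.-integrable setT F.
  apply/(integrable12ltyP _ _ mF).
  apply: (@le_lt_trans _ _ (\int[mu]_x (`|U x|%:E * (\int[mu]_y `|V y|%:E)))%E).
    apply: ge0_le_integral => //.
    - by move=> x _; exact: integral_ge0.
    - apply: (measurable_fun_fubini_tonelli_F (abse \o F)) => //=.
      exact: measurableT_comp.
    - by apply: emeasurable_funM => //; apply/measurable_EFinP; exact: measurableT_comp.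
    - move=> x _; rewrite -ge0_integralZl//; last first.
        by apply/measurable_EFinP; exact: measurableT_comp.
      apply: ge0_le_integral => //.
      - apply: measurableT_comp => //.
        apply/measurable_EFinP; apply: measurable_funM => //.
          by rewrite [X in measurable_fun _ X](_ : _ = cst (U x)).
        by have [/integrableP[/measurable_EFinP]] := Prim_tail x iv.
      - by apply: emeasurable_funM => //; apply/measurable_EFinP; exact: measurableT_comp.
      move=> y _; rewrite /F /= !normrM -EFinM lee_fin ler_wpM2l//.
      by rewrite ler_piMr// normr_nat lern1 leq_b1.
  rewrite ge0_integralZr//; last 2 first.
    by apply/measurable_EFinP; exact: measurableT_comp.
    exact: integral_ge0.
  case/integrableP: iU => _ iU'; case/integrableP: iV => _ iV'.
  have U0 : (0 <= \int[mu]_x `|U x|%:E)%E by apply: integral_ge0.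
  by apply: lte_mul_pinfty => //; rewrite ge0_fin_numE.
have := Fubini iF => /(congr1 fine).
have -> : (\int[mu]_x \int[mu]_y F (x, y) = \int[mu]_x (U x * (Prim v 1 - Prim v x))%:E)%E.
  apply: eq_integral => x _; have [it E] := Prim_tail x iv.
  rewrite -E EFinM -EFin_Rintegral// -integralZl//.
have -> : (\int[mu]_y \int[mu]_x F (x, y) = \int[mu]_y (V y * Prim u y)%:E)%E.
  apply: eq_integral => y _.
  have iuy : mu.-integrable `]-oo, y] (EFin \o U) by exact: restrict_integrableS.
  rewrite EFinM /Prim -EFin_Rintegral// -integralZl// integral_mkcond.
  apply: eq_integral => x _; rewrite /F /patch /= mem_setE in_itv/=.
  by case: leP => xy; rewrite ?mulr1 ?mulr0 // -?EFinM mulrC.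
rewrite -![fine _]/(Rintegral _ _ _) => E.
have {}E : rip u (fun x => - 1 * Prim v x + Prim v 1) = rip v (Prim u).
  rewrite /rip Rintegral_mkcond [RHS]Rintegral_mkcond.
  transitivity (\int[mu]_x (U x * (Prim v 1 - Prim v x))).
    apply: eq_Rintegral => x _; rewrite /U.
    have [xI|xI] := pselect (I01 x); last by rewrite !patch_out ?mul0r.
    by rewrite !patch_in// mulN1r addrC.
  rewrite E; apply: eq_Rintegral => x _; rewrite /V.
  by have [xI|xI] := pselect (I01 x); [rewrite !patch_in|rewrite !patch_out ?mul0r].
move: E; rewrite ripC (@rip_cmbl _ (-1) (Prim v) (cst (Prim v 1)))//; first last.
- exact: sqi_cst.
- exact: Prim_sqi.
have -> : rip (cst (Prim v 1)) u = Prim v 1 * Prim u 1.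
  by rewrite (Prim1 u) -RintegralZl.
by rewrite (ripC v) (ripC (Prim v)); lra.
Qed.

End primitives.

(** * Test functions and the du Bois-Reymond lemma *)

Section du_Bois_Reymond.
Variable R : realType.
Local Notation mu := (@lebesgue_measure R).
Local Notation I01 := (@I01 R).
Implicit Types (u v w phi psi : R -> R).

Hint Extern 0 (measurable _) => solve [exact: measurable_I01] : core.

Lemma Prim_cst (c x : R) : 0 <= x < 1 -> Prim (cst c) x = c * x.
Proof.
move=> /andP[x0 x1]; rewrite /Prim -Rintegral_mkcondr Rintegral_cst; last first.
  exact: measurableI.
have -> : `]-oo, x] `&` I01 = `]0, x]%classic.
  apply/seteqP; split => t /=; rewrite !in_itv/=.
    by move=> [-> /I01E[->]].
  by move=> /andP[t0 tx]; split => //; apply/I01E; split => //; apply: le_lt_trans x1.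
have E : mu `]0, x]%classic = x%:E.
  rewrite lebesgue_measure_itv/= lte_fin; case: ltP => h; first by rewrite oppr0 adde0.
  by congr (_%:E); apply/eqP; rewrite eq_le x0 h.
by rewrite [X in fine X]E.
Qed.

(** By Lebesgue differentiation [w] is almost everywhere the derivative of [Prim w], which is
    locally constant on (0,1). *)
Lemma sqi_Prim_const w : mu.-integrable I01 (EFin \o w) ->
  (forall a b : R, 0 < a -> a < b -> b < 1 -> Prim w a = Prim w b) ->
  ae_eq mu I01 w (cst 0).
Proof.
move=> iw h; have iW := restrict_integrable iw.
have iy y : mu.-integrable `]-oo, y] (EFin \o w \_ I01) by exact: integrableS iW.
have loc : locally_integrable [set: R] (w \_ I01).
  by apply: open_integrable_locally => //; exact: openT.
have := FTC1Ny iy loc; apply: filterS; first exact: (ae_filter_ringOfSetsType mu).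
move=> x [_ dx] Ix /=.
rewrite -(patch_in w Ix) -dx derive1E.
rewrite -(derive1_cst (Prim w x) x) derive1E.
apply: near_eq_derive.
have [x0 x1] := (I01E x).1 Ix.
have nI : \forall y \near x, I01 y by apply: open_nbhs_nbhs; split => //; exact: itv_open.
near=> y; rewrite -/(Prim w y) /=.
have /I01E[y0 y1] : I01 y by near: y.
have [xy|yx|->//] := ltgtP x y; first by apply/esym/h.
exact: h.
Unshelve. all: by end_near. Qed.

(* n s / (1 + n s), where s is the positive part of (x - a) (b - x): a continuous
   function with support [a, b] that increases to the indicator of ]a, b[. *)
Definition hat (a b x : R) : R := ((x - a) * (b - x) + `|(x - a) * (b - x)|) / 2.

Definition bump (a b : R) (n : nat) (x : R) : R :=
  n%:R * hat a b x / (1 + n%:R * hat a b x).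

Lemma hat_ge0 a b x : 0 <= hat a b x.
Proof. by rewrite /hat divr_ge0//; have := ler_norm (- ((x - a) * (b - x))); rewrite normrN; lra. Qed.

Lemma hat_continuous a b : continuous (hat a b).
Proof.
move=> x; apply: cvgMl.
have h : (y - a) * (b - y) @[y --> x] --> (x - a) * (b - x).
  by apply: cvgM; apply: cvgB; [exact: cvg_id|exact: cvg_cst|exact: cvg_cst|exact: cvg_id].
by apply: cvgD => //; exact: cvg_norm.
Qed.

Lemma bump_den a b n x : 0 < 1 + n%:R * hat a b x.
Proof. by rewrite ltr_pwDl// mulr_ge0// hat_ge0. Qed.

Lemma bump_continuous a b n : continuous (bump a b n).
Proof.
move=> x; have h : n%:R * hat a b y @[y --> x] --> n%:R * hat a b x.
  by apply: cvgMr; exact: hat_continuous.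
apply: cvgM => //; apply: cvgV; first by rewrite gt_eqF// bump_den.
by apply: cvgD => //; exact: cvg_cst.
Qed.

Lemma bump_out a b n x : a <= b -> x \notin `[a, b] -> bump a b n x = 0.
Proof.
move=> ab; rewrite in_itv/= negb_and -!ltNge => xab.
suff h0 : (x - a) * (b - x) <= 0.
  by rewrite /bump /hat ler0_norm// subrr mul0r mulr0 mul0r.
by case/orP: xab => h; nra.
Qed.

Lemma bump_bound a b n x : 0 <= bump a b n x <= 1.
Proof.
rewrite /bump; have := bump_den a b n x; have : 0 <= n%:R * hat a b x by rewrite mulr_ge0// hat_ge0.
set t := n%:R * _ => t0 t1; rewrite divr_ge0 ?(ltW t1)//=.
by rewrite ler_pdivrMr// mul1r; lra.
Qed.

Lemma bump_cvg (a b x : R) : a <= b -> (fun n => bump a b n x) @ \oo --> (\1_(`]a, b[%classic : set R) x : R).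
Proof.
move=> ab; rewrite indicE.
have [xab|xab] := pselect (`]a, b[%classic x); last first.
  rewrite memNset//; suff h0 : hat a b x = 0.
    by under eq_cvg do rewrite /bump h0 mulr0 mul0r; exact: cvg_cst.
  have h1 : (x - a) * (b - x) <= 0.
    move: xab; rewrite /= in_itv/= => /negP; rewrite negb_and -!leNgt => /orP[]; nra.
  by rewrite /hat ler0_norm// subrr mul0r.
rewrite mem_set//; move: xab; rewrite /= in_itv/= => /andP[ax xb].
have s0 : 0 < hat a b x.
  have p : 0 < (x - a) * (b - x) by apply: mulr_gt0; lra.
  by rewrite /hat gtr0_norm//; lra.
have E n : bump a b n x = 1 - (1 + n%:R * hat a b x)^-1.
  rewrite /bump; have := bump_den a b n x; move=> ?; field; lra.
under eq_cvg do rewrite E.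
suff h : (fun n => 1 - (1 + n%:R * hat a b x)^-1) @ \oo --> (1 - 0 : R).
  by rewrite subr0 in h.
apply: cvgB; first exact: cvg_cst.
have h : (fun n => (hat a b x)^-1 * n%:R^-1) @ \oo --> (0 : R).
  rewrite -[X in _ --> X](mulr0 (hat a b x)^-1); apply: cvgMr.
  apply/gtr0_cvgV0; first by exists 1%N => // n /= n1; rewrite ltr0n.
  exact: cvgr_idn.
apply: (squeeze_cvgr _ (cvg_cst 0) h).
exists 1%N => // n /= n1; rewrite invr_ge0 (ltW (bump_den _ _ _ _))/=.
have n0 : 0 < n%:R :> R by rewrite ltr0n.
rewrite -invfM lef_pV2 ?posrE ?(mulr_gt0 s0 n0) ?bump_den//.
by rewrite (mulrC (hat a b x)) lerDr ler01.
Qed.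

(** Dominated convergence with majorant |w|: interval integrals of [w] are limits of pairings with
    continuous functions. *)
Lemma bump_integral_cvg w (a b : R) : sqi w -> 0 <= a -> a < b -> b <= 1 ->
  (fun n => rip w (bump a b n)) @ \oo --> Prim w b - Prim w a.
Proof.
move=> sw a0 ab b1; have iw := sqi_integrable sw.
have mw : measurable_fun I01 w := sqi_measurable sw.
pose f (n : nat) (x : measurableTypeR R) : \bar R := (w x * bump a b n x)%:E.
pose g (x : measurableTypeR R) : \bar R := (w x * \1_(`]a, b[%classic : set R) x)%:E.
have mb n : measurable_fun I01 (bump a b n).
  apply: (@measurable_funS _ _ _ _ setT) => //.
  by apply: continuous_measurable_fun; exact: bump_continuous.
have [|||||ig _ lim] := @dominated_convergence _ _ _ mu I01 measurable_I01 f g (fun x => `|w x|%:E).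
- by move=> n; apply/measurable_EFinP; exact: (measurable_funM mw (mb n)).
- apply/measurable_EFinP; apply: measurable_funM => //.
- apply: aeW => x _; apply: cvg_EFin; first exact: nearW.
  by apply: cvgMr; apply: bump_cvg; exact: ltW.
- exact: integrable_norm.
- apply: aeW => x n _; rewrite /f /= lee_fin normrM ler_piMr//.
  by have /andP[h0 h1] := bump_bound a b n x; rewrite ger0_norm.
have E : (\int[mu]_(x in I01) g x)%E = (Prim w b - Prim w a)%:E.
  rewrite (EFin_Rintegral _ ig)//; congr (_%:E).
  rewrite /Prim.
  have iW := restrict_integrable iw.
  rewrite Rintegral_itvB ?bnd_simp ?(ltW ab)//; last exact: restrict_integrableS.
  rewrite -Rintegral_itv_bndo_bndc; last exact: restrict_integrableS.
  rewrite Rintegral_mkcond [RHS]Rintegral_mkcond; apply: eq_Rintegral => x _.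
  rewrite {1}/patch; have [xab|xab] := pselect (`]a, b[%classic x).
    have Ix : I01 x.
      move: xab; rewrite /= in_itv/= => /andP[ax xb]; apply/I01E; split.
        exact: le_lt_trans ax.
      exact: lt_le_trans b1.
    by rewrite mem_set// [RHS]patch_in// patch_in// indicE mem_set// mulr1.
  by rewrite [RHS]patch_out//; case: ifP => // _; rewrite indicE memNset// mulr0.
have : (fun n => fine (\int[mu]_(x in I01) f n x)%E) @ \oo --> Prim w b - Prim w a.
  by apply: fine_cvg; rewrite -E.
exact.
Qed.

Lemma itv_sub_I01 (a b x : R) : 0 < a -> b < 1 -> x \in `[a, b] -> I01 x.
Proof.
move=> a0 b1; rewrite in_itv/= => /andP[ax xb]; apply/I01E; split.
  exact: lt_le_trans ax.
exact: le_lt_trans b1.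
Qed.

Lemma restrict_supp psi (a b : R) : 0 < a -> b < 1 ->
  (forall x, x \notin `[a, b] -> psi x = 0) -> psi \_ I01 = psi.
Proof.
move=> a0 b1 psi0; apply/funext => x.
have [xI|xI] := pselect (I01 x); first by rewrite patch_in.
by rewrite patch_out// psi0//; apply/negP => /(itv_sub_I01 a0 b1).
Qed.

(** The zero mean of [psi] makes its primitive vanish to the right of [b], so the support stays
    compact in (0,1). *)
Lemma Prim_test_fun psi (a b : R) : 0 < a -> a <= b -> b < 1 ->
  continuous psi -> (forall x, x \notin `[a, b] -> psi x = 0) ->
  Prim psi 1 = 0 -> test_fun (Prim psi) /\ derive1 (Prim psi) = psi.
Proof.
move=> a0 ab b1 cpsi psi0 P1.
have PE := restrict_supp a0 b1 psi0.
have ipsi : mu.-integrable I01 (EFin \o psi).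
  by apply/sqi_integrable/continuous_sqi/continuous_subspaceT.
have ftc x : derivable (Prim psi) x 1 /\ derive1 (Prim psi) x = psi x.
  have i1 : mu.-integrable [set` Interval -oo%O (BRight (x + 1))] (EFin \o psi).
    by rewrite -PE; exact: restrict_integrableS.
  have x1 : x < x + 1 by rewrite ltrDl.
  have := continuous_FTC1 x1 i1 (ltNyr _) (cpsi x).
  by rewrite /Prim PE.
have dE : derive1 (Prim psi) = psi by apply/funext => x; case: (ftc x).
split => //; split; [by move=> x; case: (ftc x)|by rewrite dE|].
exists a, b; split => // x; rewrite in_itv/= negb_and -!ltNge => /orP[xa|bx].
  apply: Rintegral_eq0 => t /=; rewrite in_itv/= => tx.
  rewrite PE psi0//= in_itv/= negb_and -!ltNge; apply/orP; left.
  exact: le_lt_trans xa.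
rewrite -P1 /Prim PE Rintegral_mkcond [RHS]Rintegral_mkcond.
apply: eq_Rintegral => t _; have [tab|tab] := boolP (t \in `[a, b]); last first.
  by rewrite !patch_eq0// psi0.
move: tab; rewrite in_itv/= => /andP[_ tb].
by rewrite !patch_in//= in_itv/=; apply: le_trans tb _; exact: ltW.
Qed.

(** Being the primitive of its derivative, a test function can be fed to [Prim_by_parts]. *)
Lemma test_funP phi : test_fun phi -> [/\ sqi phi, sqi (derive1 phi), phi 1 = 0 &
  forall x, 0 <= x <= 1 -> phi x = Prim (derive1 phi) x].
Proof.
move=> [dphi cphi' [a [b [a0 ab b1 phi0]]]].
have cphi : continuous phi.
  by move=> x; apply: differentiable_continuous; apply/derivable1_diffP.
have phi'0 x : x \notin `[a, b] -> derive1 phi x = 0.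
  move=> xab; rewrite -(derive1_cst (0 : R) x) !derive1E.
  apply: near_eq_derive.
  have : \forall y \near x, (~` `[a, b]%classic) y.
    apply: open_nbhs_nbhs; split; first exact/closed_openC/itv_closed.
    exact/negP.
  by apply: filterS => y /= /negP yab; rewrite phi0.
have PE := restrict_supp a0 b1 phi'0.
have phi00 : phi 0 = 0 by rewrite phi0// in_itv/= negb_and -ltNge a0.
split.
- by apply/continuous_sqi/continuous_subspaceT.
- by apply/continuous_sqi/continuous_subspaceT.
- by rewrite phi0// in_itv/= negb_and -!ltNge b1 orbT.
(* The point 0 is treated apart because [continuous_FTC2] asks for a nondegenerate interval. *)
move=> x /andP[]; rewrite le_eqVlt => /predU1P[<- _|x0 x1]; first by rewrite Prim0.
have := @continuous_FTC2 R (derive1 phi) phi 0 x x0.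
have cw : {within `[0, x], continuous (derive1 phi)} by exact: continuous_subspaceT.
have dw : derivable_oo_LRcontinuous phi 0 x.
  split; first by move=> y _; exact: dphi.
    by apply/cvg_at_right_filter; exact: cphi.
  by apply/cvg_at_left_filter; exact: cphi.
move=> /(_ cw dw (fun _ _ => erefl)) /(congr1 fine); rewrite /= phi00 subr0 => <-.
by rewrite Prim_parameterized PE.
Qed.

Lemma sqi_weak_deriv_prim v (c : R) phi : sqi v -> test_fun phi ->
  rip (fun x => c + Prim v x) (derive1 phi) = - rip v phi.
Proof.
move=> sv tphi; have [sp sp' p1 pE] := test_funP tphi.
have := Prim_by_parts sv sp'.
have -> : Prim (derive1 phi) 1 = 0 by rewrite -pE// ler01 lexx.
have -> : rip v (Prim (derive1 phi)) = rip v phi.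
  apply: eq_Rintegral => x /set_mem/I01E[x0 x1]; rewrite pE//.
  by rewrite !ltW.
rewrite mulr0 => E.
have -> : rip (fun x => c + Prim v x) (derive1 phi) =
    rip (fun x => 1 * Prim v x + cst c x) (derive1 phi).
  by apply: eq_Rintegral => x _; rewrite mul1r addrC.
rewrite rip_cmbl//; [|exact: Prim_sqi|exact: sqi_cst].
have -> : rip (cst c) (derive1 phi) = c * Prim (derive1 phi) 1.
  by rewrite Prim1 -RintegralZl//; exact: sqi_integrable.
by rewrite -pE ?ler01 ?lexx// p1; lra.
Qed.

(** A combination of two bumps with zero mean is the derivative of a test function, so the pairing
    of [u] with a bump is proportional to the integral of the bump. In the limit, the integral of
    [u] over [a, b] is proportional to b - a. *)
Lemma du_Bois_Reymond u : sqi u ->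
  (forall phi, test_fun phi -> rip u (derive1 phi) = 0) ->
  exists c : R, ae_eq mu I01 u (cst c).
Proof.
move=> su u0.
have sb a b n : sqi (bump a b n).
  by apply/continuous_sqi/continuous_subspaceT; exact: bump_continuous.
have s1 : sqi (cst (1 : R)) by exact: sqi_cst.
(* Here [psi] is k' times the first bump minus k times the second, with k and k' their integrals. *)
have swap (a b a' b' : R) n m : 0 < a -> a < b -> b < 1 -> 0 < a' -> a' < b' -> b' < 1 ->
    rip u (bump a b n) * rip (cst 1) (bump a' b' m) =
    rip u (bump a' b' m) * rip (cst 1) (bump a b n).
  move=> a0 ab b1 a0' ab' b1'.
  set k := rip (cst 1) (bump a b n); set k' := rip (cst 1) (bump a' b' m).
  pose psi x := k' * bump a b n x + (- k) * bump a' b' m x.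
  have cpsi : continuous psi.
    move=> x; apply: cvgD; apply: cvgMr; exact: bump_continuous.
  pose c := Num.min a a'; pose d := Num.max b b'.
  have psi0 x : x \notin `[c, d] -> psi x = 0.
    rewrite in_itv/= negb_and -!ltNge lt_min gt_max => h.
    rewrite /psi !bump_out ?(ltW ab) ?(ltW ab')// ?mulr0 ?addr0//.
      by rewrite in_itv/= negb_and -!ltNge; case/orP: h => /andP[h1 h2]; rewrite ?h1 ?h2 ?orbT.
    by rewrite in_itv/= negb_and -!ltNge; case/orP: h => /andP[h1 h2]; rewrite ?h1 ?h2 ?orbT.
  have c0 : 0 < c by rewrite lt_min a0.
  have cd : c <= d by rewrite ge_min le_max (ltW ab).
  have d1 : d < 1 by rewrite gt_max b1.
  have ripE w : sqi w -> rip w psi = k' * rip w (bump a b n) - k * rip w (bump a' b' m).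
    move=> sw; rewrite ripC /psi (rip_cmbl _ (sb _ _ _) (sqiZ _ (sb _ _ _)))//.
    rewrite (ripC _ w); congr (_ + _).
    have := rip_cmbl (- k) (sb a' b' m) (sqi_cst 0) sw.
    have -> : rip (cst 0) w = 0 by apply: Rintegral_eq0 => x _; rewrite mul0r.
    rewrite addr0 => E; rewrite (ripC w) -mulNr -E.
    by apply: eq_Rintegral => x _; rewrite /= addr0.
  have P0 : Prim psi 1 = 0.
    rewrite Prim1; transitivity (rip (cst 1) psi).
      by apply: eq_Rintegral => x _; rewrite mul1r.
    by rewrite ripE// -/k -/k' mulrC subrr.
  have [tP dP] := Prim_test_fun c0 cd d1 cpsi psi0 P0.
  have := u0 _ tP; rewrite dP ripE//; lra.
(* The second bump is now taken on the fixed interval [1/4, 3/4]. Its length 1/2 is the source of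
   the factor 2 in the constant [2 * kap]. *)
have q0 : 0 < 4^-1 :> R by [].
have q1 : 4^-1 < 3 / 4 :> R by lra.
have q2 : 3 / 4 < 1 :> R by lra.
pose kap := Prim u (3 / 4) - Prim u 4^-1.
have half : Prim (cst 1) (3 / 4) - Prim (cst 1) 4^-1 = 2^-1 :> R.
  by rewrite !Prim_cst//; lra.
have limT w (a b : R) : sqi w -> 0 < a -> a < b -> b < 1 ->
    (fun n => rip w (bump a b n)) @ \oo --> Prim w b - Prim w a.
  by move=> sw a0 ab b1; apply: bump_integral_cvg => //; exact: ltW.
have step1 (a b : R) n : 0 < a -> a < b -> b < 1 ->
    rip u (bump a b n) * 2^-1 = kap * rip (cst 1) (bump a b n).
  move=> a0 ab b1.
  have l1 : (fun m => rip u (bump a b n) * rip (cst 1) (bump 4^-1 (3 / 4) m)) @ \oo -->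
      rip u (bump a b n) * 2^-1.
    by apply: cvgMr; rewrite -half; exact: limT.
  have l2 : (fun m => rip u (bump 4^-1 (3 / 4) m) * rip (cst 1) (bump a b n)) @ \oo -->
      kap * rip (cst 1) (bump a b n).
    by apply: cvgMl; exact: limT.
  move: l1; under eq_cvg do rewrite swap//.
  by move=> l1; exact: (cvg_unique _ l1 l2).
have step2 (a b : R) : 0 < a -> a < b -> b < 1 ->
    (Prim u b - Prim u a) * 2^-1 = kap * (Prim (cst 1) b - Prim (cst 1) a).
  move=> a0 ab b1.
  have l1 : (fun n => rip u (bump a b n) * 2^-1) @ \oo --> (Prim u b - Prim u a) * 2^-1.
    by apply: cvgMl; exact: limT.
  have l2 : (fun n => kap * rip (cst 1) (bump a b n)) @ \oo --> kap * (Prim (cst 1) b - Prim (cst 1) a).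
    by apply: cvgMr; exact: limT.
  move: l1; under eq_cvg do rewrite step1//.
  by move=> l1; exact: (cvg_unique _ l1 l2).
exists (2 * kap).
have sw : sqi (u \- cst (2 * kap)) by apply: sqiB => //; exact: sqi_cst.
have PB x : Prim (u \- cst (2 * kap)) x = Prim u x - Prim (cst (2 * kap)) x.
  rewrite /Prim -RintegralB//; try by apply: restrict_integrableS => //; apply: sqi_integrable => //; exact: sqi_cst.
  apply: eq_Rintegral => t _.
  by have [tI|tI] := pselect (I01 t); [rewrite !patch_in|rewrite !patch_out ?subr0].
have := sqi_Prim_const (sqi_integrable sw).
have H a b : 0 < a -> a < b -> b < 1 -> Prim (u \- cst (2 * kap)) a = Prim (u \- cst (2 * kap)) b.
  move=> a0 ab b1; rewrite !PB; have := step2 a b a0 ab b1.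
  have ha : 0 <= a < 1 by rewrite ltW//; apply: lt_trans b1.
  have hb : 0 <= b < 1 by rewrite ltW//; apply: lt_trans ab.
  by rewrite !Prim_cst//; lra.
move=> /(_ H); apply: filterS => x /[apply] /= /eqP; rewrite subr_eq0 => /eqP //.
Qed.

Lemma sqi_weak_prim u v : sqi u -> sqi v ->
  (forall phi, test_fun phi -> rip u (derive1 phi) = - rip v phi) ->
  exists c : R, ae_eq mu I01 u (fun x => c + Prim v x).
Proof.
move=> su sv uv; have sP := Prim_sqi sv.
have [phi tphi|c hc] := @du_Bois_Reymond (u \- Prim v) (sqiB su sP).
  have [sp sp' _ _] := test_funP tphi.
  have -> : rip (u \- Prim v) (derive1 phi) = rip (fun x => (-1) * Prim v x + u x) (derive1 phi).
    by apply: eq_Rintegral => x _ /=; rewrite mulN1r [_ + u x]addrC.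
  rewrite rip_cmbl// uv//; have := sqi_weak_deriv_prim 0 sv tphi.
  have -> : rip (fun x => 0 + Prim v x) (derive1 phi) = rip (Prim v) (derive1 phi).
    by apply: eq_Rintegral => x _ /=; rewrite add0r.
  by move=> ->; lra.
exists c; apply: filterS hc => x h /h /= <-; by rewrite subrK.
Qed.

End du_Bois_Reymond.

(** * Sobolev functions, traces and integration by parts *)

Section sobolev.
Variable R : realType.
Local Notation C := R[i].
Local Notation mu := (@lebesgue_measure R).
Local Notation I01 := (@I01 R).
Local Notation L2 := (L2 R).
Implicit Types (f g h k : L2) (a b c : C) (u v w phi : R -> R) (F G : R -> C).

Hint Extern 0 (measurable _) => solve [exact: measurable_I01] : core.
Hint Resolve L2fun_re_sqi L2fun_im_sqi : core.

(** Near x there is an interval of positive measure inside (0,1), hence a point off the exceptional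
    null set. Clipping the interval to (0,1) covers the end points 0 and 1. *)
Lemma continuous_ae0 u : {within `[0, 1], continuous u} ->
  ae_eq mu I01 u (cst 0) -> forall x, 0 <= x <= 1 -> u x = 0.
Proof.
move=> cu [N [mN N0 hN]] x /andP[x0 x1].
apply/eqP; rewrite -normr_eq0 eq_le normr_ge0 andbT; apply/ler_addgt0Pl => e e0; rewrite addr0.
have xI : `[0, 1]%classic x by rewrite /= in_itv/= x0.
have /cvgrPdist_lt/(_ e e0) := (subspace_continuousP _ _).1 cu x xI.
rewrite /within/= => -[d /= d0 hd].
pose l := Num.max 0 (x - d); pose r := Num.min 1 (x + d).
have lr : l < r.
  by rewrite gt_max !lt_min; apply/andP; split; apply/andP; split => //; lra.
have [y [ly yr] yN] : exists2 y, l < y /\ y < r & ~ N y.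
  apply: contrapT => h.
  have sub : `]l, r[%classic `<=` N.
    move=> y /=; rewrite in_itv/= => /andP[ly yr]; apply: contrapT => yN.
    by apply: h; exists y.
  have : (mu `]l, r[%classic <= mu N)%E by apply: le_measure => //; rewrite inE.
  rewrite [X in (_ <= X)%E]N0 lebesgue_measure_itv/= lte_fin lr -EFinB lee_fin.
  by rewrite subr_le0 leNgt lr.
move: ly yr; rewrite gt_max lt_min => /andP[y0 xy] /andP[y1 yx].
have uy : u y = 0.
  by apply: contrapT => uy; apply: yN; apply: hN => /=; apply: contra_not uy; apply; apply/I01E.
have : `|u x - u y| < e.
  by apply: hd => /=; [rewrite ltr_norml; apply/andP; split; lra|rewrite in_itv/= !ltW].
by rewrite uy subr0 => /ltW.
Qed.

Definition continuous_rep f F : Prop :=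
  [/\ {within `[0, 1], continuous (reC \o F : R -> R)},
      {within `[0, 1], continuous (imC \o F : R -> R)} & ae_eq mu I01 f F].

Lemma within_continuousB u v : {within `[0, 1], continuous u} ->
  {within `[0, 1], continuous v} -> {within `[0, 1], continuous (u \- v)}.
Proof. by move=> cu cv x; exact: (cvgB (cu x) (cv x)). Qed.

Lemma within_continuousD u v : {within `[0, 1], continuous u} ->
  {within `[0, 1], continuous v} -> {within `[0, 1], continuous (u \+ v)}.
Proof. by move=> cu cv x; exact: (cvgD (cu x) (cv x)). Qed.

Lemma within_continuousZ (r : R) u : {within `[0, 1], continuous u} ->
  {within `[0, 1], continuous (fun x => r * u x)}.
Proof. by move=> cu x; exact: (cvgM (cvg_cst r) (cu x)). Qed.

Lemma continuous_rep_unique f F G x : continuous_rep f F -> continuous_rep f G ->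
  0 <= x <= 1 -> F x = G x.
Proof.
move=> [rF iF fF] [rG iG fG] x01.
have FG : ae_eq mu I01 F G by apply: filterS2 fF fG => y h1 h2 Iy; rewrite -h1// h2.
apply: eqC; apply/eqP; rewrite -subr_eq0; apply/eqP.
  apply: (continuous_ae0 (within_continuousB rF rG) _ x01).
  by apply: filterS FG => y h /h /= ->; rewrite subrr.
apply: (continuous_ae0 (within_continuousB iF iG) _ x01).
by apply: filterS FG => y h /h /= ->; rewrite subrr.
Qed.

Lemma trace_rep f F x : continuous_rep f F -> 0 <= x <= 1 -> trace f x = F x.
Proof.
move=> fF x01; rewrite /trace; case: xgetP => [c cE [G [rG iG fG <-]]|].
  by apply: (continuous_rep_unique (f := f)) x01 => //; split.
by move=> /(_ (F x)) []; exists F; case: fF.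
Qed.

Lemma continuous_rep_cmb a f F g G : continuous_rep f F -> continuous_rep g G ->
  continuous_rep (a *: f + g) (fun x => a * F x + G x).
Proof.
move=> [rF iF fF] [rG iG fG]; split.
- have -> : reC \o (fun x => a * F x + G x) =
      (fun x => reC a * reC (F x)) \+ (fun x => - imC a * imC (F x)) \+ (reC \o G).
    by apply/funext => x /=; rewrite !partsE; ring.
  apply: within_continuousD => //.
  by apply: within_continuousD; apply: within_continuousZ.
- have -> : imC \o (fun x => a * F x + G x) =
      (fun x => reC a * imC (F x)) \+ (fun x => imC a * reC (F x)) \+ (imC \o G).
    by apply/funext => x /=; rewrite !partsE; ring.
  apply: within_continuousD => //.
  by apply: within_continuousD; apply: within_continuousZ.
- apply: filterS2 (L2_cmbE a f g) (filterI fF fG) => x h [h1 h2] Ix.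
  by rewrite h// h1// h2.
Qed.

Definition cprim c g (x : R) : C :=
  (reC c + Prim (reC \o g) x) +i* (imC c + Prim (imC \o g) x).

Lemma cprim_sqi c g : sqi (reC \o cprim c g) /\ sqi (imC \o cprim c g).
Proof.
split.
  exact: (sqiD (sqi_cst (reC c)) (Prim_sqi (L2fun_re_sqi g))).
exact: (sqiD (sqi_cst (imC c)) (Prim_sqi (L2fun_im_sqi g))).
Qed.

Lemma cprim_rep f c g : ae_eq mu I01 f (cprim c g) -> continuous_rep f (cprim c g).
Proof.
move=> fE; split => //.
  have cc : {within `[0, 1], continuous (cst (reC c) : R -> R)}.
    by apply: continuous_subspaceT => x; exact: cvg_cst.
  exact: (within_continuousD cc (Prim_continuous (sqi_integrable (L2fun_re_sqi g)))).
have cc : {within `[0, 1], continuous (cst (imC c) : R -> R)}.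
  by apply: continuous_subspaceT => x; exact: cvg_cst.
exact: (within_continuousD cc (Prim_continuous (sqi_integrable (L2fun_im_sqi g)))).
Qed.

Lemma cprim0 c g : cprim c g 0 = c.
Proof. by rewrite /cprim !Prim0 !addr0; case: c. Qed.

(** Writes the pairings of [weak_deriv] as inner products, so that linearity is that of [inner]; no
    conjugate appears since [u] is real. *)
Lemma test_fun_inner u : sqi u -> exists p : L2, forall f,
  cintegral (fun x => f x * (u x)%:C) = inner p f.
Proof.
move=> su; have [p pE] := @L2fun_of R (fun x => (u x)%:C) su (sqi_cst 0).
exists p => f; rewrite innerE /cintegral.
have er : ae_eq mu I01 (reC \o p) u by apply: filterS pE => x h /h /= ->.
have ei : ae_eq mu I01 (imC \o p) (cst 0) by apply: filterS pE => x h /h /= ->.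
have s0 : sqi (cst (0 : R)) by exact: sqi_cst.
have z w : rip (cst 0) w = 0 by apply: Rintegral_eq0 => x _; rewrite mul0r.
have refl w : ae_eq mu I01 w w by exact: aeW.
rewrite !(rip_ae _ su _ _ er (refl _))// !(rip_ae _ s0 _ _ ei (refl _))// !z addr0 subr0.
by congr (_ +i* _); apply: eq_Rintegral => x _; rewrite !partsE /=; ring.
Qed.

Lemma weak_deriv_cmb a f f' g g' : weak_deriv f f' -> weak_deriv g g' ->
  weak_deriv (a *: f + g) (a *: f' + g').
Proof.
move=> wf wg phi tphi; have [sp sp' _ _] := test_funP tphi.
have := wf _ tphi; have := wg _ tphi.
have [p pE] := test_fun_inner sp; have [p' pE'] := test_fun_inner sp'.
rewrite !pE !pE' !inner_cmbr => -> ->; ring.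
Qed.

(** Weak differentiability becomes a statement about primitives; traces, uniqueness and construction
    of functions all rest on it. *)
Lemma weak_derivP f g : weak_deriv f g <-> exists c, ae_eq mu I01 f (cprim c g).
Proof.
split=> [wfg|[c fE] phi tphi].
  have [c1 h1] : exists c : R, ae_eq mu I01 (reC \o f) (fun x => c + Prim (reC \o g) x).
    apply: sqi_weak_prim => // phi tphi.
    have := congr1 (fun z : C => reC z) (wfg _ tphi); rewrite reN /= => E.
    transitivity (\int[mu]_(x in I01) reC (f x * (derive1 phi x)%:C)).
      by apply: eq_Rintegral => x _; rewrite !partsE /=; ring.
    by rewrite E; congr (- _); apply: eq_Rintegral => x _; rewrite !partsE /=; ring.
  have [c2 h2] : exists c : R, ae_eq mu I01 (imC \o f) (fun x => c + Prim (imC \o g) x).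
    apply: sqi_weak_prim => // phi tphi.
    have := congr1 (fun z : C => imC z) (wfg _ tphi); rewrite imN /= => E.
    transitivity (\int[mu]_(x in I01) imC (f x * (derive1 phi x)%:C)).
      by apply: eq_Rintegral => x _; rewrite !partsE /=; ring.
    by rewrite E; congr (- _); apply: eq_Rintegral => x _; rewrite !partsE /=; ring.
  exists (c1 +i* c2); apply: filterS2 h1 h2 => x h1 h2 Ix.
  by apply: eqC; [exact: h1|exact: h2].
have [sp sp' _ _] := test_funP tphi.
have [sr si] := cprim_sqi c g.
have refl w : ae_eq mu I01 w w by exact: aeW.
have er := ae_eq_reC fE; have ei := ae_eq_imC fE.
apply: eqC; rewrite ?reN ?imN.
  transitivity (rip (reC \o f) (derive1 phi)).
    by apply: eq_Rintegral => x _; rewrite !partsE /=; ring.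
  rewrite (rip_ae _ sr sp' sp' er (refl _))// (sqi_weak_deriv_prim _ _ tphi)//.
  by congr (- _); apply: eq_Rintegral => x _; rewrite !partsE /=; ring.
transitivity (rip (imC \o f) (derive1 phi)).
  by apply: eq_Rintegral => x _; rewrite !partsE /=; ring.
rewrite (rip_ae _ si sp' sp' ei (refl _))// (sqi_weak_deriv_prim _ _ tphi)//.
by congr (- _); apply: eq_Rintegral => x _; rewrite !partsE /=; ring.
Qed.

Lemma weak_deriv_rep f g : weak_deriv f g -> continuous_rep f (cprim (trace f 0) g).
Proof.
move=> /weak_derivP[c /cprim_rep fE].
by rewrite (trace_rep fE) ?cprim0// lexx ler01.
Qed.

Lemma weak_deriv_exists c g : exists2 f, weak_deriv f g & trace f 0 = c.
Proof.
have [sr si] := cprim_sqi c g; have [f fE] := L2fun_of sr si.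
exists f; first by apply/weak_derivP; exists c.
by rewrite (trace_rep (cprim_rep fE)) ?cprim0// lexx ler01.
Qed.

Lemma trace_cmb a f f' g g' x : weak_deriv f f' -> weak_deriv g g' -> 0 <= x <= 1 ->
  trace (a *: f + g) x = a * trace f x + trace g x.
Proof.
move=> /weak_deriv_rep wf /weak_deriv_rep wg x01.
by rewrite (trace_rep wf x01) (trace_rep wg x01) (trace_rep (continuous_rep_cmb a wf wg) x01).
Qed.

Lemma L2_zeroE : ae_eq mu I01 (0 : L2) (cst 0 : R -> C).
Proof.
have := @L2_scaleE R 0 0; rewrite scaler0; apply: filterS => x h /h ->.
by rewrite mul0r.
Qed.

Lemma Prim_ae u v x : sqi u -> sqi v -> ae_eq mu I01 u v -> Prim u x = Prim v x.
Proof.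
move=> su sv uv; rewrite /Prim /Rintegral; congr fine.
have iu := restrict_integrableS (measurable_itv `]-oo, x]) (sqi_integrable su).
have iv := restrict_integrableS (measurable_itv `]-oo, x]) (sqi_integrable sv).
have /integrableP[mu' _] := iu; have /integrableP[mv _] := iv.
apply: ae_eq_integral => //.
apply: filterS uv => t h _; have [tI|tI] := pselect (I01 t).
  by rewrite !patch_in// h.
by rewrite !patch_out.
Qed.

Lemma Prim_zero x : Prim (cst 0) x = 0 :> R.
Proof.
apply: Rintegral_eq0 => t _; have [tI|tI] := pselect (I01 t).
  by rewrite patch_in.
by rewrite patch_out.
Qed.

Lemma weak_deriv0_rep f : weak_deriv f 0 -> continuous_rep f (cst (trace f 0)).
Proof.
move=> /weak_deriv_rep; congr continuous_rep; apply/funext => x.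
have z := L2_zeroE; have s0 : sqi (cst (0 : R)) by exact: sqi_cst.
rewrite /cprim (Prim_ae x _ s0 (ae_eq_reC z))// (Prim_ae x _ s0 (ae_eq_imC z))//.
by rewrite !Prim_zero !addr0 /=; case: (trace f 0).
Qed.

Lemma weak_deriv0_trace f x : weak_deriv f 0 -> 0 <= x <= 1 -> trace f x = trace f 0.
Proof. by move=> /weak_deriv0_rep h x01; rewrite (trace_rep h). Qed.

(** Two weak derivatives have primitives with the same continuous representative, and
    [sqi_Prim_const] applies to their difference. *)
Lemma weak_deriv_unique f g h : weak_deriv f g -> weak_deriv f h -> g = h.
Proof.
move=> wg wh; have rg := weak_deriv_rep wg; have rh := weak_deriv_rep wh.
have E x : 0 <= x <= 1 -> cprim (trace f 0) g x = cprim (trace f 0) h x.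
  by move=> x01; exact: continuous_rep_unique rg rh x01.
have key u v : sqi u -> sqi v -> (forall x, 0 <= x <= 1 -> Prim u x = Prim v x) ->
    ae_eq mu I01 u v.
  move=> su sv uv; have s := sqiB su sv.
  have : ae_eq mu I01 (u \- v) (cst 0).
    apply: sqi_Prim_const; first exact: sqi_integrable.
    have PB x : Prim (u \- v) x = Prim u x - Prim v x.
      rewrite /Prim -RintegralB//; try by apply: restrict_integrableS => //; exact: sqi_integrable.
      apply: eq_Rintegral => t _.
      by have [tI|tI] := pselect (I01 t); [rewrite !patch_in|rewrite !patch_out ?subr0].
    move=> a b a0 ab b1; rewrite !PB !uv ?subrr// ?(ltW a0) ?(ltW b1) ?andbT/=.
      by apply/ltW/(lt_trans a0).
    by apply/ltW/(lt_trans ab).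
  by apply: filterS => x hx Ix; apply/eqP; rewrite -subr_eq0; apply/eqP/hx.
have er := key _ _ (L2fun_re_sqi g) (L2fun_re_sqi h).
have ei := key _ _ (L2fun_im_sqi g) (L2fun_im_sqi h).
apply/L2_eqP; apply: filterS2 (er _) (ei _) => [x h1 h2 Ix|x x01|x x01].
- by apply: eqC; [exact: h1|exact: h2].
- by have := congr1 (fun z : C => reC z) (E x x01) => /= /addrI.
- by have := congr1 (fun z : C => imC z) (E x x01) => /= /addrI.
Qed.

Lemma Prim_affine_by_parts u v (a b : R) : sqi u -> sqi v ->
  rip (fun x => a + Prim u x) v + rip u (fun x => b + Prim v x) =
  (a + Prim u 1) * (b + Prim v 1) - a * b.
Proof.
move=> su sv; have := Prim_by_parts su sv.
have E w w' (r : R) : sqi w -> sqi w' ->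
    rip (fun x => r + Prim w x) w' = r * Prim w' 1 + rip (Prim w) w'.
  move=> sw sw'; transitivity (rip (fun x => 1 * Prim w x + cst r x) w').
    by apply: eq_Rintegral => x _; rewrite mul1r addrC.
  rewrite rip_cmbl//; [|exact: Prim_sqi|exact: sqi_cst].
  by rewrite mul1r addrC Prim1 -RintegralZl//; exact: sqi_integrable.
rewrite E// (ripC u (fun x => b + Prim v x)) E// (ripC (Prim v)); lra.
Qed.

(** Assembles four real integrations by parts, one for each choice of parts, into the complex one;
    [p], [q] are end values at 1 and [a], [b] at 0. *)
Lemma sesquilinear_parts (p q a b : C) (s1 s2 s3 s4 t1 t2 t3 t4 : R) :
  s1 + t1 = reC p * reC q - reC a * reC b ->
  s2 + t2 = reC p * imC q - reC a * imC b ->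
  s3 + t3 = imC p * reC q - imC a * reC b ->
  s4 + t4 = imC p * imC q - imC a * imC b ->
  ((s1 + s4) +i* (s2 - s3)) + ((t1 + t4) +i* (t2 - t3)) = p^*%C * q - a^*%C * b.
Proof. by move=> h1 h2 h3 h4; apply: eqC; rewrite !partsE /=; lra. Qed.

Lemma weak_deriv_by_parts f f' g g' : weak_deriv f f' -> weak_deriv g g' ->
  inner f g' + inner f' g =
  (trace f 1)^*%C * trace g 1 - (trace f 0)^*%C * trace g 0.
Proof.
move=> /weak_deriv_rep rf /weak_deriv_rep rg.
have tf : trace f 1 = cprim (trace f 0) f' 1 by rewrite (trace_rep rf)// ler01 lexx.
have tg : trace g 1 = cprim (trace g 0) g' 1 by rewrite (trace_rep rg)// ler01 lexx.
rewrite tf tg; move: (trace f 0) (trace g 0) rf rg => a b [_ _ fE] [_ _ gE].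
have [sar sai] := cprim_sqi a f'; have [sbr sbi] := cprim_sqi b g'.
have refl w : ae_eq mu I01 w w by exact: aeW.
have fr := ae_eq_reC fE; have fi := ae_eq_imC fE.
have gr := ae_eq_reC gE; have gi := ae_eq_imC gE.
rewrite !innerE.
rewrite !(rip_ae _ sar _ _ fr (refl _))// !(rip_ae _ sai _ _ fi (refl _))//.
rewrite !(rip_ae _ _ _ sbr (refl _) gr)// !(rip_ae _ _ _ sbi (refl _) gi)//.
have Prr := Prim_affine_by_parts (reC a) (reC b) (L2fun_re_sqi f') (L2fun_re_sqi g').
have Pri := Prim_affine_by_parts (reC a) (imC b) (L2fun_re_sqi f') (L2fun_im_sqi g').
have Pir := Prim_affine_by_parts (imC a) (reC b) (L2fun_im_sqi f') (L2fun_re_sqi g').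
have Pii := Prim_affine_by_parts (imC a) (imC b) (L2fun_im_sqi f') (L2fun_im_sqi g').
exact: (@sesquilinear_parts (cprim a f' 1) (cprim b g' 1) a b _ _ _ _ _ _ _ _ Prr Pri Pir Pii).
Qed.

End sobolev.

(** * The Laplacian *)

Section span2.
Variable R : realType.
Local Notation C := R[i].
Local Notation L2 := (L2 R).
Implicit Types (f g h u : L2) (a b c p q : C).

Lemma conj0 : (0 : C)^*%C = 0. Proof. by apply: eqC; rewrite /= ?oppr0. Qed.
Lemma conj1 : (1 : C)^*%C = 1. Proof. by apply: eqC; rewrite /= ?oppr0. Qed.

Lemma inner_neq0 f : f != 0 -> inner f f != 0.
Proof. by apply: contra => /eqP/inner_eq0 ->. Qed.

(** One Gram-Schmidt step: [u] is the part of [e2] orthogonal to [e1], which makes the system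
    triangular. *)
Lemma span2_solve e1 e2 p q : e1 != 0 -> (forall a, e2 != a *: e1) ->
  exists a b, inner e1 (a *: e1 + b *: e2) = p /\ inner e2 (a *: e1 + b *: e2) = q.
Proof.
move=> e10 e12.
pose l := inner e1 e2 / inner e1 e1; pose u := e2 - l *: e1.
have n1 := inner_neq0 e10.
have u0 : u != 0 by rewrite subr_eq0 e12.
have nu := inner_neq0 u0.
have e1u : inner e1 u = 0 by rewrite innerBr innerZr divfK// subrr.
have ue1 : inner u e1 = 0 by rewrite inner_conj e1u conj0.
have e2u : inner e2 u = inner u u.
  by rewrite {2}/u innerBl innerZl e1u mulr0 subr0.
pose al := p / inner e1 e1.
pose be := (q - al * inner e2 e1) / inner u u.
exists (al - be * l), be.
have -> : (al - be * l) *: e1 + be *: e2 = al *: e1 + be *: u.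
  by rewrite scalerBl /u scalerBr scalerA -addrA; congr (_ + _); rewrite addrC.
rewrite !innerDr !innerZr e1u mulr0 addr0 divfK// e2u divfK//.
by split => //; rewrite addrC subrK.
Qed.

(** Take the element [s] of the span with the same inner products as [u]; then [u - s] is orthogonal
    to [e1] and [e2], hence to [u] and to itself. *)
Lemma span2_double_orth e1 e2 u : e1 != 0 -> (forall a, e2 != a *: e1) ->
  (forall h, inner e1 h = 0 -> inner e2 h = 0 -> inner u h = 0) ->
  exists a b, u = a *: e1 + b *: e2.
Proof.
move=> e10 e12 hu.
have [a [b [E1 E2]]] := span2_solve (inner e1 u) (inner e2 u) e10 e12.
exists a, b; apply/eqP; rewrite -subr_eq0; apply/eqP/inner_eq0.
set s := a *: e1 + b *: e2 in E1 E2 *.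
have o1 : inner e1 (u - s) = 0 by rewrite innerBr E1 subrr.
have o2 : inner e2 (u - s) = 0 by rewrite innerBr E2 subrr.
by rewrite innerBl hu// /s innerDl !innerZl o1 o2 !mulr0 addr0 subrr.
Qed.

End span2.

Section laplacian.
Variable R : realType.
Local Notation C := R[i].
Local Notation L2 := (L2 R).
Local Notation S := (minLaplacian R).
Implicit Types (f g h : L2) (a b c d : C).

Lemma in01_0 : 0 <= (0 : R) <= 1. Proof. by rewrite lexx ler01. Qed.
Lemma in01_1 : 0 <= (1 : R) <= 1. Proof. by rewrite lexx ler01. Qed.
Hint Resolve in01_0 in01_1 : core.

Lemma wderivE f g : weak_deriv f g -> wderiv f = g.
Proof.
move=> fg; rewrite /wderiv; case: xgetP => [h _ fh|/(_ g)//].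
exact: weak_deriv_unique fh fg.
Qed.

Definition wderiv2 f := wderiv (wderiv f).

Lemma H2_intro f g h : weak_deriv f g -> weak_deriv g h ->
  [/\ H2 f, wderiv f = g & wderiv2 f = h].
Proof.
move=> fg gh; have E := wderivE fg; rewrite /wderiv2 E (wderivE gh); split => //.
by split; [exists g|rewrite E; exists h].
Qed.

Lemma H2P f : H2 f -> weak_deriv f (wderiv f) /\ weak_deriv (wderiv f) (wderiv2 f).
Proof.
move=> [[g fg] [h gh]]; have E := wderivE fg; rewrite E in gh *.
by rewrite /wderiv2 E (wderivE gh).
Qed.

Lemma H2_cmb a f g : H2 f -> H2 g ->
  [/\ H2 (a *: f + g), wderiv (a *: f + g) = a *: wderiv f + wderiv g &
      wderiv2 (a *: f + g) = a *: wderiv2 f + wderiv2 g].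
Proof.
move=> /H2P[f1 f2] /H2P[g1 g2].
by apply: H2_intro; exact: weak_deriv_cmb.
Qed.

Definition b0 f := trace f 0.
Definition b1 f := trace f 1.
Definition d0 f := trace (wderiv f) 0.
Definition d1 f := trace (wderiv f) 1.

Lemma boundary_cmb a f g : H2 f -> H2 g ->
  [/\ b0 (a *: f + g) = a * b0 f + b0 g, b1 (a *: f + g) = a * b1 f + b1 g,
      d0 (a *: f + g) = a * d0 f + d0 g & d1 (a *: f + g) = a * d1 f + d1 g].
Proof.
move=> Hf Hg; have [_ E _] := H2_cmb a Hf Hg.
have [f1 f2] := H2P Hf; have [g1 g2] := H2P Hg.
by rewrite /d0 /d1 E; split; [exact: (trace_cmb a f1 g1 in01_0)|
  exact: (trace_cmb a f1 g1 in01_1)|exact: (trace_cmb a f2 g2 in01_0)|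
  exact: (trace_cmb a f2 g2 in01_1)].
Qed.

Lemma weak_deriv00 : weak_deriv (0 : L2) 0.
Proof.
have [f wf _] := weak_deriv_exists (0 : C) (0 : L2).
by have := weak_deriv_cmb (-1) wf wf; rewrite scaler0 addr0 scaleN1r addNr.
Qed.

Lemma H2_0 : H2 (0 : L2).
Proof. by have [] := H2_intro weak_deriv00 weak_deriv00. Qed.

Lemma wderiv2_0 : wderiv2 (0 : L2) = 0.
Proof. by have [] := H2_intro weak_deriv00 weak_deriv00. Qed.

Lemma boundary0 : [/\ b0 (0 : L2) = 0, b1 (0 : L2) = 0, d0 (0 : L2) = 0 & d1 (0 : L2) = 0].
Proof.
have := boundary_cmb (-1) H2_0 H2_0; rewrite scaler0 addr0.
by move=> [-> -> -> ->]; rewrite !mulN1r !addNr.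
Qed.

Lemma boundaryZ a f : H2 f -> [/\ H2 (a *: f), b0 (a *: f) = a * b0 f,
  b1 (a *: f) = a * b1 f, d0 (a *: f) = a * d0 f & d1 (a *: f) = a * d1 f].
Proof.
move=> Hf; have := boundary_cmb a Hf H2_0; have [H _ _] := H2_cmb a Hf H2_0.
by have [-> -> -> ->] := boundary0; rewrite !addr0 in H * => -[].
Qed.

Lemma boundaryB f g : H2 f -> H2 g -> [/\ H2 (f - g), b0 (f - g) = b0 f - b0 g,
  b1 (f - g) = b1 f - b1 g, d0 (f - g) = d0 f - d0 g & d1 (f - g) = d1 f - d1 g].
Proof.
move=> Hf Hg; have := boundary_cmb (-1) Hg Hf; have [H _ _] := H2_cmb (-1) Hg Hf.
by rewrite scaleN1r addrC in H * => -[]; rewrite !mulN1r ![- _ + _]addrC.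
Qed.

Lemma Green f h : H2 f -> H2 h ->
  inner f (- wderiv2 h) = inner (- wderiv2 f) h
    + ((b0 f)^*%C * d0 h - (b1 f)^*%C * d1 h)
    - ((d0 f)^*%C * b0 h - (d1 f)^*%C * b1 h).
Proof.
move=> /H2P[f1 f2] /H2P[h1 h2].
have E1 := weak_deriv_by_parts f1 h2; have E2 := weak_deriv_by_parts f2 h1.
rewrite innerNr innerNl /b0 /b1 /d0 /d1.
(* [B] is <f', h'>, eliminated between the two integrations by parts. *)
have alg (A B D p q r s : C) :
    A + B = p - q -> B + D = r - s -> - A = - D + (q - p) - (s - r).
  move=> h1' h2'; have -> : A = p - q - B by rewrite -h1' addrK.
  have -> : D = r - s - B by rewrite -h2' addrAC subrr add0r.
  ring.
exact: alg E1 E2.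
Qed.

Lemma domSP h : dom S h <-> [/\ H2 h, b0 h = 0, b1 h = 0, d0 h = 0 & d1 h = 0].
Proof. by split=> [[H []]|[H]]. Qed.

(** [e] is the constant 1 and [x] the coordinate function, known through their weak derivatives and
    traces. *)
Lemma affine_basis : exists e x : L2, [/\ weak_deriv e 0, trace e 0 = 1, trace e 1 = 1,
  weak_deriv x e & trace x 0 = 0] /\ (e != 0 /\ forall a, x != a *: e).
Proof.
have [e we e0] := weak_deriv_exists (1 : C) (0 : L2).
have [x wx x0] := weak_deriv_exists (0 : C) e.
exists e, x; split; first by split => //; rewrite (weak_deriv0_trace we in01_1).
have en : e != 0.
  apply/eqP => ee; move: e0; rewrite ee; have [+ _ _ _] := boundary0; rewrite /b0 => ->.
  by move/eqP; rewrite eq_sym oner_eq0.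
split => // a; apply/eqP => xa.
have wa : weak_deriv (a *: e) 0.
  by have := weak_deriv_cmb a we weak_deriv00; rewrite scaler0 !addr0.
rewrite xa in wx; move: en; rewrite (weak_deriv_unique wx wa).
by rewrite eqxx.
Qed.

(** Seek f'' = psi in span(1, x), which makes f a cubic. Integration by parts turns f'(1) = d and
    f(1) = b into prescribed values of <1, psi> and <x, psi>. *)
Lemma H2_boundary_onto a b c d : exists f, [/\ H2 f, b0 f = a, b1 f = b, d0 f = c & d1 f = d].
Proof.
have [e [x [[we e0 e1 wx x0] [en xe]]]] := affine_basis.
have [r [s [E1 E2]]] := span2_solve (d - c) ((trace x 1)^*%C * d - (b - a)) en xe.
set psi := r *: e + s *: x in E1 E2.
have [g wg g0] := weak_deriv_exists c psi.
have [f wf f0] := weak_deriv_exists a g.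
have g1 : trace g 1 = d.
  have := weak_deriv_by_parts we wg.
  rewrite E1 e0 e1 g0 conj1 !mul1r inner0l addr0 => h.
  by apply: (addIr (- c)); rewrite h.
have f1 : trace f 1 = b.
  have := weak_deriv_by_parts wx wg; rewrite x0 conj0 mul0r subr0 E2 g1 => h.
  have := weak_deriv_by_parts we wf; rewrite e0 e1 f0 conj1 !mul1r inner0l addr0 => h'.
  rewrite h' in h; apply: (addIr (- a)).
  have -> : trace f 1 - a = ((trace x 1)^*%C * d - (b - a) + (trace f 1 - a)) - ((trace x 1)^*%C * d) + (b - a).
    by ring.
  by rewrite h; ring.
have [Hf fg fpsi] := H2_intro wf wg.
by exists f; rewrite /d0 /d1 fg.
Qed.

(** Integrate [psi] twice with zero data at 0; orthogonality to 1 and x says exactly that f' and f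
    vanish at 1. *)
Lemma domS_orth_affine e x psi : weak_deriv e 0 -> trace e 0 = 1 -> trace e 1 = 1 ->
  weak_deriv x e -> trace x 0 = 0 -> inner e psi = 0 -> inner x psi = 0 ->
  exists2 h, dom S h & wderiv2 h = psi.
Proof.
move=> we e0 e1 wx x0 oe ox.
have [g wg g0] := weak_deriv_exists (0 : C) psi.
have [f wf f0] := weak_deriv_exists (0 : C) g.
have g1 : trace g 1 = 0.
  have := weak_deriv_by_parts we wg.
  by rewrite oe inner0l e0 e1 g0 conj1 mul1r mulr0 subr0 addr0 => <-.
have f1 : trace f 1 = 0.
  have := weak_deriv_by_parts wx wg; rewrite ox x0 g1 conj0 mul0r mulr0 subrr add0r => h.
  have := weak_deriv_by_parts we wf.
  by rewrite h inner0l e0 e1 f0 conj1 mul1r mulr0 subr0 addr0 => <-.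
have [Hf fg fpsi] := H2_intro wf wg.
by exists f => //; apply/domSP; rewrite /d0 /d1 fg.
Qed.

(* {h'' : h in dom S} is the orthogonal complement of the affine functions, so a
   distributional solution of f'' = - g is a classical one plus an affine function. *)
Lemma adjoint_H2 f g : (forall h, dom S h -> inner f (- wderiv2 h) = inner g h) ->
  H2 f /\ - wderiv2 f = g.
Proof.
move=> hfg; have [e [x [[we e0 e1 wx x0] [en xe]]]] := affine_basis.
(* [G] is a particular solution of G'' = - g. *)
have [G' wG' _] := weak_deriv_exists (0 : C) (- g).
have [G wG _] := weak_deriv_exists (0 : C) G'.
have [HG GG' Gg] := H2_intro wG wG'.
have [r [s frs]] : exists a b, f - G = a *: e + b *: x.
  apply: span2_double_orth => // psi oe ox.
  have [h Dh hpsi] := domS_orth_affine we e0 e1 wx x0 oe ox.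
  have /domSP[Hh h0 h1 h0' h1'] := Dh.
  have := Green HG Hh; rewrite h0 h1 h0' h1' Gg opprK !mulr0 !subr0 addr0.
  rewrite -hfg// => /eqP; rewrite -subr_eq0 -innerBl innerNr oppr_eq0 hpsi.
  by rewrite -opprB innerNl oppr_eq0 => /eqP.
have [Hx x' x''] := H2_intro wx we.
have [He e' e''] := H2_intro we weak_deriv00.
have -> : f = r *: e + (s *: x + G) by rewrite addrA -frs subrK.
have [HxG _ xG''] := H2_cmb s Hx HG; have [H _ H''] := H2_cmb r He HxG.
by split => //; rewrite H'' xG'' e'' x'' Gg !scaler0 !add0r opprK.
Qed.

(** The orthogonality says that the adjoint of S sends 0 to [f]; by [adjoint_H2] this value is - 0''
    = 0. *)
Lemma domS_orth0 f : (forall h, dom S h -> inner f h = 0) -> f = 0.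
Proof.
move=> h; have [|_ <-] := @adjoint_H2 0 f.
  by move=> g Dg; rewrite h// inner0l.
by rewrite wderiv2_0 oppr0.
Qed.

Lemma domS_subspace : subspace (dom S).
Proof.
split; first by apply/domSP; have [-> -> -> ->] := boundary0; split => //; exact: H2_0.
move=> a f g /domSP[Hf f0 f1 f2 f3] /domSP[Hg g0 g1 g2 g3]; apply/domSP.
have [H _ _] := H2_cmb a Hf Hg; have [-> -> -> ->] := boundary_cmb a Hf Hg.
by rewrite f0 f1 f2 f3 g0 g1 g2 g3 mulr0 addr0.
Qed.

Lemma domS_dense : densely_defined S.
Proof.
move=> f e e0; have [//|g Dg h] := dense_subspace domS_subspace _ f e0; last by exists g.
by move=> g h; apply: domS_orth0.
Qed.

Lemma adjoint_act f : H2 f -> act (adjoint S) f = - wderiv2 f.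
Proof.
move=> Hf.
have ok h : dom S h -> inner f (act S h) = inner (- wderiv2 f) h.
  move=> /domSP[Hh h0 h1 h0' h1']; rewrite (Green Hf Hh).
  by rewrite h0 h1 h0' h1' !mulr0 !subr0 addr0.
rewrite /=; case: xgetP => [g _ hg|/(_ (- wderiv2 f))//].
apply/eqP; rewrite -subr_eq0; apply/eqP/domS_orth0 => h Dh.
by rewrite innerBl -hg// -ok// subrr.
Qed.

End laplacian.

(** * The operators V^(1/2) and V^(-1/2) *)

Section inverse_square_root.
Variable R : realType.
Local Notation C := R[i].
Local Notation L2 := (L2 R).
Variable V : {linear L2 -> L2}.
Hypotheses (bV : bounded_op V) (V0 : nonneg_op V).
Local Notation W := (op_sqrt V).
Local Notation Vih := (op_invsqrt V).
Implicit Types (f g h k : L2) (a : C).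

(** [xget] returns its default when no square root exists, so the existence proof is what gives
    [op_sqrt] its properties. *)
Lemma op_sqrtP : [/\ linear W, bounded_op W, nonneg_op W & forall f, W (W f) = V f].
Proof.
rewrite /op_sqrt; case: xgetP => [W' _ //|h].
by have [W' hW'] := op_sqrt_exists (linearP V) bV V0; have := h W' hW'.
Qed.

Lemma op_sqrt_cmb a f g : W (a *: f + g) = a *: W f + W g.
Proof. by have [linW _ _ _] := op_sqrtP; exact: linW. Qed.

Lemma op_sqrt0 : W 0 = 0.
Proof. by have := op_sqrt_cmb (-1) 0 0; rewrite scaler0 addr0 scaleN1r addNr. Qed.

Lemma op_sqrtK f : W (W f) = V f.
Proof. by have [] := op_sqrtP. Qed.

Lemma op_sqrt_sym f g : inner f (W g) = inner (W f) g.
Proof. by have [linW _ W0 _] := op_sqrtP; exact: nonneg_symmetric. Qed.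

Lemma op_sqrt_n2 f : inner f (V f) = (n2 (W f))%:C.
Proof. by rewrite -op_sqrtK op_sqrt_sym inner_self. Qed.

Lemma ker_op_sqrt f : V f = 0 -> W f = 0.
Proof.
move=> Vf; apply: n2_eq0; have := op_sqrt_n2 f.
by rewrite Vf inner0r => /(congr1 (fun z : C => reC z)).
Qed.

(** The range of W is orthogonal to ker V because W is symmetric and kills ker V; orthogonality
    survives limits. *)
Lemma ker_orth_closure (u : nat -> L2) g : L2_cvg (W \o u) g -> ker_orth V g.
Proof.
move=> ug f /ker_op_sqrt Wf.
have z n : inner f ((W \o u) n) = 0 by rewrite /= op_sqrt_sym Wf inner0l.
apply: eqC.
  have := L2_cvg_re_inner (h := f) ug; under eq_cvg do rewrite z.
  by move=> lim; exact: (cvg_unique _ lim (cvg_cst 0)).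
have := L2_cvg_im_inner (h := f) ug; under eq_cvg do rewrite z.
by move=> lim; exact: (cvg_unique _ lim (cvg_cst 0)).
Qed.

Lemma op_invsqrtE k h : ker_orth V h -> W h = k -> Vih k = h.
Proof.
move=> oh Wh; rewrite /op_invsqrt; case: xgetP => [g _ [og Wg]|/(_ h)[]//].
have WB : W (g - h) = 0.
  by rewrite addrC -scaleN1r op_sqrt_cmb Wh Wg scaleN1r addNr.
have VB : V (g - h) = 0.
  by rewrite -op_sqrtK WB op_sqrt0.
apply/eqP; rewrite -subr_eq0; apply/eqP/inner_eq0.
by rewrite innerBr og// oh// subrr.
Qed.

(** For k = W x, the preimage is the orthogonal projection of [x] on the closure of the range of W,
    supplied by [riesz_image] for f |-> <x, W f>. *)
Lemma op_invsqrtP k : range W k -> ker_orth V (Vih k) /\ W (Vih k) = k.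
Proof.
move=> [x _ <-].
have sT : subspace [set: L2] by split.
have [||||g [gE _ [u _ ug]]] := @riesz_image R setT W (fun f => inner x (W f)) (n2 x) sT.
- by move=> a f g _ _; exact: op_sqrt_cmb.
- by move=> a f g _ _; rewrite op_sqrt_cmb inner_cmbr.
- exact: n2_ge0.
- by move=> f _; exact: inner_CS.
have Wg : W g = W x.
  apply/eqP; rewrite -subr_eq0; apply/eqP/inner_eq0.
  set d := W g - W x; rewrite {1}/d innerBl -!op_sqrt_sym gE// subrr //.
by rewrite (op_invsqrtE (ker_orth_closure ug) Wg); split => //; exact: ker_orth_closure ug.
Qed.

Lemma range_op_sqrt_cmb a k k' : range W k -> range W k' -> range W (a *: k + k').
Proof.
by move=> [x _ <-] [y _ <-]; exists (a *: x + y) => //; rewrite op_sqrt_cmb.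
Qed.

Lemma op_invsqrt_cmb a k k' : range W k -> range W k' ->
  Vih (a *: k + k') = a *: Vih k + Vih k'.
Proof.
move=> /op_invsqrtP[p1 E1] /op_invsqrtP[p2 E2]; apply: op_invsqrtE.
  by move=> f Vf; rewrite inner_cmbr p1// p2// mulr0 addr0.
by rewrite op_sqrt_cmb E1 E2.
Qed.

End inverse_square_root.

(** * Dissipative extensions *)

Section boundary_form.
Variable R : realType.
Local Notation C := R[i].
Implicit Types (x y z l p q : C).

Definition bform_val x0 x1 y0 y1 : R := imC (x0^*%C * y0 - x1^*%C * y1).

(** The form vanishes at (u0, u1, 0, 0), so no term in |l|^2 appears. The factor i/2 gives the
    linear term the shape used by [sesquilinear_CS]. *)
Lemma bform_val_neumann l x0 x1 u0 u1 y0 y1 :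
  bform_val (l * u0 + x0) (l * u1 + x1) y0 y1 = bform_val x0 x1 y0 y1
    + 2 * reC (l * ('i%C / 2 * (u0^*%C * y0 - u1^*%C * y1)^*%C)).
Proof.
have -> : 'i%C / 2 = (0 +i* 2^-1 : C) by apply: eqC; rewrite !partsE /=; field.
by rewrite /bform_val !partsE /=; field.
Qed.

(** A zero space is orthogonal to (1, 0) and the line through (p, q) to (conj q, - conj p); two
    independent vectors reach everything by Cramer's rule. *)
Lemma C2_subspace (N : C -> C -> Prop) : N 0 0 ->
  (forall l p q p' q', N p q -> N p' q' -> N (l * p + p') (l * q + q')) ->
  (forall p q, N p q) \/
  exists p q, (p != 0 \/ q != 0) /\
    forall p' q', N p' q' -> p^*%C * p' + q^*%C * q' = 0.
Proof.
move=> N0 Nl; have [all0|] := pselect (forall p q, N p q -> p = 0 /\ q = 0).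
  right; exists 1, 0; split; first by left; exact: oner_neq0.
  by move=> p' q' /all0[-> ->]; rewrite !mulr0 addr0.
move=> /existsNP[p] /existsNP[q] /not_implyP[Npq pq].
have [orth|] := pselect (forall p' q', N p' q' -> q * p' - p * q' = 0).
  right; exists (q^*%C), (- p^*%C); split; last first.
    by move=> p' q' /orth; rewrite conjN !conjK mulNr.
  have [q0|q0] := eqVneq q 0; last first.
    by left; apply: contra q0 => /eqP h; rewrite -(conjK q) h conj0.
  right; apply/negP => /eqP h; apply: pq; split => //.
  by rewrite -(conjK p) -[p^*%C]opprK h oppr0 conj0.
move=> /existsNP[p'] /existsNP[q'] /not_implyP[Npq' /eqP dt].
left=> a b; have Z l x y : N x y -> N (l * x) (l * y).
  by move=> h; have := Nl l _ _ _ _ h N0; rewrite !addr0.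
set d := q * p' - p * q' in dt.
have := Nl ((q * a - p * b) / d) _ _ _ _ Npq' (Z ((p' * b - q' * a) / d) _ _ Npq).
have E1 : (q * a - p * b) / d * p' + (p' * b - q' * a) / d * p = a.
  rewrite mulrAC [X in _ + X]mulrAC -mulrDl -[RHS](mulfK dt); congr (_ / _).
  by rewrite /d; ring.
have E2 : (q * a - p * b) / d * q' + (p' * b - q' * a) / d * q = b.
  rewrite mulrAC [X in _ + X]mulrAC -mulrDl -[RHS](mulfK dt); congr (_ / _).
  by rewrite /d; ring.
by rewrite E1 E2.
Qed.

End boundary_form.

Section operators.
Variable R : realType.
Local Notation C := R[i].
Local Notation L2 := (L2 R).
Local Notation S := (minLaplacian R).
Variable V : {linear L2 -> L2}.
Hypotheses (bV : bounded_op V) (V0 : nonneg_op V).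
Local Notation W := (op_sqrt V).
Local Notation Vih := (op_invsqrt V).
Local Notation A := (minLaplacian_iV V).
Local Notation Smax := (Smax_iV V).
Implicit Types (f g h k u : L2) (a l p q : C) (T : operator R).

Definition bform f : R := bform_val (b0 f) (b1 f) (d0 f) (d1 f).

Lemma Smax_iVE f : H2 f -> Smax f = - wderiv2 f + 'i%C *: V f.
Proof. by move=> Hf; rewrite /Smax_iV adjoint_act. Qed.

Lemma minLaplacian_iVE h : dom S h -> act A h = Smax h.
Proof. by move=> /domSP[Hh _ _ _ _]; rewrite Smax_iVE. Qed.

Lemma Smax_iV_cmb a f g : H2 f -> H2 g -> Smax (a *: f + g) = a *: Smax f + Smax g.
Proof.
move=> Hf Hg; have [H _ E] := H2_cmb a Hf Hg.
rewrite !Smax_iVE// E (linearP V) opprD !scalerDr -scalerN addrACA; congr (_ + (_ + _)).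
by rewrite !scalerA mulrC.
Qed.

Lemma im_inner_laplacian f : H2 f -> imC (inner f (- wderiv2 f)) = bform f.
Proof.
move=> Hf; have := Green Hf Hf; rewrite (inner_conj f (- wderiv2 f)).
rewrite /bform /bform_val; move: (inner f _) (b0 f) (b1 f) (d0 f) (d1 f) => z x0 x1 y0 y1.
by move/(congr1 (fun w : C => imC w)); rewrite !partsE; lra.
Qed.

Lemma im_inner_Smax f : H2 f -> imC (inner f (Smax f)) = bform f + n2 (W f).
Proof.
move=> Hf; rewrite Smax_iVE// innerDr innerZr op_sqrt_n2// imD im_inner_laplacian//.
by rewrite !partsE /= mul0r mul1r add0r.
Qed.

Lemma bform0 f : H2 f -> d0 f = 0 -> d1 f = 0 -> bform f = 0.
Proof. by move=> Hf h0 h1; rewrite /bform /bform_val h0 h1 !mulr0 subrr. Qed.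

Definition Smax_defect T f := act T f - Smax f.
Local Notation defect := Smax_defect.

(** Expand |W f - (i/2) h|^2 >= 0; this is where 1/4 comes from. *)
Lemma dissipative_bound T f h : H2 f -> ker_orth V h -> W h = defect T f ->
  4^-1 * n2 h <= bform f -> 0 <= imC (inner f (act T f)).
Proof.
move=> Hf oh Wh hb.
have -> : act T f = Smax f + W h by rewrite Wh /Smax_defect addrC subrK.
rewrite innerDr imD im_inner_Smax// op_sqrt_sym//.
have := n2_ge0 (W f + (- 'i%C / 2) *: h); rewrite n2_cmb.
have -> : - 'i%C / 2 = (0 +i* - 2^-1 : C) by apply: eqC; rewrite !partsE /=; field.
rewrite /sqn !partsE /= expr0n add0r sqrrN.
have -> : (2^-1 : R) ^+ 2 = 4^-1 by field.
move: (imC _) (n2 (W f)) (reC _) => x y z; lra.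
Qed.

Lemma dissipative_intro T : linear_operator T -> dom S `<=` dom T ->
  (forall f, dom T f -> [/\ H2 f, range W (defect T f) &
      4^-1 * n2 (Vih (defect T f)) <= bform f]) -> dissipative T.
Proof.
move=> linT ST hT; split => //.
  move=> f e e0; have [g Sg fg] := domS_dense f e0; exists g => //; exact: ST.
move=> f /hT[Hf rf hf]; have [oh Wh] := op_invsqrtP bV V0 rf.
exact: dissipative_bound Hf oh Wh hf.
Qed.

Lemma inner_V_sym f g : inner f (V g) = inner (V f) g.
Proof. exact: (nonneg_symmetric (linearP V)). Qed.

(* Cauchy-Schwarz for the form Im<f, T f> on span(f, v), v in dom S, bounds
   v |-> <f, A v> - <T f, v> by |V^{1/2} v|; by riesz_image it is <g, V^{1/2} v>. *)
Lemma dissipative_struct T f : dissipative T -> extension T A -> dom T f ->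
  [/\ H2 f, range W (defect T f) & 4^-1 * n2 (Vih (defect T f)) <= bform f].
Proof.
move=> [[T0 linT] _ dissT] [ST TA] Tf.
set a := imC (inner f (act T f)).
have a0 : 0 <= a by exact: dissT.
(* The factor - i/2 makes 2 Re (c * l v) equal to the cross terms of Im <c v + f, T (c v + f)>. *)
pose l v : C := - ('i%C / 2) * (inner f (act A v) - inner (act T f) v).
have i2 : 'i%C / 2 = (0 +i* 2^-1 : C) by apply: eqC; rewrite !partsE /=; field.
have AE v : dom S v -> act A v = Smax v by exact: minLaplacian_iVE.
have linA : linear_on (dom S) (act A).
  move=> c g h Sg Sh; have [_ sS] := domS_subspace R.
  have /domSP[Hg _ _ _ _] := Sg; have /domSP[Hh _ _ _ _] := Sh.
  by rewrite (AE _ (sS c g h Sg Sh)) (AE _ Sg) (AE _ Sh) Smax_iV_cmb.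
have bound v : dom S v -> sqn (l v) <= a * n2 (W v).
  move=> Sv; apply: sesquilinear_CS => c.
  have Tv : dom T v by exact: ST.
  have [Tcv E] := linT c _ _ Tv Tf.
  have := dissT _ Tcv; rewrite E TA// !innerDl !innerDr !innerZl !innerZr.
  have /domSP[Hv v0 v1 w0 w1] := Sv.
  (* Boundary values vanish on dom S, so Im <v, A v> is just |W v|^2. *)
  have -> : inner v (act A v) = reC (inner v (act A v)) +i* n2 (W v).
    apply: eqC => //; rewrite AE// im_inner_Smax// bform0//= add0r //.
  rewrite (inner_conj (act T f) v) /l i2 /sqn !partsE/= -/a.
  by move=> h; apply: le_trans h _; rewrite le_eqVlt; apply/orP; left; apply/eqP; field.
have [||g [gE gn [un _ ug]]] := @riesz_image R (dom S) W l a (domS_subspace R) _ _ a0 bound.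
- by move=> c g h _ _; exact: op_sqrt_cmb.
- move=> c g h Sg Sh; rewrite /l linA// !inner_cmbr.
  rewrite -[_ *: (_ : C^o)]/(c * _); ring.
have og : ker_orth V g := ker_orth_closure bV V0 ug.
(* Solving [l h = <g, W h>] for <f, - h''> puts [f] in the domain of the adjoint of S. *)
have adj h : dom S h -> inner f (- wderiv2 h) =
    inner (act T f - (2 * 'i%C) *: W g + 'i%C *: V f) h.
  move=> Sh; have := gE h Sh; rewrite /l AE//; have /domSP[Hh _ _ _ _] := Sh.
  rewrite Smax_iVE// innerDr innerZr inner_V_sym op_sqrt_sym//.
  rewrite innerDl innerBl !innerZl i2.
  move: (inner f _) (inner (V f) h) (inner (act T f) h) (inner (W g) h) => x y z w E.
  have E1 := congr1 (fun w : C => reC w) E; have E2 := congr1 (fun w : C => imC w) E.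
  by move: E1 E2; rewrite !partsE/= => E1 E2; apply: eqC; rewrite !partsE/=; lra.
have [Hf fE] := adjoint_H2 adj.
have oW : ker_orth V (W f).
  by apply: (@ker_orth_closure R V bV V0 (fun=> f)); exact: L2_cvg_cst.
have dE : defect T f = W ((2 * 'i%C) *: (g - W f)).
  have -> : (2 * 'i%C) *: (g - W f) = (2 * 'i%C) *: (-1 *: W f + g) + 0.
    by rewrite addr0 scaleN1r addrC.
  rewrite !op_sqrt_cmb// op_sqrt0// addr0 op_sqrtK//.
  rewrite /Smax_defect Smax_iVE// fE scaleN1r scalerDr scalerN.
  have -> : (2 * 'i%C) *: V f = 'i%C *: V f + 'i%C *: V f.
    by rewrite -scalerDl; congr (_ *: _); ring.
  by rewrite !opprD opprK !addrA subrr add0r -addrA addrC.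
have oh : ker_orth V ((2 * 'i%C) *: (g - W f)).
  by move=> h Vh; rewrite innerZr innerBr og// oW// subrr mulr0.
have VE : Vih (defect T f) = (2 * 'i%C) *: (g - W f) by exact: op_invsqrtE.
split => //; first by exists ((2 * 'i%C) *: (g - W f)).
rewrite VE n2Z n2B.
(* With this value of [a], the bound |g|^2 <= a reads |g - W f|^2 <= bform f, and the defect is W
   applied to 2 i (g - W f). *)
have aE : a = bform f + n2 (W f) - 2 * n2 (W f) + 2 * reC (inner g (W f)).
  have -> : a = imC (inner f (Smax f + defect T f)) by rewrite /Smax_defect addrC subrK.
  rewrite innerDr imD im_inner_Smax// dE op_sqrt_sym// innerZr innerBr inner_self.
  by rewrite (inner_conj g (W f)) !partsE/=; ring.
have -> : sqn (2 * 'i%C : C) = 4 by rewrite /sqn !partsE/=; ring.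
move: gn; rewrite aE; move: (n2 _) (n2 _) (reC _) => x y z; lra.
Qed.

End operators.

Local Opaque b0 b1 d0 d1.

(** * Consequences of dissipativity and maximality *)

Section maximality.
Variable R : realType.
Local Notation C := R[i].
Local Notation L2 := (L2 R).
Local Notation S := (minLaplacian R).
Variable V : {linear L2 -> L2}.
Hypotheses (bV : bounded_op V) (V0 : nonneg_op V).
Local Notation Vih := (op_invsqrt V).
Local Notation A := (minLaplacian_iV V).
Local Notation Smax := (Smax_iV V).
Local Notation defect := (Smax_defect V).
Implicit Types (f g h k u e : L2) (a l p q : C) (T : operator R).

(** The cross term between (p, q, i p, - i q) and the old data is governed by the pairing in the
    hypothesis; what remains is |l|^2 (|p|^2 + |q|^2). *)
Lemma bform_val_orth_add l p q x0 x1 y0 y1 :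
  p^*%C * (x0 - 'i%C * y0) + q^*%C * (x1 + 'i%C * y1) = 0 ->
  bform_val x0 x1 y0 y1 <=
  bform_val (l * p + x0) (l * q + x1) (l * ('i%C * p) + y0) (l * (- 'i%C * q) + y1).
Proof.
move=> h.
have E : bform_val (l * p + x0) (l * q + x1) (l * ('i%C * p) + y0) (l * (- 'i%C * q) + y1) =
  bform_val x0 x1 y0 y1 + sqn l * (sqn p + sqn q) +
  reC (l^*%C * (p^*%C * (x0 - 'i%C * y0) + q^*%C * (x1 + 'i%C * y1))).
  rewrite /bform_val /sqn !partsE/=; clear h.
  by case: l p q x0 x1 y0 y1 => [? ?] [? ?] [? ?] [? ?] [? ?] [? ?] [? ?] /=; ring.
by rewrite E h mulr0 re0 addr0 lerDl mulr_ge0 ?sqn_ge0// addr_ge0 ?sqn_ge0.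
Qed.

Lemma defect_cmb T a f g : linear_operator T -> dom T f -> dom T g -> H2 f -> H2 g ->
  defect T (a *: f + g) = a *: defect T f + defect T g.
Proof.
move=> [_ linT] Tf Tg Hf Hg; rewrite /Smax_defect Smax_iV_cmb//.
have [_ ->] := linT a f g Tf Tg.
by rewrite scalerBr opprD addrACA.
Qed.

Lemma defect_domS T h : extension T A -> dom S h -> defect T h = 0.
Proof.
move=> [_ TA] Sh; rewrite /Smax_defect TA// minLaplacian_iVE//.
by rewrite subrr.
Qed.

(** The boundary form is nonnegative on dom T and vanishes at [e]; Cauchy-Schwarz then forces the
    cross term to vanish. *)
Lemma neumann_orth T e f : dissipative T -> extension T A -> dom T e -> dom T f ->
  d0 e = 0 -> d1 e = 0 -> (b0 e)^*%C * d0 f - (b1 e)^*%C * d1 f = 0.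
Proof.
move=> dT TA Te Tf e0 e1.
have [He _ _] := dissipative_struct bV V0 dT TA Te.
have [Hf _ hf] := dissipative_struct bV V0 dT TA Tf.
have [[_ linT] _ _] := dT.
set z := _ - _.
have : sqn ('i%C / 2 * z^*%C) <= bform f * 0.
  apply: sesquilinear_CS => l; rewrite mulr0 addr0.
  have [Tlf _] := linT l e f Te Tf.
  have [_ _ hlf] := dissipative_struct bV V0 dT TA Tlf.
  have : 0 <= bform (l *: e + f) by apply: le_trans hlf; rewrite mulr_ge0// n2_ge0.
  rewrite /bform; have [-> -> -> ->] := boundary_cmb l He Hf.
  by rewrite e0 e1 !mulr0 !add0r bform_val_neumann.
rewrite mulr0 sqnM sqn_conj => h.
have i2 : 'i%C / 2 = (0 +i* 2^-1 : C) by apply: eqC; rewrite !partsE /=; field.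
apply: sqn_eq0; apply/eqP; rewrite eq_le sqn_ge0 andbT.
move: h; rewrite {1}/sqn i2 /=; lra.
Qed.

Lemma neumann_defect T e : dissipative T -> extension T A -> dom T e ->
  d0 e = 0 -> d1 e = 0 -> defect T e = 0.
Proof.
move=> dT TA Te e0 e1; have [He re] := dissipative_struct bV V0 dT TA Te.
rewrite bform0// => h; have [_ <-] := op_invsqrtP bV V0 re.
have -> : Vih (defect T e) = 0.
  by apply: n2_eq0; apply/eqP; rewrite eq_le n2_ge0 andbT; lra.
exact: op_sqrt0.
Qed.

Lemma dom_same_boundary T f g : linear_operator T -> dom S `<=` dom T ->
  H2 f -> dom T g -> H2 g -> b0 f = b0 g -> b1 f = b1 g -> d0 f = d0 g -> d1 f = d1 g ->
  dom T f.
Proof.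
move=> [_ linT] ST Hf Tg Hg E1 E2 E3 E4.
have [H h0 h1 h2 h3] := boundaryB Hf Hg.
rewrite E1 subrr in h0; rewrite E2 subrr in h1; rewrite E3 subrr in h2; rewrite E4 subrr in h3.
have : dom S (f - g) by apply/domSP; exact: And5 H h0 h1 h2 h3.
by move=> /ST Tfg; have [] := linT 1 _ _ Tfg Tg; rewrite scale1r subrK.
Qed.

Lemma maximal_intro T : dissipative T ->
  (forall T', dissipative T' -> extension T' T -> dom T' `<=` dom T) ->
  maximally_dissipative T.
Proof.
move=> dT h; split => // T' dT' TT'; split => //.
have [_ E] := TT'; split; first exact: h.
by move=> f Tf; rewrite E//; apply: (h _ dT').
Qed.

Lemma extension_trans T T' T'' : extension T T' -> extension T' T'' -> extension T T''.
Proof.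
move=> [h1 e1] [h2 e2]; split; first by move=> f /h2/h1.
by move=> f Tf; rewrite e1 ?e2//; exact: h2.
Qed.

Lemma op_eq_dissipative T T' : op_eq T T' -> dissipative T' -> dissipative T.
Proof.
move=> [[TT' E] [T'T E']] [[T0 linT] den dis]; split.
- split; first exact: TT'.
  move=> a f g /T'T Tf /T'T Tg; have [h1 h2] := linT a f g Tf Tg.
  by split; [exact: TT'|rewrite !E].
- by move=> f e e0; have [g Tg] := den f e e0; exists g => //; exact: TT'.
- by move=> f /T'T Tf; rewrite E//; exact: dis.
Qed.

Lemma op_eq_maximal T T' : op_eq T T' -> maximally_dissipative T' -> extension T' A ->
  maximally_dissipative T /\ extension T A.
Proof.
move=> TT' [dT' mT'] T'A; have [h1 h2] := TT'.
split; last exact: extension_trans T'A.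
split; first exact: op_eq_dissipative dT'.
move=> T'' dT'' T''T; have [h3 h4] := mT' _ dT'' (extension_trans T''T h1).
by split => //; exact: extension_trans h4.
Qed.

(* Otherwise some (p, q) <> 0 is orthogonal to the range, and T extends to an element
   with boundary values (p, q, i p, - i q), on which the form is |p|^2 + |q|^2. *)
Lemma maximal_onto T p0 q0 : maximally_dissipative T -> extension T A ->
  exists2 f, dom T f & b0 f - 'i%C * d0 f = p0 /\ b1 f + 'i%C * d1 f = q0.
Proof.
move=> [dT mT] TA; have [linT _ _] := dT; have [T0 linT'] := linT.
have [ST TAE] := TA.
have HT f : dom T f -> H2 f by move=> Tf; have [] := dissipative_struct bV V0 dT TA Tf.
pose N p q := exists2 f, dom T f & b0 f - 'i%C * d0 f = p /\ b1 f + 'i%C * d1 f = q.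
have [||all|[p [q [pq orth]]]] := @C2_subspace R N.
- exists 0 => //; have [-> -> -> ->] := boundary0 R.
  by rewrite mulr0 subrr addr0.
- move=> l p1 q1 p2 q2 [f Tf [<- <-]] [g Tg [<- <-]]; exists (l *: f + g).
    by have [] := linT' l f g Tf Tg.
  have [-> -> -> ->] := boundary_cmb l (HT _ Tf) (HT _ Tg).
  by move: (b0 _) (b1 _) (d0 _) (d1 _) (b0 _) (b1 _) (d0 _) (d1 _) => *; split; ring.
- exact: all.
exfalso; pose nrm := 2 * (p^*%C * p + q^*%C * q).
have nrm0 : nrm != 0.
  have E (z : C) : z^*%C * z = (sqn z)%:C.
    by apply: eqC; rewrite /sqn !partsE/=; ring.
  rewrite /nrm mulf_neq0 ?pnatr_eq0//; apply/eqP; rewrite !E => /(congr1 (fun z : C => reC z)); rewrite !partsE/= => /eqP.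
  rewrite paddr_eq0 ?sqn_ge0// => /andP[/eqP/sqn_eq0 zp /eqP/sqn_eq0 zq].
  by case: pq; rewrite ?zp ?zq eqxx.
have [e [He eb0 eb1 ed0 ed1]] := H2_boundary_onto p q ('i%C * p) (- 'i%C * q).
have ii : 'i%C * 'i%C = -1 :> C by apply: eqC; rewrite !partsE/=; ring.
have Pe0 : b0 e - 'i%C * d0 e = 2 * p by rewrite eb0 ed0 mulrA ii; ring.
have Pe1 : b1 e + 'i%C * d1 e = 2 * q by rewrite eb1 ed1 mulrA mulrN ii; ring.
(* The coordinate along [e]: it vanishes on dom T, and the factor 2 in [nrm] makes it 1 at [e]. *)
pose lam u := (p^*%C * (b0 u - 'i%C * d0 u) + q^*%C * (b1 u + 'i%C * d1 u)) / nrm.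
have lam_cmb a u w : H2 u -> H2 w -> lam (a *: u + w) = a * lam u + lam w.
  move=> Hu Hw; rewrite /lam; have [-> -> -> ->] := boundary_cmb a Hu Hw.
  move: (b0 _) (b1 _) (d0 _) (d1 _) (b0 _) (b1 _) (d0 _) (d1 _) => *.
  by rewrite mulrA -mulrDl; congr (_ / _); ring.
have lam_e : lam e = 1 by rewrite /lam Pe0 Pe1 mulrCA [X in _ + X]mulrCA -mulrDr divff.
have lam_T u : dom T u -> lam u = 0.
  by move=> Tu; rewrite /lam (orth _ _ (ex_intro2 _ _ u Tu (conj erefl erefl))) mul0r.
move: lam lam_cmb lam_e lam_T => lam lam_cmb lam_e lam_T.
pose D := [set u | H2 u /\ dom T (u - lam u *: e)].
(* On the sum of dom T and the line of [e], [e] is sent to [Smax e], so its defect is zero and only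
   the boundary form changes. *)
pose T' := Operator D (fun u => act T (u - lam u *: e) + lam u *: Smax e).
have cmbE a u w : H2 u -> H2 w ->
    a *: u + w - lam (a *: u + w) *: e = a *: (u - lam u *: e) + (w - lam w *: e).
  move=> Hu Hw; rewrite lam_cmb// scalerDl scalerBr scalerA opprD addrACA.
  by rewrite -!addrA; congr (_ + _); rewrite addrCA.
have T'T : extension T' T.
  split => u Tu; last by rewrite /= lam_T// !scale0r subr0 addr0.
  by split; [exact: HT|rewrite lam_T// scale0r subr0].
have linT'' : linear_operator T'.
  split; first by have [h _] := T'T; exact: h.
  move=> a u w [Hu Tu] [Hw Tw]; have [H _ _] := H2_cmb a Hu Hw.
  have [h1 h2] := linT' a _ _ Tu Tw.
  rewrite -cmbE in h1 h2 => //; split; first exact: conj H h1.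
  rewrite -[act T' _]/(act T _ + _) h2 lam_cmb// scalerDl -scalerA.
  by rewrite addrACA -scalerDr.
have dT' : dissipative T'.
  apply: (dissipative_intro bV V0 linT'') => [h Sh|u [Hu Tu]].
    by have [h1 _] := T'T; apply/h1/ST.
  set w := u - lam u *: e in Tu *.
  have uw : u = lam u *: e + w by rewrite /w addrCA subrr addr0.
  have Hw := HT _ Tu.
  have dE : defect T' u = defect T w.
    rewrite /Smax_defect /= -/w [in Smax u]uw Smax_iV_cmb//.
    by rewrite opprD addrA addrK.
  have [_ rw hw] := dissipative_struct bV V0 dT TA Tu.
  suff uw' : bform w <= bform u by rewrite dE; exact: And3 Hu rw (le_trans hw uw').
  rewrite [in leRHS]uw /bform; have [-> -> -> ->] := boundary_cmb (lam u) He Hw.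
  rewrite eb0 eb1 ed0 ed1; apply: bform_val_orth_add.
  exact: orth (ex_intro2 _ _ w Tu (conj erefl erefl)).
have [_ [TT' _]] := mT _ dT' T'T.
have Te : dom T e.
  by apply: TT'; split => //; rewrite lam_e scale1r subrr.
(* Once [e] is in dom T, (p, q) is orthogonal to 2 (p, q), a contradiction. *)
have := orth _ _ (ex_intro2 _ _ e Te (conj erefl erefl)).
by rewrite Pe0 Pe1 mulrCA [X in _ + X]mulrCA -mulrDr => h; move: nrm0; rewrite /nrm h eqxx.
Qed.

End maximality.

(** * Boundary conditions *)

Section boundary_spaces.
Variable R : realType.
Local Notation C := R[i].
Implicit Types (B N : C -> C -> C -> C -> Prop) (a b u v p q l x y c : C).

(* Boundary data are listed as f(0), f(1), f'(0), f'(1). *)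
Definition boundary_space N := N 0 0 0 0 /\
  forall l x0 x1 y0 y1 x0' x1' y0' y1', N x0 x1 y0 y1 -> N x0' x1' y0' y1' ->
    N (l * x0 + x0') (l * x1 + x1') (l * y0 + y0') (l * y1 + y1').

Definition neumann_isotropic N := forall u v x0 x1 y0 y1,
  N u v 0 0 -> N x0 x1 y0 y1 -> u^*%C * y0 - v^*%C * y1 = 0.

Definition transversal N := forall p q, exists x0 x1 y0 y1,
  [/\ N x0 x1 y0 y1, x0 - 'i%C * y0 = p & x1 + 'i%C * y1 = q].

Definition sub_bc B N := forall x0 x1 y0 y1, B x0 x1 y0 y1 -> N x0 x1 y0 y1.
Definition eq_bc B N := sub_bc B N /\ sub_bc N B.

Definition bc_i c11 c12 c21 c22 x0 x1 y0 y1 : Prop :=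
  x0 = c11 * y0 - c12 * y1 /\ x1 = c21 * y0 - c22 * y1.
Definition bc_ii c12 c22 x0 x1 y0 y1 : Prop :=
  x1 - c22^*%C * x0 = c22^*%C * c12 * y1 /\ y0 - c22 * y1 = 0.
Definition bc_iii c11 x0 (x1 : C) y0 y1 : Prop := x0 = c11 * y0 /\ y1 = 0.
Definition bc_iv c12 (x0 : C) x1 y0 y1 : Prop := x1 = - c12 * y1 /\ y0 = 0.
Definition bc_v (x0 x1 : C) y0 y1 : Prop := y0 = 0 /\ y1 = 0.

Definition bc_case (c : ext_case) N : Prop :=
  match c with
  | case_i => exists c11 c12 c21 c22, eq_bc N (bc_i c11 c12 c21 c22)
  | case_ii => exists c12 c22, c22 != 0 /\ eq_bc N (bc_ii c12 c22)
  | case_iii => exists c11, eq_bc N (bc_iii c11)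
  | case_iv => exists c12, eq_bc N (bc_iv c12)
  | case_v => eq_bc N bc_v
  end.

Lemma conj_eq0 u : u^*%C = 0 -> u = 0.
Proof. by move=> h; rewrite -(conjK u) h conj0. Qed.

Section linear.
Variables (N : C -> C -> C -> C -> Prop).
Hypotheses (Nl : boundary_space N) (Ni : neumann_isotropic N).

Lemma bs_scale l x0 x1 y0 y1 : N x0 x1 y0 y1 -> N (l * x0) (l * x1) (l * y0) (l * y1).
Proof.
by move=> Nx; have := Nl.2 l _ _ _ _ _ _ _ _ Nx Nl.1; rewrite !addr0.
Qed.

Lemma bs_sub x0 x1 y0 y1 l x0' x1' y0' y1' : N x0 x1 y0 y1 -> N x0' x1' y0' y1' ->
  y0 = l * y0' -> y1 = l * y1' -> N (x0 - l * x0') (x1 - l * x1') 0 0.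
Proof.
move=> Nx Nx' E0 E1; have := Nl.2 (- l) _ _ _ _ _ _ _ _ Nx' Nx.
by rewrite E0 E1 !mulNr !addNr ![- _ + _]addrC.
Qed.

End linear.

(** Subtracting the member of [bc_i] with the same derivatives leaves Neumann data; isotropy against
    members with derivatives (1, 0) and (0, 1) makes them zero. *)
Lemma bc_i_maximal c11 c12 c21 c22 N : boundary_space N -> neumann_isotropic N ->
  sub_bc (bc_i c11 c12 c21 c22) N -> sub_bc N (bc_i c11 c12 c21 c22).
Proof.
move=> Nl Ni BN x0 x1 y0 y1 Nx.
have Ny : N (c11 * y0 - c12 * y1) (c21 * y0 - c22 * y1) y0 y1 by exact: BN.
have Nd := bs_sub Nl Nx Ny (esym (mul1r _)) (esym (mul1r _)).
have N1 : N c11 c21 1 0 by apply: BN; split; rewrite mulr1 mulr0 subr0.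
have N2 : N (- c12) (- c22) 0 1 by apply: BN; split; rewrite mulr1 mulr0 sub0r.
have := Ni _ _ _ _ _ _ Nd N1; have := Ni _ _ _ _ _ _ Nd N2.
rewrite !mulr0 !mulr1 !subr0 !sub0r => /eqP; rewrite oppr_eq0 => /eqP/conj_eq0 h1 /conj_eq0 h0.
by move: h0 h1; rewrite !mul1r => /eqP; rewrite subr_eq0 => /eqP -> /eqP; rewrite subr_eq0 => /eqP ->.
Qed.

(** The Neumann vector (1, conj c22, 0, 0) forces y0 = c22 y1. Subtracting y1 times the member with
    derivatives (c22, 1) leaves Neumann data, and isotropy against that member is the other
    condition. *)
Lemma bc_ii_maximal c12 c22 N : boundary_space N -> neumann_isotropic N ->
  sub_bc (bc_ii c12 c22) N -> sub_bc N (bc_ii c12 c22).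
Proof.
move=> Nl Ni BN x0 x1 y0 y1 Nx.
have Ne : N 1 (c22^*%C) 0 0 by apply: BN; split; rewrite ?mulr1 ?mulr0 subrr.
have := Ni _ _ _ _ _ _ Ne Nx; rewrite conj1 mul1r conjK => hy; split => //.
have Nw : N 0 (c22^*%C * c12) c22 1 by apply: BN; split; rewrite ?mulr0 ?mulr1 ?subr0 ?subrr.
have yE : y0 = y1 * c22 by apply/eqP; rewrite -subr_eq0 mulrC hy.
have Nd := bs_sub Nl Nx Nw yE (esym (mulr1 _)).
have /eqP := Ni _ _ _ _ _ _ Nd Nw; rewrite mulr0 subr0 mulr1 subr_eq0 => /eqP.
move/(congr1 (fun z : C => z^*%C)); rewrite conjM !conjK => h.
by rewrite [c22^*%C * x0]mulrC h [y1 * _]mulrC; ring.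
Qed.

(** As for [bc_ii], with Neumann vector (0, 1, 0, 0) and a member with derivatives (1, 0). *)
Lemma bc_iii_maximal c11 N : boundary_space N -> neumann_isotropic N ->
  sub_bc (bc_iii c11) N -> sub_bc N (bc_iii c11).
Proof.
move=> Nl Ni BN x0 x1 y0 y1 Nx.
have Ne : N 0 1 0 0 by apply: BN; split; rewrite ?mulr0.
have /eqP := Ni _ _ _ _ _ _ Ne Nx.
rewrite conj0 conj1 mul0r mul1r sub0r oppr_eq0 => /eqP hy; split => //.
have Nw : N c11 0 1 0 by apply: BN; split; rewrite ?mulr1.
have Nd := bs_sub Nl Nx Nw (esym (mulr1 _)) (etrans hy (esym (mulr0 _))).
have := Ni _ _ _ _ _ _ Nd Nw; rewrite !mulr0 subr0 mulr1 => /conj_eq0/eqP.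
by rewrite subr_eq0 mulrC => /eqP.
Qed.

Lemma bc_iv_maximal c12 N : boundary_space N -> neumann_isotropic N ->
  sub_bc (bc_iv c12) N -> sub_bc N (bc_iv c12).
Proof.
move=> Nl Ni BN x0 x1 y0 y1 Nx.
have Ne : N 1 0 0 0 by apply: BN; split; rewrite ?mulr0.
have := Ni _ _ _ _ _ _ Ne Nx.
rewrite conj0 conj1 mul0r mul1r subr0 => hy; split => //.
have Nw : N 0 (- c12) 0 1 by apply: BN; split; rewrite ?mulr1.
have Nd := bs_sub Nl Nx Nw (etrans hy (esym (mulr0 _))) (esym (mulr1 _)).
have /eqP := Ni _ _ _ _ _ _ Nd Nw; rewrite !mulr0 sub0r mulr1 oppr_eq0 => /eqP/conj_eq0/eqP.
by rewrite subr_eq0 mulrC => /eqP.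
Qed.

Lemma bc_v_maximal N : neumann_isotropic N -> sub_bc bc_v N -> sub_bc N bc_v.
Proof.
move=> Ni BN x0 x1 y0 y1 Nx.
have N0 : N 1 0 0 0 by exact: BN.
have N1 : N 0 1 0 0 by exact: BN.
have := Ni _ _ _ _ _ _ N0 Nx; have /eqP := Ni _ _ _ _ _ _ N1 Nx.
rewrite conj0 conj1 !mul0r !mul1r subr0 sub0r oppr_eq0 => /eqP h1 h0.
by split.
Qed.

(** Split by the Neumann vectors (u, v, 0, 0) in [N]. If all are zero, case i holds. Otherwise
    isotropy confines the derivatives to a line: if they all vanish it is case v, else u = 0 gives
    iii, v = 0 gives iv, and the rest is ii. *)
Lemma transversal_case N : boundary_space N -> neumann_isotropic N -> transversal N ->
  exists c : ext_case, bc_case c N.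
Proof.
move=> Nl Ni Nt.
have [inj|] := pselect (forall u v, N u v 0 0 -> u = 0 /\ v = 0).
  exists case_i.
  have [a0 [a1 [r0 [r1 [Na A0 A1]]]]] := Nt 1 0.
  have [b0 [b1 [s0 [s1 [Nb B0 B1]]]]] := Nt 0 1.
  have cmb l m : N (l * a0 + m * b0) (l * a1 + m * b1) (l * r0 + m * s0) (l * r1 + m * s1).
    exact: (Nl.2 l _ _ _ _ _ _ _ _ Na (bs_scale Nl m Nb)).
  have inj' l m : l * r0 + m * s0 = 0 -> l * r1 + m * s1 = 0 -> l = 0 /\ m = 0.
    move=> E0 E1; have := cmb l m; rewrite E0 E1 => /inj[F0 F1]; split.
      transitivity (l * (a0 - 'i%C * r0) + m * (b0 - 'i%C * s0)); first by rewrite A0 B0; ring.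
      transitivity (l * a0 + m * b0 - 'i%C * (l * r0 + m * s0)); first by ring.
      by rewrite F0 E0; ring.
    transitivity (l * (a1 + 'i%C * r1) + m * (b1 + 'i%C * s1)); first by rewrite A1 B1; ring.
    transitivity (l * a1 + m * b1 + 'i%C * (l * r1 + m * s1)); first by ring.
    by rewrite F1 E1; ring.
  (* Determinant of the derivative parts of the two members; a zero would give a nontrivial
     combination that is Neumann data, against [inj]. *)
  pose D := r0 * s1 - s0 * r1.
  have D0 : D != 0.
    apply/eqP => D0.
    have [s10 r10] : s1 = 0 /\ - r1 = 0 by apply: inj'; [rewrite -D0 /D; ring|ring].
    have [s00 r00] : s0 = 0 /\ - r0 = 0 by apply: inj'; [ring|rewrite -[RHS]oppr0 -D0 /D; ring].
    have [/eqP + _] : (1 : C) = 0 /\ (1 : C) = 0.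
      apply: inj'; first by rewrite s00 -[r0]opprK r00; ring.
      by rewrite s10 -[r1]opprK r10; ring.
    by rewrite oner_eq0.
  (* Cramer's rule for derivatives (1, 0) and (0, -1); the minus sign is that of - f'(1) in case
     i. *)
  have N1 := cmb (s1 / D) (- r1 / D); have N2 := cmb (s0 / D) (- r0 / D).
  have E1 : s1 / D * r0 + - r1 / D * s0 = 1 by rewrite -[RHS](divff D0) /D; ring.
  have E2 : s1 / D * r1 + - r1 / D * s1 = 0 by ring.
  have E3 : s0 / D * r0 + - r0 / D * s0 = 0 by ring.
  have E4 : s0 / D * r1 + - r0 / D * s1 = - 1 by apply: oppr_inj; rewrite opprK -[RHS](divff D0) /D; ring.
  rewrite E1 E2 in N1; rewrite E3 E4 in N2.
  move: (_ + _) (_ + _) N1 => c21 c11 N1; move: (_ + _) (_ + _) N2 => c22 c12 N2.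
  have mem y0 y1 : N (c11 * y0 - c12 * y1) (c21 * y0 - c22 * y1) y0 y1.
    have := Nl.2 y0 _ _ _ _ _ _ _ _ N1 (bs_scale Nl (- y1) N2).
    have -> : y0 * c11 + - y1 * c12 = c11 * y0 - c12 * y1 by ring.
    have -> : y0 * c21 + - y1 * c22 = c21 * y0 - c22 * y1 by ring.
    have -> : y0 * 1 + - y1 * 0 = y0 by ring.
    by have -> : y0 * 0 + - y1 * - 1 = y1 by ring.
  exists c11, c12, c21, c22; split => x0 x1 y0 y1; last by move=> [-> ->]; exact: mem.
  move=> Nx; have := bs_sub Nl Nx (mem y0 y1) (esym (mul1r _)) (esym (mul1r _)).
  by rewrite !mul1r => /inj[/eqP + /eqP]; rewrite !subr_eq0 => /eqP -> /eqP ->.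
move=> /existsNP[u] /existsNP[v] /not_implyP[Ne uv0].
have Ny x0 x1 y0 y1 : N x0 x1 y0 y1 -> u^*%C * y0 - v^*%C * y1 = 0 by exact: Ni.
have [ally|] := pselect (forall x0 x1 y0 y1, N x0 x1 y0 y1 -> y0 = 0 /\ y1 = 0).
  exists case_v; split => x0 x1 y0 y1; first exact: ally.
  (* With zero derivatives, transversality says that (x0, x1) is arbitrary. *)
  move=> [-> ->]; have [x0' [x1' [y0' [y1' [Nx <- <-]]]]] := Nt x0 x1.
  by have [E0 E1] := ally _ _ _ _ Nx; rewrite E0 E1 mulr0 subr0 addr0 in Nx *.
move=> /existsNP[w0] /existsNP[w1] /existsNP[z0] /existsNP[z1] /not_implyP[Nw z01].
have [u0|un] := eqVneq u 0.
  have vn : v != 0 by apply/eqP => v0; exact: uv0 (conj u0 v0).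
  have y10 x0 x1 y0 y1 : N x0 x1 y0 y1 -> y1 = 0.
    move=> /Ny/eqP; rewrite u0 conj0 mul0r sub0r oppr_eq0 mulf_eq0 => /orP[/eqP/conj_eq0 v0|/eqP//].
    by case/eqP: vn.
  have z1E := y10 _ _ _ _ Nw; have z0n : z0 != 0 by apply/eqP => z0E; exact: z01 (conj z0E z1E).
  have {Nw} := bs_scale Nl z0^-1 Nw; rewrite z1E mulr0 mulVf//.
  move: (_ * w0) (_ * w1) => a b Nw.
  exists case_iii, a; split => x0 x1 y0 y1.
    move=> Nx; have E1 := y10 _ _ _ _ Nx; split => //.
    have Nd := bs_sub Nl Nx Nw (esym (mulr1 _)) (etrans E1 (esym (mulr0 _))).
    have := Ni _ _ _ _ _ _ Nd Nw; rewrite !mulr0 subr0 mulr1 => /conj_eq0/eqP.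
    by rewrite subr_eq0 mulrC => /eqP.
  move=> [-> ->]; have := Nl.2 ((x1 - b * y0) / v) _ _ _ _ _ _ _ _ Ne (bs_scale Nl y0 Nw).
  by rewrite u0 !mulr0 !mulr1 !add0r [a * _]mulrC divfK// [b * _]mulrC subrK.
have [v0|vn] := eqVneq v 0.
  have y00 x0 x1 y0 y1 : N x0 x1 y0 y1 -> y0 = 0.
    move=> /Ny/eqP; rewrite v0 conj0 mul0r subr0 mulf_eq0 => /orP[/eqP/conj_eq0 u0|/eqP//].
    by case/eqP: un.
  have z0E := y00 _ _ _ _ Nw; have z1n : z1 != 0 by apply/eqP => z1E; exact: z01 (conj z0E z1E).
  have {Nw} := bs_scale Nl z1^-1 Nw; rewrite z0E mulr0 mulVf//.
  move: (_ * w0) (_ * w1) => a b Nw.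
  exists case_iv, (- b); split => x0 x1 y0 y1.
    move=> Nx; have E0 := y00 _ _ _ _ Nx; split => //.
    have Nd := bs_sub Nl Nx Nw (etrans E0 (esym (mulr0 _))) (esym (mulr1 _)).
    have /eqP := Ni _ _ _ _ _ _ Nd Nw; rewrite !mulr0 sub0r mulr1 oppr_eq0 => /eqP/conj_eq0/eqP.
    by rewrite subr_eq0 mulrC opprK => /eqP.
  move=> [-> ->]; have := Nl.2 ((x0 - a * y1) / u) _ _ _ _ _ _ _ _ Ne (bs_scale Nl y1 Nw).
  by rewrite v0 opprK !mulr0 !mulr1 !add0r [b * _]mulrC divfK// [a * _]mulrC subrK.
(* Isotropy reads conj u * y0 = conj v * y1, that is y0 = c22 y1. *)
pose c22 := v^*%C / u^*%C.
have un' : u^*%C != 0 by apply/eqP => /conj_eq0/eqP; rewrite (negbTE un).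
have vn' : v^*%C != 0 by apply/eqP => /conj_eq0/eqP; rewrite (negbTE vn).
have c0 : c22 != 0 by rewrite mulf_neq0// invr_eq0.
have c0' : c22^*%C != 0 by apply/eqP => /conj_eq0/eqP; rewrite (negbTE c0).
have cE : c22^*%C * u = v.
  by rewrite -[X in _ * X]conjK -conjM divfK ?conjK.
have yE x0 x1 y0 y1 : N x0 x1 y0 y1 -> y0 = y1 * c22.
  move=> /Ny/eqP; rewrite subr_eq0 => /eqP h; apply: (mulfI un').
  by rewrite h /c22 mulrCA [u^*%C * _]mulrC divfK// mulrC.
have z1n : z1 != 0.
  by apply/eqP => z1E; apply: z01; split => //; rewrite (yE _ _ _ _ Nw) z1E mul0r.
have z0E := yE _ _ _ _ Nw; have {Nw} := bs_scale Nl z1^-1 Nw.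
rewrite z0E mulrA mulVf// mul1r.
move: (_ * w0) (_ * w1) => a b Nw.
(* [c12] is the solution of the first condition of [bc_ii] at the normalised member (a, b, c22,
   1). *)
exists case_ii, ((b - c22^*%C * a) / c22^*%C), c22; split => //.
have cc : c22^*%C * ((b - c22^*%C * a) / c22^*%C) = b - c22^*%C * a.
  by rewrite mulrC divfK.
split => x0 x1 y0 y1.
  move=> Nx; have E0 := yE _ _ _ _ Nx; split; last by rewrite E0 mulrC subrr.
  have Nd := bs_sub Nl Nx Nw E0 (esym (mulr1 _)).
  have /eqP := Ni _ _ _ _ _ _ Nd Nw; rewrite mulr1 subr_eq0 => /eqP.
  move/(congr1 (fun z : C => z^*%C)); rewrite conjM !conjK cc => h.
  have -> : x1 = x1 - y1 * b + y1 * b by rewrite subrK.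
  by rewrite -h; ring.
rewrite /bc_ii cc => -[E1 /eqP]; rewrite subr_eq0 => /eqP ->.
have := Nl.2 ((x0 - a * y1) / u) _ _ _ _ _ _ _ _ Ne (bs_scale Nl y1 Nw).
rewrite !mulr0 !add0r mulr1 divfK// -cE mulrA [_ / u * _]mulrC -mulrA divfK//.
have -> : x0 - a * y1 + y1 * a = x0 by ring.
have -> : c22^*%C * (x0 - a * y1) + y1 * b = x1.
  by rewrite -(subrK (c22^*%C * x0) x1) E1; ring.
by rewrite mulrC.
Qed.

(** Invariants of the set of attained derivatives: all of C^2 in case i, the line through (c22, 1)
    in ii, the first axis in iii, the second in iv, zero in v. *)
Definition dirichlet_signature N : (Prop * Prop * Prop) :=
  ((exists x0 x1, N x0 x1 1 0), (exists x0 x1, N x0 x1 0 1),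
   (exists x0 x1 y0 y1, N x0 x1 y0 y1 /\ y1 != 0)).

Lemma bc_case_signature (c : ext_case) N : bc_case c N ->
  let: (s1, s2, s3) := dirichlet_signature N in
  match c with
  | case_i => s1 /\ s2 | case_ii => ~ s1 /\ ~ s2 /\ s3 | case_iii => s1 /\ ~ s2
  | case_iv => ~ s1 /\ s2 | case_v => ~ s1 /\ ~ s2 /\ ~ s3
  end.
Proof.
case: c => /=.
- move=> [c11 [c12 [c21 [c22 [_ BN]]]]]; split.
    by exists c11, c21; apply: BN; split; rewrite mulr1 mulr0 subr0.
  by exists (- c12), (- c22); apply: BN; split; rewrite mulr1 mulr0 sub0r.
- move=> [c12 [c22 [c0 [NB BN]]]]; split; [|split].
  + by move=> [x0 [x1 /NB[_ /eqP]]]; rewrite mulr0 subr0 oner_eq0.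
  + by move=> [x0 [x1 /NB[_ /eqP]]]; rewrite mulr1 sub0r oppr_eq0 (negbTE c0).
  + exists 0, (c22^*%C * c12), c22, 1; split; last exact: oner_neq0.
    by apply: BN; split; rewrite ?mulr0 ?mulr1 ?subr0 ?subrr.
- move=> [c11 [NB BN]]; split.
    by exists c11, 0; apply: BN; split; rewrite ?mulr1.
  by move=> [x0 [x1 /NB[_ /eqP]]]; rewrite oner_eq0.
- move=> [c12 [NB BN]]; split; last first.
    by exists 0, (- c12); apply: BN; split; rewrite ?mulr1.
  by move=> [x0 [x1 /NB[_ /eqP]]]; rewrite oner_eq0.
- move=> [NB BN]; split; [|split].
  + by move=> [x0 [x1 /NB[/eqP]]]; rewrite oner_eq0.
  + by move=> [x0 [x1 /NB[_ /eqP]]]; rewrite oner_eq0.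
  + by move=> [x0 [x1 [y0 [y1 [/NB[_ ->]]]]]]; rewrite eqxx.
Qed.

Lemma bc_case_unique (c c' : ext_case) N : bc_case c N -> bc_case c' N -> c = c'.
Proof.
move=> /bc_case_signature + /bc_case_signature; rewrite /dirichlet_signature.
by case: c c' => -[]; tauto.
Qed.

End boundary_spaces.

(** * Operators given by boundary conditions *)

Section boundary_value_operators.
Variable R : realType.
Local Notation C := R[i].
Local Notation L2 := (L2 R).
Local Notation S := (minLaplacian R).
Variable V : {linear L2 -> L2}.
Hypotheses (bV : bounded_op V) (V0 : nonneg_op V).
Local Notation W := (op_sqrt V).
Local Notation Vih := (op_invsqrt V).
Local Notation A := (minLaplacian_iV V).
Local Notation Smax := (Smax_iV V).
Local Notation defect := (Smax_defect V).
Implicit Types (f g h k u e : L2) (a l p q : C) (T : operator R)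
  (B N : C -> C -> C -> C -> Prop).

Definition boundary_values T x0 x1 y0 y1 : Prop := exists2 f, dom T f &
  [/\ H2 f, b0 f = x0, b1 f = x1, d0 f = y0 & d1 f = y1].

(** Common shape of the five families, with the sign of case i; cases ii and iv therefore take [- k]
    as second vector. *)
Definition bv_op B k1 k2 : operator R :=
  Operator [set f | H2 f /\ B (b0 f) (b1 f) (d0 f) (d1 f)]
           (fun f => Smax f + (d0 f *: k1 - d1 f *: k2)).

Lemma op_eq_sym T T' : op_eq T T' -> op_eq T' T.
Proof. by case. Qed.

Lemma op_eq_trans T T' T'' : op_eq T T' -> op_eq T' T'' -> op_eq T T''.
Proof.
move=> [h1 h2] [h3 h4]; split.
  exact: extension_trans h1 h3.
exact: extension_trans h4 h2.
Qed.

Lemma boundary_values_space T : linear_operator T -> boundary_space (boundary_values T).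
Proof.
move=> [T0 linT]; split.
  by exists 0 => //; have [h0 h1 h2 h3] := boundary0 R; exact: And5 (H2_0 R) h0 h1 h2 h3.
move=> l x0 x1 y0 y1 x0' x1' y0' y1'.
move=> [f Tf [Hf <- <- <- <-]] [g Tg [Hg <- <- <- <-]].
have [Tfg _] := linT l f g Tf Tg; have [H _ _] := H2_cmb l Hf Hg.
exists (l *: f + g) => //; have [h0 h1 h2 h3] := boundary_cmb l Hf Hg.
exact: And5 H h0 h1 h2 h3.
Qed.

Lemma boundary_values_isotropic T : dissipative T -> extension T A ->
  neumann_isotropic (boundary_values T).
Proof.
move=> dT TA u v x0 x1 y0 y1 [e Te [_ <- <- e0 e1]] [f Tf [_ _ _ <- <-]].
exact: (neumann_orth bV V0 dT TA).
Qed.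

Lemma boundary_values_transversal T : maximally_dissipative T -> extension T A ->
  transversal (boundary_values T).
Proof.
move=> mT TA p q; have [f Tf [E0 E1]] := maximal_onto bV V0 p q mT TA.
have [Hf _ _] := dissipative_struct bV V0 mT.1 TA Tf.
exists (b0 f), (b1 f), (d0 f), (d1 f); split => //.
by exists f.
Qed.

Lemma bv_opE B k1 k2 f : defect (bv_op B k1 k2) f = d0 f *: k1 - d1 f *: k2.
Proof. by rewrite /Smax_defect /= addrAC subrr add0r. Qed.

Lemma bv_op_values B k1 k2 T : op_eq T (bv_op B k1 k2) -> eq_bc (boundary_values T) B.
Proof.
move=> [[h1 _] [h2 _]]; split => x0 x1 y0 y1.
  by move=> [f /h2[_ +] [_ <- <- <- <-]].
have [f [Hf <- <- <- <-]] := H2_boundary_onto x0 x1 y0 y1.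
by move=> Bf; exists f; first exact: h1.
Qed.

Lemma invsqrt_pair y0 y1 k1 k2 : range W k1 -> range W k2 ->
  range W (y0 *: k1 - y1 *: k2) /\
  Vih (y0 *: k1 - y1 *: k2) = y0 *: Vih k1 - y1 *: Vih k2.
Proof.
move=> r1 r2.
have r0 : range W 0 by exists 0; rewrite ?op_sqrt0.
have r : range W (- y1 *: k2) by rewrite -[X in range W X]addr0; exact: range_op_sqrt_cmb.
rewrite -scaleNr; split; first exact: range_op_sqrt_cmb.
rewrite (op_invsqrt_cmb bV V0 y0 r1 r).
have V00 : Vih 0 = 0.
  by apply: (op_invsqrtE bV V0); [move=> h _; exact: inner0r|exact: op_sqrt0].
have := op_invsqrt_cmb bV V0 (- y1) r2 r0.
by rewrite V00 !addr0 => ->; rewrite scaleNr.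
Qed.

Definition form_cond B k1 k2 := forall x0 x1 y0 y1, B x0 x1 y0 y1 ->
  4^-1 * n2 (y0 *: Vih k1 - y1 *: Vih k2) <= bform_val x0 x1 y0 y1.

Lemma bv_op_dissipative B k1 k2 : range W k1 -> range W k2 -> boundary_space B ->
  form_cond B k1 k2 -> dissipative (bv_op B k1 k2) /\ extension (bv_op B k1 k2) A.
Proof.
move=> r1 r2 [B0 Bl] fc.
have SB h : dom S h -> dom (bv_op B k1 k2) h.
  by move=> /domSP[Hh h0 h1 h2 h3]; split => //; rewrite h0 h1 h2 h3.
have alg l y0 y1 y0' y1' s t : l *: s + t + ((l * y0 + y0') *: k1 - (l * y1 + y1') *: k2)
    = l *: (s + (y0 *: k1 - y1 *: k2)) + (t + (y0' *: k1 - y1' *: k2)).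
  rewrite !scalerDl !scalerDr -!scalerA scalerN opprD.
  by rewrite [RHS]addrACA; congr (_ + _); exact: addrACA.
have linB : linear_operator (bv_op B k1 k2).
  split; first by apply: SB; have [] := domS_subspace R.
  move=> a f g [Hf Bf] [Hg Bg]; have [H _ _] := H2_cmb a Hf Hg.
  have [h0 h1 h2 h3] := boundary_cmb a Hf Hg.
  have Bfg := Bl a _ _ _ _ _ _ _ _ Bf Bg; rewrite -h0 -h1 -h2 -h3 in Bfg.
  split; first exact: conj H Bfg.
  rewrite /= Smax_iV_cmb// h2 h3; exact: alg.
split; last first.
  split; first exact: SB.
  move=> h Sh; have /domSP[Hh h0 h1 h2 h3] := Sh.
  by rewrite minLaplacian_iVE// /= h2 h3 !scale0r subrr addr0.
apply: (dissipative_intro bV V0 linB SB) => f [Hf Bf].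
rewrite bv_opE; have [rf ->] := invsqrt_pair (d0 f) (d1 f) r1 r2.
exact: And3 Hf rf (fc _ _ _ _ Bf).
Qed.

(** The boundary values of a dissipative extension form an isotropic space containing [B], hence
    contained in [B], so the domain cannot grow. *)
Lemma bv_op_maximal B k1 k2 T : range W k1 -> range W k2 -> boundary_space B ->
  form_cond B k1 k2 ->
  (forall N, boundary_space N -> neumann_isotropic N -> sub_bc B N -> sub_bc N B) ->
  op_eq T (bv_op B k1 k2) -> maximally_dissipative T /\ extension T A.
Proof.
move=> r1 r2 Bl fc Bm TB; have [dB BA] := bv_op_dissipative r1 r2 Bl fc.
apply: (op_eq_maximal TB _ BA); apply: (maximal_intro dB) => T' dT' T'B f T'f.
have T'A := extension_trans T'B BA.
have [Hf _ _] := dissipative_struct bV V0 dT' T'A T'f.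
split => //; apply: (Bm (boundary_values T')).
- by apply: boundary_values_space; have [] := dT'.
- exact: boundary_values_isotropic.
- move=> x0 x1 y0 y1; have [g [Hg <- <- <- <-]] := H2_boundary_onto x0 x1 y0 y1.
  by move=> Bg; have [h _] := T'B; exists g => //; exact: h.
- by exists f.
Qed.

Lemma bv_op_intro T B k1 k2 : dissipative T -> extension T A ->
  eq_bc (boundary_values T) B ->
  (forall f, dom T f -> defect T f = d0 f *: k1 - d1 f *: k2) ->
  op_eq T (bv_op B k1 k2).
Proof.
move=> dT TA [TB BT] hT; have [linT _ _] := dT.
have TE f : dom T f -> act T f = Smax f + (d0 f *: k1 - d1 f *: k2).
  by move=> Tf; rewrite -hT// /Smax_defect addrC subrK.
have HT f : dom T f -> H2 f by move=> Tf; have [] := dissipative_struct bV V0 dT TA Tf.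
have sub : dom (bv_op B k1 k2) `<=` dom T.
  move=> f [Hf /BT[g Tg [Hg E0 E1 E2 E3]]].
  exact: (dom_same_boundary linT TA.1 Hf Tg Hg (esym E0) (esym E1) (esym E2) (esym E3)).
split; split => //.
- by move=> f [Hf Bf]; rewrite TE//; exact: sub.
- by move=> f Tf; have Hf := HT f Tf; split => //; apply: TB; exists f.
- by move=> f Tf; rewrite TE.
Qed.

Lemma form_condP T B k1 k2 : dissipative T -> extension T A ->
  range W k1 -> range W k2 -> op_eq T (bv_op B k1 k2) -> form_cond B k1 k2.
Proof.
move=> dT TA r1 r2 [[BT E] _] x0 x1 y0 y1.
have [f [Hf <- <- <- <-]] := H2_boundary_onto x0 x1 y0 y1 => Bf.
have Tf : dom T f by exact: BT.
have [_ _] := dissipative_struct bV V0 dT TA Tf.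
have -> : defect T f = defect (bv_op B k1 k2) f by rewrite /Smax_defect E.
by rewrite bv_opE; have [_ ->] := invsqrt_pair (d0 f) (d1 f) r1 r2.
Qed.

(** f - a g - b h has vanishing derivatives at both ends, so [neumann_defect] gives it zero
    defect. *)
Lemma defect_neumann_cmb T f g h a b : dissipative T -> extension T A ->
  dom T f -> dom T g -> dom T h ->
  d0 f = a * d0 g + b * d0 h -> d1 f = a * d1 g + b * d1 h ->
  defect T f = a *: defect T g + b *: defect T h.
Proof.
move=> dT TA Tf Tg Th E0 E1; have [[T0 linT] _ _] := dT.
have HT u : dom T u -> H2 u by move=> Tu; have [] := dissipative_struct bV V0 dT TA Tu.
have [Hf Hg Hh] := And3 (HT _ Tf) (HT _ Tg) (HT _ Th).
have [Tbh _] := linT b h 0 Th T0.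
have [Hbh _ Db0 Db1] : [/\ H2 (b *: h + 0), True, d0 (b *: h + 0) = b * d0 h
    & d1 (b *: h + 0) = b * d1 h].
  by rewrite addr0; have [] := boundaryZ b Hh.
have [Tgh _] := linT a g _ Tg Tbh; have [Hgh _ _] := H2_cmb a Hg Hbh.
have [_ _ D0 D1] := boundary_cmb a Hg Hbh.
have [Te _] := linT (-1) _ _ Tgh Tf.
have [_ _ e0 e1] := boundary_cmb (-1) Hgh Hf.
rewrite D0 Db0 E0 mulN1r addNr in e0; rewrite D1 Db1 E1 mulN1r addNr in e1.
have := neumann_defect bV V0 dT TA Te e0 e1.
have [linT' _ _] := dT.
have dz : defect T 0 = 0 by exact: (defect_domS TA (domS_subspace R).1).
rewrite (defect_cmb V _ linT' Tgh Tf Hgh Hf) (defect_cmb V _ linT' Tg Tbh Hg Hbh).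
rewrite (defect_cmb V _ linT' Th T0 Hh (H2_0 R)) dz addr0 scaleN1r => /eqP.
by rewrite addrC subr_eq0 => /eqP.
Qed.

End boundary_value_operators.

(** * The matrix inequality as a family of scalar ones *)

Section matrices.
Variable R : realType.
Local Notation C := R[i].
Local Notation L2 := (L2 R).
Implicit Types (h : L2) (a b c d x y : C).

Lemma cv2_eqP a b c11 c12 c21 c22 x y :
  cv2 a b = mx2 c11 c12 c21 c22 *m cv2 x y <->
  a = c11 * x + c12 * y /\ b = c21 * x + c22 * y.
Proof.
have E : mx2 c11 c12 c21 c22 *m cv2 x y = cv2 (c11 * x + c12 * y) (c21 * x + c22 * y).
  apply/matrixP => i j; rewrite !mxE big_ord_recl big_ord1 !mxE/=.
  by case: ifP.
rewrite E; split => [/matrixP h|[-> ->]//].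
by have := h 0 0; have := h 1 0; rewrite !mxE.
Qed.

Lemma cv2E (v : 'cV[C]_2) : v = cv2 (v 0 0) (v 1 0).
Proof.
apply/matrixP => i j; rewrite !mxE ord1.
by case: i => [[|[|//]] i]; congr (v _ _); apply: val_inj.
Qed.

Lemma mx2_form a b c d x y :
  (adjmx (cv2 x y) *m mx2 a b c d *m cv2 x y) 0 0 =
  x^*%C * (a * x + b * y) + y^*%C * (c * x + d * y).
Proof.
rewrite !mxE big_ord_recl big_ord1 !mxE !big_ord_recl !big_ord0 !mxE/=.
ring.
Qed.

Lemma Im_mx2 a b c d : Im_mx (adjmx (mx2 a b c d)) =
  mx2 ((2 * 'i%C)^-1 * (a^*%C - a)) ((2 * 'i%C)^-1 * (c^*%C - b))
      ((2 * 'i%C)^-1 * (b^*%C - c)) ((2 * 'i%C)^-1 * (d^*%C - d)).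
Proof.
apply/matrixP => i j; rewrite !mxE.
by case: i => [[|[|//]] ?]; case: j => [[|[|//]] ?]; rewrite /= conjcK.
Qed.

(** At z = (x, y) the Gram matrix gives |x h1 + y h2|^2 and the imaginary part of the adjoint of M
    gives Im <M z, z>; both are real, so the order of R[i] becomes that of R. *)
Lemma form_le_gram h1 h2 c11 c12 c21 c22 :
  form_le (4^-1 *: mx2 (L2norm h1 ^+ 2)%:C (inner h1 h2) (inner h2 h1) (L2norm h2 ^+ 2)%:C)
          (Im_mx (adjmx (mx2 c11 c12 c21 c22))) <->
  forall x y, 4^-1 * n2 (x *: h1 + y *: h2) <=
    imC ((c11 * x + c12 * y)^*%C * x + (c21 * x + c22 * y)^*%C * y).
Proof.
have q4 : (4^-1 : C) = (4^-1)%:C by rewrite rmorphV ?unitfE ?pnatr_eq0// rmorph_nat.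
have lhs x y : (adjmx (cv2 x y) *m (4^-1 *: mx2 (L2norm h1 ^+ 2)%:C (inner h1 h2)
    (inner h2 h1) (L2norm h2 ^+ 2)%:C) *m cv2 x y) 0 0 = (4^-1 * n2 (x *: h1 + y *: h2))%:C.
  rewrite -scalemxAr -scalemxAl mxE mx2_form q4 [RHS]rmorphM; congr (_ * _).
  rewrite !n2E -[RHS]inner_self -!inner_self !innerDr !innerDl !innerZr !innerZl.
  by move: (inner h1 h1) (inner h1 h2) (inner h2 h1) (inner h2 h2) => *; ring.
have rhs x y : (adjmx (cv2 x y) *m Im_mx (adjmx (mx2 c11 c12 c21 c22)) *m cv2 x y) 0 0 =
    (imC ((c11 * x + c12 * y)^*%C * x + (c21 * x + c22 * y)^*%C * y))%:C.
  have i2 : (2 * 'i%C)^-1 = (0 +i* - 2^-1 : C).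
    apply: (mulfI (_ : 2 * 'i%C != 0 :> C)).
      by rewrite mulf_neq0 ?pnatr_eq0// eq_complex/= oner_eq0 andbF.
    rewrite divff; last by rewrite mulf_neq0 ?pnatr_eq0// eq_complex/= oner_eq0 andbF.
    by apply: eqC; rewrite !partsE/=; field.
  set z := (X in imC X); have imE : (imC z)%:C = (0 +i* - 2^-1) * (z - z^*%C).
    by move: z => z; apply: eqC; rewrite !partsE/=; field.
  rewrite imE Im_mx2 mx2_form i2 /z !(conjD, conjM) !conjK; ring.
split => [h x y|h v]; first by rewrite -lecR -lhs -rhs; exact: h.
by have := h (v 0 0) (v 1 0); rewrite -lecR -lhs -rhs -cv2E.
Qed.

End matrices.

(** * The five cases *)

Section cases.
Variable R : realType.
Local Notation C := R[i].
Local Notation L2 := (L2 R).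
Variable V : {linear L2 -> L2}.
Hypotheses (bV : bounded_op V) (V0 : nonneg_op V).
Local Notation W := (op_sqrt V).
Local Notation Vih := (op_invsqrt V).
Local Notation A := (minLaplacian_iV V).
Local Notation bv_op := (bv_op V).
Local Notation form_cond := (form_cond V).
Local Notation defect := (Smax_defect V).
Implicit Types (f g h k : L2) (a x y : C) (T : operator R) (B N : C -> C -> C -> C -> Prop).

Lemma range_op_sqrt0 : range W 0.
Proof. by exists 0 => //; exact: op_sqrt0. Qed.

Lemma invsqrt0 : Vih 0 = 0.
Proof.
have [_] := invsqrt_pair bV V0 0 0 range_op_sqrt0 range_op_sqrt0.
by rewrite !scale0r subrr.
Qed.

Lemma invsqrtN k : range W k -> range W (- k) /\ Vih (- k) = - Vih k.
Proof.
move=> rk; have := invsqrt_pair bV V0 0 1 rk rk.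
by rewrite !scale0r !scale1r !sub0r.
Qed.

Lemma boundary_space_i c11 c12 c21 c22 : boundary_space (@bc_i R c11 c12 c21 c22).
Proof.
split=> [|l x0 x1 y0 y1 x0' x1' y0' y1' [-> ->] [-> ->]]; first by split; rewrite !mulr0 subrr.
by split; ring.
Qed.

Lemma boundary_space_ii c12 c22 : boundary_space (@bc_ii R c12 c22).
Proof.
split=> [|l x0 x1 y0 y1 x0' x1' y0' y1' [h1 h2] [h1' h2']].
  by split; rewrite !mulr0 subrr.
split; last first.
  have -> : l * y0 + y0' - c22 * (l * y1 + y1') = l * (y0 - c22 * y1) + (y0' - c22 * y1') by ring.
  by rewrite h2 h2' mulr0 addr0.
rewrite [RHS]mulrDr [in RHS]mulrCA -h1 -h1'; ring.
Qed.

Lemma boundary_space_iii c11 : boundary_space (@bc_iii R c11).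
Proof.
split=> [|l x0 x1 y0 y1 x0' x1' y0' y1' [-> ->] [-> ->]]; first by split; rewrite ?mulr0.
by split; ring.
Qed.

Lemma boundary_space_iv c12 : boundary_space (@bc_iv R c12).
Proof.
split=> [|l x0 x1 y0 y1 x0' x1' y0' y1' [-> ->] [-> ->]]; first by split; rewrite ?mulr0.
by split; ring.
Qed.

Lemma boundary_space_v : boundary_space (@bc_v R).
Proof.
split=> [|l x0 x1 y0 y1 x0' x1' y0' y1' [-> ->] [-> ->]]; first by split.
by split; ring.
Qed.

Lemma op_eq_ext T T' : (forall f, dom T f <-> dom T' f) ->
  (forall f, act T f = act T' f) -> op_eq T T'.
Proof.
by move=> h1 h2; split; split => [f /h1//|f _]; rewrite h2.
Qed.

Lemma ext_iE c11 c12 c21 c22 k1 k2 :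
  op_eq (ext_i V c11 c12 c21 c22 k1 k2) (bv_op (bc_i c11 c12 c21 c22) k1 k2).
Proof.
apply: op_eq_ext => f; last by rewrite /= -addrA.
split=> [[Hf /cv2_eqP[E0 E1]]|[Hf [E0 E1]]]; split => //.
  by split; rewrite -mulrN.
by apply/cv2_eqP; rewrite !mulrN.
Qed.

Lemma ext_iiE c12 c22 k : op_eq (ext_ii V c12 c22 k) (bv_op (bc_ii c12 c22) 0 (- k)).
Proof.
apply: op_eq_ext => f; last by rewrite /= scaler0 sub0r scalerN opprK.
by split=> [[Hf h1 h2]|[Hf [h1 h2]]].
Qed.

Lemma ext_iiiE c11 k : op_eq (ext_iii V c11 k) (bv_op (bc_iii c11) k 0).
Proof.
apply: op_eq_ext => f; last by rewrite /= scaler0 subr0.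
by split=> [[Hf h1 h2]|[Hf [h1 h2]]].
Qed.

Lemma ext_ivE c12 k : op_eq (ext_iv V c12 k) (bv_op (bc_iv c12) 0 (- k)).
Proof.
apply: op_eq_ext => f; last by rewrite /= scaler0 sub0r scalerN opprK.
by split=> [[Hf h1 h2]|[Hf [h1 h2]]].
Qed.

Lemma ext_vE : op_eq (ext_v V) (bv_op (@bc_v R) 0 0).
Proof.
apply: op_eq_ext => f; last by rewrite /= !scaler0 subr0 addr0.
by split=> [[Hf h1 h2]|[Hf [h1 h2]]].
Qed.

Lemma form_cond_i c11 c12 c21 c22 k1 k2 : range W k1 -> range W k2 ->
  form_le (4^-1 *: mx2 (L2norm (Vih k1) ^+ 2)%:C (inner (Vih k1) (Vih k2))
                       (inner (Vih k2) (Vih k1)) (L2norm (Vih k2) ^+ 2)%:C)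
          (Im_mx (adjmx (mx2 c11 c12 c21 c22))) <->
  form_cond (bc_i c11 c12 c21 c22) k1 k2.
Proof.
move=> r1 r2; apply: iff_trans (form_le_gram _ _ _ _ _ _) _; split.
  move=> h x0 x1 y0 y1 [-> ->]; have := h y0 (- y1).
  by rewrite scaleNr /bform_val !mulrN.
move=> h x y; have := h (c11 * x + c12 * y) (c21 * x + c22 * y) x (- y).
rewrite scaleNr opprK /bform_val mulrN opprK; apply.
by split; rewrite mulrN opprK.
Qed.

(** On these boundary data both sides are |y1|^2 times a constant, so testing at y1 = 1 suffices. *)
Lemma form_cond_ii c12 c22 k : range W k ->
  4^-1 * L2norm (Vih k) ^+ 2 <= imC (c12 * c22^*%C) <->
  form_cond (bc_ii c12 c22) 0 (- k).
Proof.
move=> rk; have [_ kN] := invsqrtN rk.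
have E x0 x1 y0 y1 : bc_ii c12 c22 x0 x1 y0 y1 ->
    bform_val x0 x1 y0 y1 = sqn y1 * imC (c12 * c22^*%C).
  move=> [/eqP + /eqP]; rewrite subr_eq subr_eq0 => /eqP -> /eqP ->.
  by rewrite /bform_val /sqn !partsE/=; ring.
have nE y0 y1 : n2 (y0 *: Vih 0 - y1 *: Vih (- k)) = sqn y1 * n2 (Vih k).
  by rewrite invsqrt0 kN scaler0 sub0r scalerN opprK n2Z.
rewrite n2E; split => [h x0 x1 y0 y1 Bx|h].
  by rewrite nE (E _ _ _ _ Bx) mulrCA ler_wpM2l ?sqn_ge0.
have := h 0 (c22^*%C * c12) c22 1; rewrite nE.
have Bw : bc_ii c12 c22 0 (c22^*%C * c12) c22 1.
  by split; rewrite ?mulr0 ?mulr1 ?subr0 ?subrr.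
have s1 : sqn (1 : C) = 1 by rewrite /sqn !partsE/=; ring.
by rewrite (E _ _ _ _ Bw) s1 !mul1r; exact.
Qed.

Lemma form_cond_iii c11 k : range W k ->
  4^-1 * L2norm (Vih k) ^+ 2 <= imC (c11^*%C) <-> form_cond (bc_iii c11) k 0.
Proof.
move=> rk.
have E x0 x1 y0 y1 : bc_iii c11 x0 x1 y0 y1 ->
    bform_val x0 x1 y0 y1 = sqn y0 * imC (c11^*%C).
  by move=> [-> ->]; rewrite /bform_val /sqn !partsE/=; ring.
have nE y0 y1 : n2 (y0 *: Vih k - y1 *: Vih 0) = sqn y0 * n2 (Vih k).
  by rewrite invsqrt0 scaler0 subr0 n2Z.
rewrite n2E; split => [h x0 x1 y0 y1 Bx|h].
  by rewrite nE (E _ _ _ _ Bx) mulrCA ler_wpM2l ?sqn_ge0.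
have := h c11 0 1 0; rewrite nE.
have Bw : bc_iii c11 c11 0 1 0 by split; rewrite ?mulr1.
have s1 : sqn (1 : C) = 1 by rewrite /sqn !partsE/=; ring.
by rewrite (E _ _ _ _ Bw) s1 !mul1r; exact.
Qed.

Lemma form_cond_iv c12 k : range W k ->
  4^-1 * L2norm (Vih k) ^+ 2 <= imC (c12^*%C) <-> form_cond (bc_iv c12) 0 (- k).
Proof.
move=> rk; have [_ kN] := invsqrtN rk.
have E x0 x1 y0 y1 : bc_iv c12 x0 x1 y0 y1 ->
    bform_val x0 x1 y0 y1 = sqn y1 * imC (c12^*%C).
  by move=> [-> ->]; rewrite /bform_val /sqn !partsE/=; ring.
have nE y0 y1 : n2 (y0 *: Vih 0 - y1 *: Vih (- k)) = sqn y1 * n2 (Vih k).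
  by rewrite invsqrt0 kN scaler0 sub0r scalerN opprK n2Z.
rewrite n2E; split => [h x0 x1 y0 y1 Bx|h].
  by rewrite nE (E _ _ _ _ Bx) mulrCA ler_wpM2l ?sqn_ge0.
have := h 0 (- c12) 0 1; rewrite nE.
have Bw : bc_iv c12 0 (- c12) 0 1 by split; rewrite ?mulr1.
have s1 : sqn (1 : C) = 1 by rewrite /sqn !partsE/=; ring.
by rewrite (E _ _ _ _ Bw) s1 !mul1r; exact.
Qed.

Lemma form_cond_v : form_cond (@bc_v R) 0 0.
Proof.
move=> x0 x1 y0 y1 [-> ->].
by rewrite !scale0r subrr -n2E L2norm0 expr0n mulr0 /bform_val !mulr0 subrr.
Qed.

Lemma in_case_bc (c : ext_case) T : in_case V c T -> bc_case c (boundary_values T).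
Proof.
case: c => /=.
- move=> [c11 [c12 [c21 [c22 [k1 [k2 [_ _ _ TE]]]]]]]; exists c11, c12, c21, c22.
  exact: bv_op_values (op_eq_trans TE (ext_iE _ _ _ _ _ _)).
- move=> [c12 [c22 [k [_ c0 _ TE]]]]; exists c12, c22; split => //.
  exact: bv_op_values (op_eq_trans TE (ext_iiE _ _ _)).
- move=> [c11 [k [_ _ TE]]]; exists c11.
  exact: bv_op_values (op_eq_trans TE (ext_iiiE _ _)).
- move=> [c12 [k [_ _ TE]]]; exists c12.
  exact: bv_op_values (op_eq_trans TE (ext_ivE _ _)).
- by move=> TE; exact: bv_op_values (op_eq_trans TE ext_vE).
Qed.

Lemma in_case_maximal (c : ext_case) T : in_case V c T ->
  maximally_dissipative T /\ extension T A.
Proof.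
case: c => /=.
- move=> [c11 [c12 [c21 [c22 [k1 [k2 [r1 r2 /(form_cond_i _ _ _ _ r1 r2) fc TE]]]]]]].
  apply: (bv_op_maximal bV V0 r1 r2 (boundary_space_i _ _ _ _) fc).
    by move=> N; exact: bc_i_maximal.
  exact: op_eq_trans TE (ext_iE _ _ _ _ _ _).
- move=> [c12 [c22 [k [rk c0 /(form_cond_ii _ _ rk) fc TE]]]]; have [rN _] := invsqrtN rk.
  apply: (bv_op_maximal bV V0 range_op_sqrt0 rN (boundary_space_ii _ _) fc).
    by move=> N; exact: bc_ii_maximal.
  exact: op_eq_trans TE (ext_iiE _ _ _).
- move=> [c11 [k [rk /(form_cond_iii _ rk) fc TE]]].
  apply: (bv_op_maximal bV V0 rk range_op_sqrt0 (boundary_space_iii _) fc).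
    by move=> N; exact: bc_iii_maximal.
  exact: op_eq_trans TE (ext_iiiE _ _).
- move=> [c12 [k [rk /(form_cond_iv _ rk) fc TE]]]; have [rN _] := invsqrtN rk.
  apply: (bv_op_maximal bV V0 range_op_sqrt0 rN (boundary_space_iv _) fc).
    by move=> N; exact: bc_iv_maximal.
  exact: op_eq_trans TE (ext_ivE _ _).
- move=> TE.
  apply: (bv_op_maximal bV V0 range_op_sqrt0 range_op_sqrt0 boundary_space_v form_cond_v).
    by move=> N _; exact: bc_v_maximal.
  exact: op_eq_trans TE ext_vE.
Qed.

(** The vectors [k] are defects of members of dom T with normalised derivatives at the end points;
    [defect_neumann_cmb] then determines every other defect. *)
Lemma bc_case_in (c : ext_case) T : dissipative T -> extension T A ->
  bc_case c (boundary_values T) -> in_case V c T.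
Proof.
move=> dT TA.
have rT f : dom T f -> range W (defect T f).
  by move=> Tf; have [] := dissipative_struct bV V0 dT TA Tf.
have vT f : dom T f -> boundary_values T (b0 f) (b1 f) (d0 f) (d1 f).
  by move=> Tf; have [Hf _ _] := dissipative_struct bV V0 dT TA Tf; exists f.
case: c => /=.
- move=> [c11 [c12 [c21 [c22 TB]]]].
  have [|f1 Tf1 [_ _ _ E10 E11]] := TB.2 c11 c21 1 0; first by split; ring.
  (* The value -1 of f'(1) makes - f'(1) equal to 1, the second coordinate of case i. *)
  have [|f2 Tf2 [_ _ _ E20 E21]] := TB.2 c12 c22 0 (- 1); first by split; ring.
  have r1 := rT _ Tf1; have r2 := rT _ Tf2.
  have TE : op_eq T (bv_op (bc_i c11 c12 c21 c22) (defect T f1) (defect T f2)).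
    apply: (bv_op_intro bV V0 dT TA TB) => f Tf; rewrite -scaleNr.
    apply: (defect_neumann_cmb bV V0 dT TA Tf Tf1 Tf2).
      by rewrite E10 E20 mulr1 mulr0 addr0.
    by rewrite E11 E21 mulr0 mulrNN mulr1 add0r.
  exists c11, c12, c21, c22, (defect T f1), (defect T f2).
  have fc := (form_cond_i _ _ _ _ r1 r2).2 (form_condP bV V0 dT TA r1 r2 TE).
  exact: And4 r1 r2 fc (op_eq_trans TE (op_eq_sym (ext_iE _ _ _ _ _ _))).
- move=> [c12 [c22 [c0 TB]]].
  have [|w Tw [_ _ _ E0 E1]] := TB.2 0 (c22^*%C * c12) c22 1.
    by split; rewrite ?mulr0 ?mulr1 ?subr0 ?subrr.
  have r1 := rT _ Tw; have [rN _] := invsqrtN r1.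
  have TE : op_eq T (bv_op (bc_ii c12 c22) 0 (- defect T w)).
    apply: (bv_op_intro bV V0 dT TA TB) => f Tf; rewrite scaler0 sub0r scalerN opprK.
    have [_ /eqP] := TB.1 _ _ _ _ (vT _ Tf); rewrite subr_eq0 => /eqP E.
    (* A second term with coefficient 0 is added because [defect_neumann_cmb] takes two members. *)
    rewrite -[RHS]addr0 -[X in _ + X](scale0r (defect T w)).
    apply: (defect_neumann_cmb bV V0 dT TA Tf Tw Tw); rewrite mul0r addr0.
      by rewrite E0 E mulrC.
    by rewrite E1 mulr1.
  exists c12, c22, (defect T w).
  have fc := (form_cond_ii _ _ r1).2 (form_condP bV V0 dT TA range_op_sqrt0 rN TE).
  exact: And4 r1 c0 fc (op_eq_trans TE (op_eq_sym (ext_iiE _ _ _))).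
- move=> [c11 TB].
  have [|w Tw [_ _ _ E0 E1]] := TB.2 c11 0 1 0; first by split; rewrite ?mulr1.
  have r1 := rT _ Tw.
  have TE : op_eq T (bv_op (bc_iii c11) (defect T w) 0).
    apply: (bv_op_intro bV V0 dT TA TB) => f Tf; rewrite scaler0 subr0.
    have [_ E] := TB.1 _ _ _ _ (vT _ Tf).
    rewrite -[RHS]addr0 -[X in _ + X](scale0r (defect T w)).
    apply: (defect_neumann_cmb bV V0 dT TA Tf Tw Tw); rewrite mul0r addr0.
      by rewrite E0 mulr1.
    by rewrite E1 E mulr0.
  exists c11, (defect T w).
  have fc := (form_cond_iii _ r1).2 (form_condP bV V0 dT TA r1 range_op_sqrt0 TE).
  exact: And3 r1 fc (op_eq_trans TE (op_eq_sym (ext_iiiE _ _))).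
- move=> [c12 TB].
  have [|w Tw [_ _ _ E0 E1]] := TB.2 0 (- c12) 0 1; first by split; rewrite ?mulr1.
  have r1 := rT _ Tw; have [rN _] := invsqrtN r1.
  have TE : op_eq T (bv_op (bc_iv c12) 0 (- defect T w)).
    apply: (bv_op_intro bV V0 dT TA TB) => f Tf; rewrite scaler0 sub0r scalerN opprK.
    have [_ E] := TB.1 _ _ _ _ (vT _ Tf).
    rewrite -[RHS]addr0 -[X in _ + X](scale0r (defect T w)).
    apply: (defect_neumann_cmb bV V0 dT TA Tf Tw Tw); rewrite mul0r addr0.
      by rewrite E0 E mulr0.
    by rewrite E1 mulr1.
  exists c12, (defect T w).
  have fc := (form_cond_iv _ r1).2 (form_condP bV V0 dT TA range_op_sqrt0 rN TE).
  exact: And3 r1 fc (op_eq_trans TE (op_eq_sym (ext_ivE _ _))).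
- move=> TB; apply: op_eq_trans (op_eq_sym ext_vE).
  apply: (bv_op_intro bV V0 dT TA TB) => f Tf; rewrite !scaler0 subrr.
  have [E0 E1] := TB.1 _ _ _ _ (vT _ Tf).
  exact: (neumann_defect bV V0 dT TA Tf E0 E1).
Qed.

End cases.

Theorem theorem3p5 (R : realType) (V : {linear L2 R -> L2 R}) :
  bounded_op V -> nonneg_op V ->
  (forall Ahat : operator R,
     maximally_dissipative Ahat -> extension Ahat (minLaplacian_iV V) ->
     exists! c : ext_case, in_case V c Ahat) /\
  (forall (c : ext_case) (Ahat : operator R), in_case V c Ahat ->
     maximally_dissipative Ahat /\ extension Ahat (minLaplacian_iV V)).
Proof.
move=> bV V0; split; last by move=> c Ahat; exact: in_case_maximal.
move=> Ahat mA AA; have dA := mA.1; have [linA _ _] := dA.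
have [c hc] := transversal_case (boundary_values_space linA)
  (boundary_values_isotropic bV V0 dA AA) (boundary_values_transversal bV V0 mA AA).
exists c; split; first exact: bc_case_in.
by move=> c' /in_case_bc; exact: bc_case_unique hc.
Qed.
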